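(* Let $\mathcal{G}=(V,\sigma,E)$ be a signed colored graph of shifted degree $n$. Then $\mathcal G$ is a shifted dual equivalence graph if and only if the following two local properties hold. (1) For every interval of integers $I\subseteq[n]$ with $|I|\le 9$, each component of $\mathcal{G}|_I$ is isomorphic to the standard shifted dual equivalence graph $\mathcal{SG}_\lambda$ of a shifted shape $\lambda$ of size up to $|I|$. (2) If $i,j\in\mathbb{N}$ with $|i-j|>3$, $(u,v)\in E_i$ and $(u,w)\in E_j$, then there exists a vertex $y\in V$ such that $(v,y)\in E_j$ and $(w,y)\in E_i$.
   Context: Shifted tableaux. For a strict partition $\lambda=(\lambda_1>\dots>\lambda_k>0)$ of $n$ the shifted shape is $\{(i,j):1\le i\le k,\ i\le j\le\lambda_i+i-1\}$ (row $i$, column $j$; French notation, row 1 at the bottom). A standard shifted tableau is a bijective filling by $1,\dots,n$ increasing along rows and columns; $SST(\lambda)$ is the set of them. The row reading word reads rows left to right, from top row to bottom row. $j$ is a peak of $T$ if $j$ appears after both $j-1$ and $j+1$ in the row reading word ($1<j<n$). Shifted dual equivalence. On permutations of $\{1,2,3,4\}$, $h_1$ swaps $x$ and $y$ in words of the forms $1x2y,\ x12y,\ 1x4y,\ x14y,\ 4x1y,\ x41y,\ 4x3y,\ x43y$, and fixes all others. On permutations of $[n]$, $h_i$ ($1\le i\le n-3$) fixes the values outside $\{i,\dots,i+3\}$ and acts on the subword of values $i,\dots,i+3$ as $h_1$ does after subtracting $i-1$. $h_i$ acts on standard shifted tableaux through the row reading word. The standard shifted dual equivalence graph $\mathcal{SG}_\lambda$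 has vertex set $SST(\lambda)$, signature the peak set, and $i$-edges $\{T,h_i(T)\}$ with $h_i(T)\ne T$, $1\le i\le n-3$. Graphs. A signed colored graph of shifted degree $n$ is $\mathcal G=(V,\sigma,E)$ with finite $V$, for each $i\in\{1,\dots,n-3\}$ a set $E_i$ of unordered pairs of distinct vertices ($i$-edges), and $\sigma(v)\subseteq[n]$ containing neither $1$ nor $n$ nor two consecutive integers. A morphism is a map of vertices preserving $\sigma$ and mapping $E_i$ into $E'_i$ for all $i$; an isomorphism is a bijective morphism whose inverse is a morphism. A shifted dual equivalence graph is a signed colored graph isomorphic to a disjoint union of graphs $\mathcal{SG}_\lambda$. For an interval $I=[a,b]\subseteq[n]$, the restriction $\mathcal G|_I$ is the signed colored graph of shifted degree $|I|$ with the same vertex set $V$, signature $\sigma'(v)=\{s-a+1: s\in\sigma(v),\ a<s<b\}$, and edge sets $E'_i=E_{a+i-1}$ for $1\le i\le|I|-3$. Components are connected components. *)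

(* Defs.v *)
From mathcomp Require Import all_boot.

Set Implicit Arguments.
Unset Strict Implicit.
Unset Printing Implicit Defensive.

(** Sets of positive integers are boolean predicates on [nat], compared
    extensionally; integers such as [i], [j] and [n] are 1-based. *)

Record scgraph (n : nat) := SCGraph {
  vert :> finType;
  signature : vert -> pred nat;
  edge : nat -> rel vert;
  sig_bounds : forall v s, signature v s -> 1 < s < n;
  sig_nonconsec : forall v s, signature v s -> ~~ signature v s.+1;
  edge_color : forall i u v, edge i u v -> 1 <= i <= n - 3;
  edge_irr : forall i u, ~~ edge i u u;
  edge_sym : forall i u v, edge i u v -> edge i v u
}.

Definition is_morphism n (G H : scgraph n) (f : G -> H) : Prop :=
  (forall v, signature (f v) =1 signature v)
  /\ (forall i u v, edge i u v -> edge i (f u) (f v)).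

Definition isomorphic n (G H : scgraph n) : Prop :=
  exists (f : G -> H) (g : H -> G),
    [/\ cancel f g, cancel g f, is_morphism f & is_morphism g].

(** Morphisms only exist between graphs of the same shifted degree; this
    states isomorphism when the equality of degrees is not definitional. *)
Definition isomorphic_deg n m (G : scgraph n) (H : scgraph m) : Prop :=
  exists e : m = n, isomorphic G (eq_rect m scgraph H n e).

Section Restriction.
Variables (n : nat) (G : scgraph n) (a b : nat).

(* [b.+1 - a] is the cardinality of [[a, b]].  For [1 <= a], writing
   [s = a + t - 1], the condition [a < s < b] is [1 < t < b.+1 - a]. *)
Definition restrict_sig (v : G) : pred nat :=
  fun t => (1 < t < b.+1 - a) && signature v (a + t - 1).

Definition restrict_edge (i : nat) : rel G :=
  fun u v => (1 <= i <= (b.+1 - a) - 3) && edge (a + i - 1) u v.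

Fact restrict_bounds v s : restrict_sig v s -> 1 < s < b.+1 - a.
Proof. by case/andP. Qed.

Fact restrict_nonconsec v s : restrict_sig v s -> ~~ restrict_sig v s.+1.
Proof.
case/andP=> /andP[s1 _] /sig_nonconsec; apply: contra => /andP[_].
by rewrite addnS subSS subn0 -subSn ?subSS ?subn0 // addn_gt0 (ltnW s1) orbT.
Qed.

Fact restrict_color i u v : restrict_edge i u v -> 1 <= i <= (b.+1 - a) - 3.
Proof. by case/andP. Qed.

Fact restrict_irr i u : ~~ restrict_edge i u u.
Proof. by rewrite negb_and edge_irr orbT. Qed.

Fact restrict_sym i u v : restrict_edge i u v -> restrict_edge i v u.
Proof. by case/andP=> Hi /edge_sym e; apply/andP. Qed.

Definition restrict : scgraph (b.+1 - a) :=
  SCGraph restrict_bounds restrict_nonconsec restrict_color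
          restrict_irr restrict_sym.

End Restriction.

Section Component.
Variables (n : nat) (G : scgraph n) (v0 : G).

Definition adjacent : rel G :=
  fun u v => has (fun i => edge i u v) (iota 1 (n - 3)).

Definition component_vert : finType := {v : G | connect adjacent v0 v}.

Definition component_sig (v : component_vert) : pred nat := signature (val v).

Definition component_edge (i : nat) : rel component_vert :=
  fun u v => edge i (val u) (val v).

Fact component_bounds v s : component_sig v s -> 1 < s < n.
Proof. exact: sig_bounds. Qed.

Fact component_nonconsec v s : component_sig v s -> ~~ component_sig v s.+1.
Proof. exact: sig_nonconsec. Qed.

Fact component_color i u v : component_edge i u v -> 1 <= i <= n - 3.
Proof. exact: edge_color. Qed.

Fact component_irr i u : ~~ component_edge i u u.
Proof. exact: edge_irr. Qed.

Fact component_sym i u v : component_edge i u v -> component_edge i v u.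
Proof. exact: edge_sym. Qed.

Definition component : scgraph n :=
  SCGraph component_bounds component_nonconsec component_color
          component_irr component_sym.

End Component.

Section DisjointUnion.
Variables (n : nat) (J : finType) (F : J -> scgraph n).

Definition union_vert : finType := {j : J & F j}.

Definition union_sig (v : union_vert) : pred nat := signature (tagged v).

(* [tagged_as u v] is [tagged v] transported to the summand of [u]. *)
Definition union_edge (i : nat) : rel union_vert :=
  fun u v => (tag u == tag v) && edge i (tagged u) (tagged_as u v).

Fact union_bounds v s : union_sig v s -> 1 < s < n.
Proof. exact: sig_bounds. Qed.

Fact union_nonconsec v s : union_sig v s -> ~~ union_sig v s.+1.
Proof. exact: sig_nonconsec. Qed.

Fact union_color i u v : union_edge i u v -> 1 <= i <= n - 3.
Proof. by case/andP=> _; apply: edge_color. Qed.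

Fact union_irr i u : ~~ union_edge i u u.
Proof. by case: u => j x; rewrite /union_edge tagged_asE eqxx edge_irr. Qed.

Fact union_sym i u v : union_edge i u v -> union_edge i v u.
Proof.
case: u v => [j x] [k y] /andP[/eqP /= jk]; subst k.
by rewrite /union_edge !tagged_asE eqxx => /edge_sym.
Qed.

Definition disjoint_union : scgraph n :=
  SCGraph union_bounds union_nonconsec union_color union_irr union_sym.

End DisjointUnion.

(** Strict partitions of [n], as strictly decreasing lists of positive parts. *)
Record strict_part (n : nat) := StrictPart {
  parts :> seq nat;
  parts_decr : sorted gtn parts;
  parts_pos : all (leq 1) parts;
  parts_sum : sumn parts = n
}.

Section StandardGraph.
Variables (n : nat) (lam : strict_part n).

(** Rows and columns are 0-based: [(i, j)] is the cell in row [i.+1] and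
    column [j.+1].  Since the parts strictly decrease and sum to [n], the whole
    shifted shape fits in this [n * n] box. *)
Definition shifted_shape : {set 'I_n * 'I_n} :=
  [set c : 'I_n * 'I_n | c.1 <= c.2 < nth 0 lam c.1 + c.1].

(** A filling carries the dummy value [0] off the shape, so that equal fillings
    of the shape are equal functions. *)
Definition standard (T : {ffun 'I_n * 'I_n -> 'I_n.+1}) : bool :=
  [&& [forall c, (0 < T c) == (c \in shifted_shape)],
      [forall k : 'I_n.+1, (0 < k) ==>
         (#|[set c in shifted_shape | T c == k]| == 1)],
      [forall c in shifted_shape, forall d in shifted_shape,
         (c.1 == d.1) && (c.2 < d.2) ==> (T c < T d)]
    & [forall c in shifted_shape, forall d in shifted_shape,
         (c.2 == d.2) && (c.1 < d.1) ==> (T c < T d)]].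

Definition SST : finType := {T : {ffun 'I_n * 'I_n -> 'I_n.+1} | standard T}.

Definition reading_word (T : SST) : seq nat :=
  [seq nat_of_ord (val T c)
     | c <- [seq (i, j) | i <- rev (enum 'I_n), j <- enum 'I_n]
     & c \in shifted_shape].

Definition after (w : seq nat) (x y : nat) : bool := index y w < index x w.

Definition peak (T : SST) : pred nat :=
  fun j => [&& 1 < j < n, after (reading_word T) j j.-1
             & after (reading_word T) j j.+1].

(** The eight forms are [p x q y] and [x p q y] with [(p, q)] one of
    [(1, 2)], [(1, 4)], [(4, 1)], [(4, 3)]; both never hold at once. *)
Definition h1 (w : seq nat) : seq nat :=
  let pq := [:: (1, 2); (1, 4); (4, 1); (4, 3)] in
  if w is [:: a; b; c; d] then
    if (a, c) \in pq then [:: a; d; c; b]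
    else if (b, c) \in pq then [:: d; b; c; a]
    else w
  else w.

(** The subword [s] of the values in [[i, i + 3]] is replaced, position by
    position, by its image [s'] (the entries of [w] are distinct). *)
Definition h (i : nat) (w : seq nat) : seq nat :=
  let s := [seq x <- w | i <= x <= i + 3] in
  let s' := [seq x + (i - 1) | x <- h1 [seq x - (i - 1) | x <- s]] in
  [seq if x \in s then nth 0 s' (index x s) else x | x <- w].

(** [standard_edge i T U] says that [{T, U}] is [{T, h_i(T)}] or [{U, h_i(U)}];
    a tableau of given shape is determined by its reading word. *)
Definition standard_edge (i : nat) : rel SST :=
  fun T U => [&& 1 <= i <= n - 3, T != U
    & (reading_word U == h i (reading_word T))
      || (reading_word T == h i (reading_word U))].

Fact peak_bounds T j : peak T j -> 1 < j < n.
Proof. by case/and3P. Qed.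

Fact peak_nonconsec T j : peak T j -> ~~ peak T j.+1.
Proof.
by case/and3P=> _ _ jS; apply/and3P=> -[_ /(ltn_trans jS)]; rewrite ltnn.
Qed.

Fact standard_color i T U : standard_edge i T U -> 1 <= i <= n - 3.
Proof. by case/and3P. Qed.

Fact standard_irr i T : ~~ standard_edge i T T.
Proof. by rewrite /standard_edge eqxx andbF. Qed.

Fact standard_sym i T U : standard_edge i T U -> standard_edge i U T.
Proof. by case/and3P=> Hi TU e; apply/and3P; rewrite eq_sym orbC. Qed.

Definition standard_graph : scgraph n :=
  SCGraph peak_bounds peak_nonconsec standard_color
          standard_irr standard_sym.

End StandardGraph.

Definition is_sdeg n (G : scgraph n) : Prop :=
  exists (J : finType) (lam : J -> strict_part n),
    isomorphic G (disjoint_union (fun j => standard_graph (lam j))).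

(* Main.v *)
Require Import Defs.
From mathcomp Require Import all_boot.
From mathcomp Require Import zify.
From Stdlib Require Import FunctionalExtensionality Classical.

Set Implicit Arguments.
Unset Strict Implicit.
Unset Printing Implicit Defensive.

(** Restricting a standard shifted tableau to an interval of entries and rectifying it
    commutes with peaks and with all [h_i], so a shifted dual equivalence graph
    restricts to such graphs; the commutation property is immediate.

    Conversely, say that a graph is labeled when its vertices carry tableaux in a way
    compatible with signatures and edges, faithfully if the label determines the
    vertex inside its component. By induction, the restrictions to [1, n - 1] and to
    [2, n] are faithfully labeled by maps [f] and [g] with [n >= 10]. The peak at
    [n - 1], seen by [g], determines where the cell [n] must be added to [f v], since
    all tableaux of the shape of [f v] occur in the component of [v]; this gives a
    label [T v] of size [n]. Only the edges of the top color [n - 3] remain to be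
    checked. One that fixes the entry [n] can be moved, by commutation with the
    low colors, to a place where it is a path of edges seen by [g]. For one that
    exchanges [n - 1] and [n], the other end is known after rectification, and
    the ambiguity left in one rectification is removed by varying the tableau on the
    smaller entries. Finally [T] is faithful: crossings exchanging given corners lead
    from a component of [1, n - 1] to a single component, and three corners
    give three components linked in a triangle, by a closed loop of edges within the
    last nine entries. *)

(** For an edge of the top color from [v] to [w], [g] gives only that [T w] and the hop of [T v]
    have the same rectification. Tableaux of the same shape with the same rectification are equal
    ([demote_inj]), so the difficulty is to find the shape at the other end. This is why the
    components of [[1, n - 1]], on which the shape of the label is constant, are followed along the
    edges.

    The bound 9 enters twice. If the rectification were ambiguous at an exchange of [n - 1] and [n],
    it would be so for every arrangement of the entries [1, ..., n - 4], and the vacated corner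
    would always be the same; this happens only for at most five such entries (rows of lengths 3 and
    2), whereas [n >= 10] leaves six. The loop joining three corners occupies the last nine entries
    and may not move the entry 1, since [g] has to see it; this again asks for ten entries. *)

Ltac clia := clear; lia.

(** * Words of rows and slides *)

(* A shape is the function [t] giving the length of each row, rows being numbered
   from 0; a standard tableau is the word [w] of the rows of its successive entries,
   and [admf t w] says that these cells may be added one by one to [t]. *)
Definition inc (t : nat -> nat) (r : nat) : nat -> nat := fun s => t s + (s == r).
Definition addable (t : nat -> nat) (r : nat) : bool := (r == 0) || (t r + 1 < t r.-1).
Definition removable (t : nat -> nat) (r : nat) : bool :=
  (0 < t r) && ((t r.+1 == 0) || (t r.+1 + 1 < t r)).
Definition strict (t : nat -> nat) : Prop := forall r, t r.+1 = 0 \/ t r.+1 < t r.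

Fixpoint admf (t : nat -> nat) (w : seq nat) : bool :=
  if w is r :: w' then addable t r && admf (inc t r) w' else true.

(* [h_1] on the rows of four consecutive entries: entry [i] precedes entry [j > i]
   in the reading word exactly when its row is at least that of [j]. *)
Definition hop4 (a b c d : nat) : seq nat :=
  if (b <= a) && (minn c d <= b < maxn c d) then [:: a; b; d; c]
  else if [&& minn b c <= a, minn b c < d & (a < maxn b c) || (d <= maxn b c)]
  then [:: a; c; b; d]
  else if (minn a b < c <= maxn a b) && (c < d) then [:: b; a; c; d]
  else [:: a; b; c; d].

(* A jeu de taquin slide into the hole at the end of row [h] of [t]: the new word and
   the row where the hole ends. *)
Fixpoint slide (t : nat -> nat) (h : nat) (w : seq nat) : seq nat * nat :=
  if w is r :: w' then
    if (r != h) && addable t r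
    then let p := slide (inc t r) h w' in (r :: p.1, p.2)
    else let p := slide (inc t h) r w' in (h :: p.1, p.2)
  else ([::], h).

Lemma incC t r s : inc (inc t r) s = inc (inc t s) r.
Proof. by apply: functional_extensionality => x; rewrite /inc addnAC. Qed.

Lemma strict_inc t r : strict t -> addable t r -> strict (inc t r).
Proof.
move=> St A s; move: A; rewrite /addable /inc; have := St s.
case: (eqVneq s.+1 r) => [E|_]; case: (eqVneq s r) => [E'|_] //=; rewrite -?E -?E' /=; lia.
Qed.

(** The entry drawn into the hole is its right neighbour, in row [h], or its upper neighbour, in row
    [h.+1]. Each row starts one column further right than the row below, so the latter stands in the
    column of the hole exactly when [t h == (t h.+1).+1]. *)
Lemma slide_rule t h r : strict t -> addable t h -> addable (inc t h) r ->
  (r != h) && addable t r = ~~ ((r == h) || (r == h.+1) && (t h == (t h.+1).+1)).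
Proof.
move=> St; rewrite /addable /inc.
case: (eqVneq r h) => [->|nrh] //= A.
case: (eqVneq r h.+1) => [->|nrh1] /=; first by have := St h; rewrite eqxx; lia.
by case: (eqVneq r.-1 h) => E; lia.
Qed.

Lemma slide_step t h r (p := if (r != h) && addable t r then (r, h) else (h, r)) :
  strict t -> addable t h -> addable (inc t h) r ->
  [/\ addable t p.1, addable (inc t p.1) p.2 & inc (inc t p.1) p.2 = inc (inc t h) r].
Proof.
move=> St Ah Ar; rewrite /p; case: ifP => /= [/andP[nrh Art]|_]; last by [].
split=> //; last exact: incC.
move: Ah; rewrite /addable /inc; case: (eqVneq h r) nrh => // _ _; lia.
Qed.

Definition hop4s (s : seq nat) : seq nat :=
  if s is [:: a; b; c; d] then hop4 a b c d else s.

Definition good t h w := [/\ strict t, addable t h & admf (inc t h) w].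

(* The side conditions record the rows next to the hole, which is what the case
   analysis of [slide_hop4_12] and its companions needs. *)
Variant slide_view t h r w : seq nat * nat -> Prop :=
| SlideRight u of r = h & u = inc t h & h = 0 \/ (t h).+2 < t h.-1 &
    u h = (t h).+1 & u h.+1 = t h.+1 & u h.+2 = t h.+2 & good u h w :
    slide_view t h r w (h :: (slide u h w).1, (slide u h w).2)
| SlideUp u of r = h.+1 & u = inc t h & t h = (t h.+1).+1 &
    u h = (t h).+1 & u h.+1 = t h.+1 & u h.+2 = t h.+2 & good u h.+1 w :
    slide_view t h r w (h :: (slide u h.+1 w).1, (slide u h.+1 w).2)
| SlideNear u of r = h.+1 & u = inc t h.+1 & (t h.+1).+1 < t h &
    u h = t h & u h.+1 = (t h.+1).+1 & u h.+2 = t h.+2 & good u h w :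
    slide_view t h r w (h.+1 :: (slide u h w).1, (slide u h w).2)
| SlideBelow u of r < h & u = inc t r &
    u h = t h & u h.+1 = t h.+1 & u h.+2 = t h.+2 & good u h w :
    slide_view t h r w (r :: (slide u h w).1, (slide u h w).2)
| SlideAbove u of h.+1 < r & u h.+2 < t h.+1 & u = inc t r &
    u h = t h & u h.+1 = t h.+1 & u h.+2 = t h.+2 + (h.+2 == r) & good u h w :
    slide_view t h r w (r :: (slide u h w).1, (slide u h w).2).

Lemma strict_gt0 t r s : strict t -> s <= r -> 0 < t r -> 0 < t s.
Proof.
move=> St; elim: r => [|r IH]; first by case: s.
rewrite leq_eqVlt => /orP[/eqP -> //|]; rewrite ltnS => /IH {}IH H.
by apply: IH; case: (St r); lia.
Qed.

Lemma slideP t h r w : good t h (r :: w) -> slide_view t h r w (slide t h (r :: w)).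
Proof.
case=> St Ah /= /andP[Ar Aw].
have := slide_step St Ah Ar; rewrite (slide_rule St Ah Ar).
have i1 : inc t h h = (t h).+1 by rewrite /inc eqxx addn1.
have i2 x y : x <> y -> inc t x y = t y by rewrite /inc; case: eqP => [<-|]; rewrite ?addn0.
case: (eqVneq r h) => [E|/eqP nrh] /=.
  subst r; case=> ? ? ?; apply: SlideRight => //; [|apply: i2; lia|apply: i2; lia|split=> //; exact: strict_inc].
  case: (eqVneq h 0) => [h0|nh0]; [by left|right; move: Ar; rewrite /addable i1 (i2 h h.-1); lia].
case Eb: (_ && _) => /= -[A1 A2 A3].
  case/andP: Eb => /eqP E /eqP T; subst r.
  by apply: SlideUp => //; first [apply: i2; lia|split=> //; apply: strict_inc].
case: (eqVneq r h.+1) Eb => [E /= /eqP T|/eqP nrh1 _]; last first.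
  have G : good (inc t r) h w by split=> //; [apply: strict_inc|rewrite A3].
  case: (ltnP r h) => hr; first by apply: SlideBelow => //; apply: i2; lia.
  apply: SlideAbove => //; try (apply: i2); try lia.
  have := strict_inc St A1 h.+1; rewrite (i2 r h.+1); last by lia.
  have : 0 < t h.+1; last by lia.
  apply: (@strict_gt0 _ r.-1) => //; first by lia.
  by move: A1; rewrite /addable; lia.
subst r; apply: SlideNear => //; first [by apply: i2; lia|by rewrite /inc eqxx addn1|idtac].
  by have := strict_inc St A1 h; rewrite /inc eqxx; case: eqP; lia.
by split=> //; [apply: strict_inc|rewrite A3].
Qed.

(** The suffixes are the pairs [(p, q)] of the forms in [h1]: with 1 and 2 the entries 3 and 4 are
    exchanged, with 1 and 4 the entries 2 and 3, with 4 and 3 the entries 1 and 2. *)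
Lemma hop4_12 a b c d : b <= a -> d <= b < c \/ c <= b < d -> hop4 a b c d = [:: a; b; d; c].
Proof. by rewrite /hop4; move=> *; case: ifP => //; lia. Qed.

Lemma hop4_14 a b c d : b < c /\ b <= a /\ b < d /\ (a < c \/ d <= c) \/
  c < b /\ c <= a /\ c < d /\ (a < b \/ d <= b) -> hop4 a b c d = [:: a; c; b; d].
Proof. by rewrite /hop4; move=> *; case: ifP; [lia|move=> _; case: ifP => //; lia]. Qed.

Lemma hop4_43 a b c d : c < d -> a < c <= b \/ b < c <= a -> hop4 a b c d = [:: b; a; c; d].
Proof.
by rewrite /hop4; move=> *; case: ifP; [lia|move=> _; case: ifP; [lia|move=> _; case: ifP => //; lia]].
Qed.

Ltac sgo G := case: (slideP G) => [? ? ? ? ? ? ? {}G|? ? ? ? ? ? ? {}G|? ? ? ? ? ? ? {}G|? ? ? ? ? ? {}G|? ? ? ? ? ? ? {}G]; subst; cbn [predn] in *.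
Ltac prune := try (exfalso; lia).
Ltac leaf := first [ done | rewrite /hop4s /=;
  first [rewrite hop4_12; [done|lia|lia] | rewrite hop4_14; [done|lia] | rewrite hop4_43; [done|lia|lia]] | idtac].

(** The two slides run side by side, with five cases per letter, and [lia] discards the incompatible
    combinations. The slid words may be exchanged by another of the three kinds, so [leaf] tries
    them all. *)
Lemma slide_hop4_12 t h a b c d : good t h [:: a; b; c; d] -> good t h [:: a; b; d; c] ->
  b <= a -> d <= b < c ->
  slide t h [:: a; b; d; c] =
    (hop4s (slide t h [:: a; b; c; d]).1, (slide t h [:: a; b; c; d]).2).
Proof.
move=> G1 G2 ba /andP[db bc].
have [St _ _] := G1; have S1 := St h.+1.
sgo G1; sgo G2; prune.
all: sgo G1; prune.
all: sgo G2; prune.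
all: sgo G1; prune.
all: sgo G2; prune.
all: sgo G1; prune.
all: sgo G2; prune.
all: leaf.
all: have S0 := St h; have S2 := St h.+2; prune.
Qed.

Lemma slide_hop4_14 t h a b c d : good t h [:: a; b; c; d] -> good t h [:: a; c; b; d] ->
  b <= a -> b < d -> b < c -> a < c \/ d <= c ->
  slide t h [:: a; c; b; d] =
    (hop4s (slide t h [:: a; b; c; d]).1, (slide t h [:: a; b; c; d]).2).
Proof.
move=> G1 G2 ba bd bc acd.
have [St _ _] := G1; have S1 := St h.+1.
sgo G1; sgo G2; prune.
all: sgo G1; prune.
all: sgo G2; prune.
all: sgo G1; prune.
all: sgo G2; prune.
all: sgo G1; prune.
all: sgo G2; prune.
all: leaf.
all: have S0 := St h; have S2 := St h.+2; prune.
Qed.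

Lemma slide_hop4_43 t h a b c d : good t h [:: a; b; c; d] -> good t h [:: b; a; c; d] ->
  c < d -> a < c <= b ->
  slide t h [:: b; a; c; d] =
    (hop4s (slide t h [:: a; b; c; d]).1, (slide t h [:: a; b; c; d]).2).
Proof.
move=> G1 G2 cd /andP[ac cb].
have [St _ _] := G1; have S1 := St h.+1.
sgo G1; sgo G2; prune.
all: sgo G1; prune.
all: sgo G2; prune.
all: sgo G1; prune.
all: sgo G2; prune.
all: sgo G1; prune.
all: sgo G2; prune.
all: leaf.
all: have S0 := St h; have S2 := St h.+2; prune.
all: by exfalso; unfold inc in *; lia.
Qed.

Lemma incE t r : inc t r r = (t r).+1.
Proof. by rewrite /inc eqxx addn1. Qed.

Lemma inc_neq t r s : r <> s -> inc t r s = t s.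
Proof. by rewrite /inc; case: (eqVneq s r) => [->|]; rewrite ?addn0. Qed.

Lemma inc_le t r s : t s <= inc t r s.
Proof. exact: leq_addr. Qed.

Lemma addable_swap (t : nat -> nat) (x y : nat) : x <> y -> addable t x -> addable (inc t x) y ->
  ~ (y = x.+1 /\ t x = (t y).+1) -> addable t y && addable (inc t y) x.
Proof.
move=> nxy Ax Ay N; apply/andP; split; last first.
  by move: Ax; rewrite /addable (inc_neq t (not_eq_sym nxy)) /inc; lia.
move: Ay; rewrite /addable (inc_neq t nxy) => /orP[->//|].
case: (eqVneq y.-1 x) => [E|/eqP nE]; last by rewrite inc_neq; [move=> ->; rewrite orbT|lia].
rewrite E incE => H; have Ey : y = x.+1 by clear -E nxy; lia.
apply/orP; right; case: (ltnP (t y + 1) (t x)) => // H2.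
by case: N; split=> //; clear -H H2; lia.
Qed.

(* A swap breaks admissibility only if the second letter sits right above the
   first one; the pattern of [hop4] forbids this. *)
Lemma adm_hop4 t a b c d : strict t -> admf t [:: a; b; c; d] -> admf t (hop4 a b c d).
Proof.
move=> St /= /and5P[Aa Ab Ac Ad _].
have S1 := strict_inc St Aa; have S2 := strict_inc S1 Ab.
have S3 := strict_inc S2 Ac.
have pos u r s : strict u -> addable u r -> s < r -> 0 < u s.
  move=> Su Ar sr; apply: (@strict_gt0 _ r.-1) => //; first by lia.
  by move: Ar; rewrite /addable; lia.
rewrite /hop4; case: ifPn => [/andP[ba H]|H1].
  have ncd : c <> d by lia.
  rewrite /= Aa Ab /=; suff N : ~ (d = c.+1 /\ inc (inc t a) b c = (inc (inc t a) b d).+1).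
    by case/andP: (addable_swap ncd Ac Ad N) => -> ->.
  case=> E T.
  have bc : b = c by lia.
  subst b d; have : 0 < inc t a c.
    case: (eqVneq a c) => [->|nac]; first by rewrite incE.
    by apply: leq_trans (inc_le _ _ _); apply: pos St Aa _; lia.
  by have := S1 c; move: T; rewrite incE [inc (inc _ _) _ c.+1]inc_neq; lia.
case: ifPn => [/and3P[H2 H3 H4]|H2].
  have nbc : b <> c by lia.
  rewrite /= Aa /=; have N : ~ (c = b.+1 /\ inc t a b = (inc t a c).+1).
    case=> E T; subst c; have da : d <= b.+1 \/ a = b by lia.
    move: Ac; rewrite /addable /= incE inc_neq; last by lia.
    move=> Ac; case: da => da.
      have d1 : d = b.+1 by lia.
      by subst d; move: Ad T; rewrite /addable /inc /=; lia.
    subst a; have z : t b = 0 /\ t b.+1 = 0.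
      by have := St b; move: T; rewrite incE inc_neq; lia.
    have := pos _ d b.+1 S3 Ad; have := @pos _ d b.+2 S3 Ad.
    case: (ltngtP d b.+2) => // [dlt _ _|dgt|E _ _].
    - have d1 : d = b.+1 by lia.
      by subst d; move: Ad T; rewrite /addable /inc /=; lia.
    - by move=> /(_ isT) + _; move: z; rewrite /inc; have := St b.+1; lia.
    - by subst d; move: Ad T z; rewrite /addable /inc /=; have := St b.+1; lia.
  by case/andP: (addable_swap nbc Ab Ac N) => -> ->; rewrite incC Ad.
case: ifPn => [/andP[H3 cd]|_]; last by rewrite /= Aa Ab Ac Ad.
have nab : a <> b by lia.
rewrite /=; suff N : ~ (b = a.+1 /\ t a = (t b).+1).
  by case/andP: (addable_swap nab Aa Ab N) => -> ->; rewrite incC Ac Ad.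
case=> E T.
have cb : c = b by lia.
subst c b; move: Ac; rewrite /addable /= incE.
rewrite (@inc_neq _ a.+1 a) ?incE; last by lia.
by rewrite (@inc_neq _ a a.+1); lia.
Qed.


Lemma hop4K a b c d : hop4s (hop4 a b c d) = [:: a; b; c; d].
Proof.
rewrite [X in hop4s X]/hop4; case: ifP => H1 /=; first by rewrite hop4_12 //; lia.
case: ifP => H2 /=; first by rewrite hop4_14 //; lia.
case: ifP => H3 /=; first by rewrite hop4_43 //; lia.
by rewrite /hop4 H1 H2 H3.
Qed.

(* Indices are 0-based: [pk w k] is a peak at [k.+2], and [hop k] below is [h_(k+1)]. *)
Definition pk (w : seq nat) (k : nat) : bool :=
  (nth 0 w k.+1 <= nth 0 w k) && (nth 0 w k.+1 < nth 0 w k.+2).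

Lemma hop4_fixed a b c d : (hop4 a b c d == [:: a; b; c; d]) =
  ~~ (pk [:: a; b; c; d] 0 || pk [:: a; b; c; d] 1).
Proof.
rewrite /hop4 /pk /=; case: ifP => H1; last (case: ifP => H2; last case: ifP => H3);
  rewrite ?eqseq_cons ?eqxx /=; lia.
Qed.

Lemma size_slide t h w : size (slide t h w).1 = size w.
Proof. by elim: w t h => //= r w IH t h; case: ifP => _ /=; rewrite IH. Qed.

Lemma good_step t h r w (p := if (r != h) && addable t r then (r, h) else (h, r)) :
  good t h (r :: w) -> good (inc t p.1) p.2 w.
Proof.
case=> St Ah /= /andP[Ar Aw]; have [A1 A2 A3] := slide_step St Ah Ar.
by split=> //; [apply: strict_inc|rewrite A3].
Qed.

Lemma slide_cons t h r w (p := if (r != h) && addable t r then (r, h) else (h, r)) :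
  slide t h (r :: w) = (p.1 :: (slide (inc t p.1) p.2 w).1, (slide (inc t p.1) p.2 w).2).
Proof. by rewrite /p /=; case: ifP. Qed.

Lemma slide_pk t h w k : good t h w -> k.+2 < size w -> pk (slide t h w).1 k = pk w k.
Proof.
elim: k t h w => [|k IH] t h [|a w] // G; last first.
  rewrite slide_cons; rewrite /= ltnS => kw.
  by rewrite -[RHS](IH _ _ _ (good_step G) kw) /pk.
case: w G => [|b [|c w]] // G _; rewrite /pk.
have [St _ _] := G; have S0 := St h; have S1 := St h.+1.
sgo G; sgo G; sgo G => /=; lia.
Qed.

Lemma slide_hop4 t h a b c d : good t h [:: a; b; c; d] ->
  slide t h (hop4 a b c d) =
    (hop4s (slide t h [:: a; b; c; d]).1, (slide t h [:: a; b; c; d]).2).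
Proof.
move=> G; have [St Ah Aw] := G.
have Gh : good t h (hop4 a b c d).
  by split=> //; apply: adm_hop4 => //; apply: strict_inc.
have K w : size w = 4 -> hop4s (hop4s (slide t h w).1) = (slide t h w).1.
  move=> sw; have := size_slide t h w; rewrite sw.
  by case: (slide t h w).1 => [|x [|y [|z [|u [|v s]]]]] //= _; exact: hop4K.
(* [hop4s] is an involution, so only one of the two exchanged words has to be treated. *)
have F w w' : size w' = 4 -> slide t h w' = (hop4s (slide t h w).1, (slide t h w).2) ->
    size w = 4 -> slide t h w = (hop4s (slide t h w').1, (slide t h w').2).
  by move=> _ -> sw /=; rewrite K //; case: (slide t h w).
(* A fixed word has no peak at its two middle entries; slides preserve peaks, so the slid word is
   fixed as well. *)
have [E|nE] := eqVneq (hop4 a b c d) [:: a; b; c; d].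
  rewrite E; have := size_slide t h [:: a; b; c; d].
  have := slide_pk (k := 0) G isT; have := slide_pk (k := 1) G isT.
  case: (slide t h _) => -[|x [|y [|z [|u [|v s]]]]] h' //= E1 E0 _.
  have /eqP-> // : hop4 x y z u == [:: x; y; z; u].
  by rewrite hop4_fixed E0 E1 -hop4_fixed E.
move: Gh nE; rewrite /hop4; case: ifP => [/andP[H1 H]|_].
  case: (ltnP b c) => bc Gh _; first by apply: slide_hop4_12 => //; lia.
  by apply: F => //; apply: slide_hop4_12 => //; lia.
case: ifP => [/and3P[H1 H2 H3]|_].
  case: (ltnP b c) => bc Gh _; first by apply: slide_hop4_14 => //; lia.
  have [E|nE] := eqVneq b c; last by apply: F => //; apply: slide_hop4_14 => //; lia.
  by subst c; exfalso; lia.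
case: ifP => [/andP[H1 H2]|N].
  case: (ltnP a b) => ab Gh _; first by apply: slide_hop4_43 => //; lia.
  by apply: F => //; apply: slide_hop4_43 => //; lia.
by rewrite eqxx.
Qed.

Definition hop (k : nat) (w : seq nat) : seq nat :=
  take k w ++ (if drop k w is a :: b :: c :: d :: s then hop4 a b c d ++ s else drop k w).

Lemma hop_cons k a w : hop k.+1 (a :: w) = a :: hop k w.
Proof. by []. Qed.

Lemma slide_cat t h u v : slide t h (u ++ v) =
  ((slide t h u).1 ++ (slide (foldl inc t (slide t h u).1) (slide t h u).2 v).1,
   (slide (foldl inc t (slide t h u).1) (slide t h u).2 v).2).
Proof.
elim: u t h => [|r u IH] t h; first by rewrite /=; case: slide.
by rewrite cat_cons !slide_cons IH.
Qed.

Lemma admf_cat t u v : admf t (u ++ v) = admf t u && admf (foldl inc t u) v.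
Proof. by elim: u t => //= r u IH t; rewrite IH andbA. Qed.

Lemma good_catl t h u v : good t h (u ++ v) -> good t h u.
Proof. by case=> ? ?; rewrite admf_cat => /andP[? _]; split. Qed.

Lemma foldl_incE t w s : foldl inc t w s = t s + count_mem s w.
Proof. by elim: w t => [|r w IH] t /=; rewrite ?addn0 // IH /inc addnA eq_sym. Qed.

Lemma foldl_inc_perm t u v : perm_eq u v -> foldl inc t u = foldl inc t v.
Proof.
by move=> /permP E; apply: functional_extensionality => s; rewrite !foldl_incE E.
Qed.

Lemma hop4s_perm w : perm_eq (hop4s w) w.
Proof.
case: w => [|a [|b [|c [|d [|e s]]]]] //=; rewrite /hop4.
by case: ifP => _; last (case: ifP => _; last case: ifP => _);
  apply/permP => p /=; lia.
Qed.

Lemma hop_perm k w : perm_eq (hop k w) w.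
Proof.
rewrite /hop -[X in perm_eq _ X](cat_take_drop k w) perm_cat2l.
case: (drop k w) => [|a [|b [|c [|d s]]]] //.
suff: perm_eq (hop4 a b c d ++ s) ([:: a; b; c; d] ++ s) by [].
by rewrite perm_cat2r (hop4s_perm [:: a; b; c; d]).
Qed.

Lemma size_hop k w : size (hop k w) = size w.
Proof. exact/perm_size/hop_perm. Qed.

Lemma good_end t h w : good t h w ->
  good (foldl inc t (slide t h w).1) (slide t h w).2 [::] /\
  inc (foldl inc t (slide t h w).1) (slide t h w).2 = foldl inc (inc t h) w.
Proof.
elim: w t h => [|r w IH] t h G //; have := IH _ _ (good_step G).
rewrite slide_cons; case: G => St Ah /= /andP[Ar Aw].
by have [A1 A2 ->] := slide_step St Ah Ar.
Qed.

Lemma good_catr t h u v : good t h (u ++ v) ->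
  good (foldl inc t (slide t h u).1) (slide t h u).2 v.
Proof.
move=> G; have [[H1 H2 _] H3] := good_end (good_catl G).
by case: G => _ _; rewrite admf_cat => /andP[_ H]; split=> //; rewrite H3.
Qed.

Lemma strict_foldl t w : strict t -> admf t w -> strict (foldl inc t w).
Proof. by elim: w t => //= r w IH t St /andP[Ar]; apply: IH; apply: strict_inc. Qed.

Lemma admf_hop t k w : strict t -> admf t w -> admf t (hop k w).
Proof.
move=> St; rewrite /hop -{1}(cat_take_drop k w) !admf_cat => /andP[At].
rewrite At; have := strict_foldl St At; move: (foldl _ _ _) => {At St}t St.
case: (drop k w) => [|a [|b [|c [|d s]]]] //.
rewrite -[[:: a, b, c, d & s]]/([:: a; b; c; d] ++ s) !admf_cat => /andP[A B].
rewrite adm_hop4 // (@foldl_inc_perm _ _ [:: a; b; c; d]) //.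
exact: (hop4s_perm [:: a; b; c; d]).
Qed.

#[local] Arguments slide : simpl never.

(** The letters before the window slide as they did. Over the window [slide_hop4] leaves the hole
    and, up to order, the letters the same, so the rest slides from the same state. *)
Lemma slide_hop t h k w : good t h w ->
  slide t h (hop k w) = (hop k (slide t h w).1, (slide t h w).2).
Proof.
move=> G; have [lt|le] := ltnP (size w) k.+4.
  have E v : size v < k.+4 -> hop k v = v.
    rewrite /hop => sv; rewrite -[RHS](cat_take_drop k v); have := size_drop k v.
    by case: (drop k v) => [|a [|b [|c [|d s]]]] //= E; lia.
  by rewrite !E ?size_slide //; case: slide.
move: G; rewrite -(cat_take_drop k w) => G; have := good_catr G.
have sk : size (take k w) = k by rewrite size_takel //; lia.
have hk u v : size u = k -> hop k (u ++ v) = u ++ hop 0 v.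
  by move=> su; rewrite /hop take_size_cat // drop_size_cat // take0 drop0.
rewrite hk // (slide_cat t h (take k w) (hop 0 _)) slide_cat hk ?size_slide //=.
move: (slide t h (take k w)).2 (foldl _ _ _) => h1 t1.
have : 3 < size (drop k w) by rewrite size_drop; lia.
case: (drop k w) => [|a [|b [|c [|d s]]]] // _.
rewrite -[[:: a, b, c, d & s]]/([:: a; b; c; d] ++ s) => G1.
have -> : hop 0 ([:: a; b; c; d] ++ s) = hop4 a b c d ++ s by [].
have Gl := good_catl G1; rewrite !slide_cat (slide_hop4 Gl) /=.
have := size_slide t1 h1 [:: a; b; c; d].
case: (slide t1 h1 [:: a; b; c; d]) => -[|x [|y [|z [|u [|v p]]]]] h' //= _.
have /= F := @foldl_inc_perm t1 (hop4 x y z u) [:: x; y; z; u] (hop4s_perm [:: x; y; z; u]).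
by rewrite F.
Qed.

Lemma slide1_inj t h h' r r' : good t h [:: r] -> good t h' [:: r'] ->
  slide t h [:: r] = slide t h' [:: r'] -> h = h' /\ r = r'.
Proof.
case=> _ Ah _ [_ Ah' _]; rewrite /slide.
case: ifPn => /= [/andP[n A]|N]; case: ifPn => /= [/andP[n' A']|N'] [] E1 E2; subst => //.
  by move: N'; rewrite eq_sym n Ah.
by move: N; rewrite eq_sym n' Ah'.
Qed.

(** A slide can be run backwards: at a known shape, the last letter produced and the final hole
    determine the letter consumed and the previous hole. *)
Lemma slide_inj t h h' w w' : good t h w -> good t h' w' -> size w = size w' ->
  slide t h w = slide t h' w' -> h = h' /\ w = w'.
Proof.
elim/last_ind: w w' => [|w r IH] w'; first by case: w' => // _ _ _ [].
case/lastP: w' => [|w' r'] G G' //; first by rewrite size_rcons.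
move: G G'; rewrite -!cats1 => G G'; rewrite !size_cat !addn1 => -[sw].
have [G1 G2] := (good_catl G, good_catr G); have [G1' G2'] := (good_catl G', good_catr G').
rewrite !slide_cat => -[] /eqP; rewrite eqseq_cat ?size_slide // => /andP[/eqP E1 /eqP E2] E3.
rewrite E1 in G2 E2 E3.
have [Eh Er] : (slide t h w).2 = (slide t h' w').2 /\ r = r'.
  apply: (slide1_inj G2 G2'); rewrite [LHS]surjective_pairing [RHS]surjective_pairing.
  by rewrite E2 E3.
by subst r'; case: (IH w') => //; [rewrite [LHS]surjective_pairing E1 Eh -surjective_pairing|move=> -> ->].
Qed.

(** * Standard tableaux and their rectification *)

Definition null : nat -> nat := fun=> 0.
Definition adm (w : seq nat) : bool := admf null w.
Definition cnt (w : seq nat) : nat -> nat := foldl inc null w.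

Lemma strict_null : strict null. Proof. by left. Qed.
Hint Resolve strict_null : core.

Lemma cntE w s : cnt w s = count_mem s w.
Proof. by rewrite /cnt foldl_incE. Qed.

Lemma strict_cnt w : adm w -> strict (cnt w).
Proof. exact: strict_foldl. Qed.

Lemma cnt_rcons w r : cnt (rcons w r) = inc (cnt w) r.
Proof. by rewrite /cnt -cats1 foldl_cat. Qed.

Lemma adm_rcons w r : adm (rcons w r) = adm w && addable (cnt w) r.
Proof. by rewrite /adm -cats1 admf_cat /= andbT. Qed.

Lemma cnt_perm u v : perm_eq u v -> cnt u = cnt v.
Proof. exact: foldl_inc_perm. Qed.

Lemma perm_cnt u v : cnt u = cnt v -> perm_eq u v.
Proof. by move=> E; apply/allP => x _; rewrite /= -!cntE E. Qed.

Lemma adm_hop k w : adm w -> adm (hop k w).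
Proof. exact: admf_hop. Qed.

Lemma adm_head w : adm w -> w = [::] \/ exists w', w = 0 :: w'.
Proof. by case: w => [|[|r] w]; [left|right; exists w|]. Qed.

(* Rectification of the tableau of the entries [2, n], and the corner it vacates. *)
Definition demote (w : seq nat) : seq nat := (slide null 0 (behead w)).1.
Definition hole (w : seq nat) : nat := (slide null 0 (behead w)).2.

Lemma good_adm w : adm w -> good null 0 (behead w).
Proof.
by move=> /[dup] /adm_head[->|[w' ->]] // ; split.
Qed.

Lemma size_demote w : size (demote w) = (size w).-1.
Proof. by rewrite size_slide size_behead. Qed.

Lemma adm_demote w : adm w -> adm (demote w).
Proof.
move=> Aw; move: (good_adm Aw); rewrite /demote /adm; move: (behead w) null 0 => {Aw}w.
elim: w => [|r w IH] t h G //; rewrite slide_cons.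
have := IH _ _ (good_step G); case: G => St Ah /= /andP[Ar Aw].
by have [A1 _ _] := slide_step St Ah Ar => ->; rewrite A1.
Qed.

Lemma inc_inj t r s : inc t r = inc t s -> r = s.
Proof. by move=> /(congr1 (fun f => f r)); rewrite incE /inc; case: eqP => //; lia. Qed.

Lemma demote_hole w : adm w -> 0 < size w ->
  addable (cnt (demote w)) (hole w) /\ inc (cnt (demote w)) (hole w) = cnt w.
Proof.
move=> Aw sw; have := good_end (good_adm Aw); rewrite -/(demote w) -/(hole w) -/(cnt _).
by case: (adm_head Aw) sw => [->|[w' ->]] //= _ [[]].
Qed.

Lemma demote_hop k w : adm w -> k.+1 < size w -> demote (hop k.+1 w) = hop k (demote w) /\ hole (hop k.+1 w) = hole w.
Proof.
move=> Aw; case: (adm_head Aw) => [->|[w' E]] // _; subst w.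
by rewrite /demote /hole hop_cons /= slide_hop //; apply: good_adm Aw.
Qed.

Lemma demote_pk k w : adm w -> k.+3 < size w -> pk (demote w) k = pk w k.+1.
Proof.
move=> Aw; case: (adm_head Aw) => [->|[w' E]] // kw; subst w.
by rewrite /demote slide_pk //; apply: good_adm Aw.
Qed.

(** The shapes before and after rectification differ by the vacated corner, which is therefore the
    same for both; the slide is then injective. *)
Lemma demote_inj w w' : adm w -> adm w' -> perm_eq w w' -> demote w = demote w' -> w = w'.
Proof.
move=> A A' P E; have sw := perm_size P.
have [w0|w0] := posnP (size w).
  by move: sw; rewrite w0 => /esym/size0nil ->; apply: size0nil.
have w0' : 0 < size w' by rewrite -sw.
have [_ I] := demote_hole A w0; have [_ I'] := demote_hole A' w0'.
have Eh : hole w = hole w' by apply: (@inc_inj (cnt (demote w))); rewrite I (cnt_perm P) -I' E.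
case: (adm_head A) w0 => [->//|[v Ev]] _; case: (adm_head A') w0' => [->//|[v' Ev']] _; subst w w'.
have [||_ /= -> //] := slide_inj (good_adm A) (good_adm A'); first by case: sw.
by rewrite [LHS]surjective_pairing [RHS]surjective_pairing; congr pair; [exact: E|exact: Eh].
Qed.

Lemma hop_id k w : size w < k.+4 -> hop k w = w.
Proof.
rewrite /hop => sv; rewrite -[RHS](cat_take_drop k w); have := size_drop k w.
by case: (drop k w) => [|a [|b [|c [|d s]]]] //= E; lia.
Qed.

Lemma hop_cat_l u v k : hop (size u + k) (u ++ v) = u ++ hop k v.
Proof. by elim: u => //= a u IH; rewrite addSn hop_cons IH. Qed.

Lemma hop_at P a b c d s : hop (size P) (P ++ [:: a, b, c, d & s]) = P ++ hop4 a b c d ++ s.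
Proof. by rewrite -[size P]addn0 hop_cat_l. Qed.

Lemma hop_cat_r u v k : k.+4 <= size u -> hop k (u ++ v) = hop k u ++ v.
Proof.
elim: k u => [|k IH] [|a u] //= su; last by rewrite hop_cons IH.
by case: u su => [|b [|c [|d u]]] // _; rewrite /hop /= -catA.
Qed.

Lemma hop_rcons k w c : k.+4 <= size w -> hop k (rcons w c) = rcons (hop k w) c.
Proof. by rewrite -!cats1; apply: hop_cat_r. Qed.

Lemma hopK k : involutive (hop k).
Proof.
elim: k => [|k IH] [|a w] //; last by rewrite !hop_cons IH.
case: w => [|b [|c [|d w]]] //; have := hop4K a b c d; rewrite /hop /=.
have := perm_size (hop4s_perm [:: a; b; c; d]); rewrite /=.
by case: (hop4 a b c d) => [|x [|y [|z [|u [|v s]]]]] //= _ ->.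
Qed.

Lemma hop_pk k w : k.+4 <= size w -> (hop k w == w) = ~~ (pk w k || pk w k.+1).
Proof.
elim: k w => [|k IH] [|a w] //; last first.
  by move=> sw; rewrite hop_cons eqseq_cons eqxx IH.
case: w => [|b [|c [|d w]]] // _; rewrite /hop.
have -> : (take 0 [:: a, b, c, d & w] ++ hop4 a b c d ++ w == [:: a, b, c, d & w]) =
  (hop4 a b c d ++ w == [:: a; b; c; d] ++ w) by [].
rewrite eqseq_cat ?eqxx ?andbT ?hop4_fixed //.
exact: perm_size (hop4s_perm [:: a; b; c; d]).
Qed.

Lemma hop_comm k l w : k + 3 < l -> hop k (hop l w) = hop l (hop k w).
Proof.
move=> kl; have [lt|le] := ltnP (size w) l.+4; first by rewrite !(@hop_id l) ?size_hop.
rewrite -(cat_take_drop k.+4 w); move: (drop _ _) => v.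
have sk : size (take k.+4 w) = k.+4 by rewrite size_takel //; lia.
move: (take _ _) sk => u su; have -> : l = size u + (l - k.+4) by rewrite su; lia.
rewrite hop_cat_l hop_cat_r ?su // [hop k (u ++ v)]hop_cat_r ?su //.
by have := hop_cat_l (hop k u) v (l - k.+4); rewrite size_hop su.
Qed.

Lemma hop_far k l w : (k + 3 < l) || (l + 3 < k) -> (hop k (hop l w) == hop l w) = (hop k w == w).
Proof.
move=> kl; have -> : hop k (hop l w) = hop l (hop k w).
  by case/orP: kl => kl; [|symmetry]; exact: hop_comm.
exact: (inj_eq (can_inj (hopK l))).
Qed.

Lemma adm_cat u v : adm (u ++ v) = adm u && admf (cnt u) v.
Proof. exact: admf_cat. Qed.

(** * Corners of a shape and connectedness under hops *)

Lemma removable_inc t r : strict t -> addable t r -> removable (inc t r) r.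
Proof.
move=> St; rewrite /addable /removable incE inc_neq; last by lia.
by have := St r; lia.
Qed.

Lemma adm_removable w r : adm (rcons w r) -> removable (cnt (rcons w r)) r.
Proof.
by rewrite adm_rcons cnt_rcons => /andP[/strict_cnt]; apply: removable_inc.
Qed.

Lemma removable_addable t u r : strict t -> removable t r -> t = inc u r -> addable u r /\ strict u.
Proof.
move=> St + E; subst t; rewrite /removable /addable incE inc_neq; last by lia.
move=> R; split.
  case: r St R => [|r] St //= R; have := St r; rewrite incE inc_neq; lia.
move=> s; have := St s; rewrite /inc; case: (eqVneq s r) => [E|_]; case: (eqVneq s.+1 r) => [E'|_]; subst; lia.
Qed.

Lemma removable_neq t r s : r <> s -> removable (inc t s) r -> removable t r.
Proof. by move=> n; rewrite /removable (inc_neq t (not_eq_sym n)) /inc; lia. Qed.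

Lemma strict_addable t r : strict (inc t r) -> addable t r.
Proof.
by case: r => // r /(_ r); rewrite incE inc_neq /addable /=; lia.
Qed.

(** If the last entry is in another corner [s], row [r] already ends in a corner without it; the
    induction puts the last of the remaining entries there, and the two final entries commute. *)
Lemma rem_last w r : adm w -> removable (cnt w) r ->
  exists2 w', adm (rcons w' r) & perm_eq (rcons w' r) w.
Proof.
elim/last_ind: w => [|w s IH]; first by rewrite /removable.
move=> A R; have := A; rewrite adm_rcons => /andP[Aw As].
have [<-|/eqP n] := eqVneq s r; first by exists w.
have R' : removable (cnt w) r.
  by apply: (@removable_neq _ r s) => [E|]; [case: n|rewrite -cnt_rcons].
have [w' Aw' Pw'] := IH Aw R'.
have P : cnt (rcons (rcons w' s) r) = cnt (rcons w s).
  by rewrite !cnt_rcons incC -(cnt_perm Pw') cnt_rcons.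
exists (rcons w' s); last exact: perm_cnt.
have [A1 A2] := removable_addable (strict_cnt A) R (esym (etrans (esym (cnt_rcons _ _)) P)).
move: A2; rewrite adm_rcons A1 adm_rcons andbT cnt_rcons => A2.
by move: Aw'; rewrite adm_rcons => /andP[-> _]; apply: strict_addable.
Qed.

Lemma strict_add t r m : strict t -> 0 < t (r + m) -> t (r + m) + m <= t r.
Proof.
move=> St; elim: m => [|m IH]; rewrite ?addn0 // addnS => H.
by have := St (r + m); have := IH; lia.
Qed.

Lemma removable_above w r : 0 < cnt w r -> exists2 q, r <= q & removable (cnt w) q.
Proof.
move=> H; have ub q : 0 < cnt w q -> q <= \max_(x <- w) x.
  by rewrite cntE -has_count has_pred1 => wq; exact: (@leq_bigmax_seq _ _ xpredT id q wq isT).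
have [q Hq Mq] := ex_maxnP (ex_intro (fun q => 0 < cnt w q) r H) ub.
exists q; first exact: Mq.
by rewrite /removable Hq /=; case: (ltnP 0 (cnt w q.+1)) => [/Mq|]; lia.
Qed.

(** Without a corner in the rows from [b] up to [a], the lengths would drop by exactly one at each
    row. *)
Lemma removable_between t b a : strict t -> b < a -> t a + (a - b) < t b ->
  exists x, [/\ b <= x < a, removable t x & 1 < t x].
Proof.
move=> St; elim: (a - b) {-2}b (erefl (a - b)) => [|m IH] {}b E ba H; first by lia.
case R: (removable t b); first by exists b; split; lia.
have T : t b = (t b.+1).+1 by move: R; rewrite /removable; have := St b; lia.
have [Eb|nb] := eqVneq b.+1 a; first by subst a; lia.
have [|||x [H1 H2 H3]] := IH b.+1; try lia.
by exists x; split=> //; lia.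
Qed.

(* Two corners of a shape may carry the last two entries in either order, the
   previous two entries being placed so that a hop exchanges the last two. *)
Lemma corner_pair w b a : adm w -> b < a -> removable (cnt w) b -> removable (cnt w) a ->
  exists P x1 x2, [/\ adm (P ++ [:: x1; x2; b; a]), adm (P ++ [:: x1; x2; a; b]),
    perm_eq (P ++ [:: x1; x2; b; a]) w & [/\ b <= x2, x2 < a & x2 <= x1]].
Proof.
move=> A ba Rb Ra.
have [w1 A1 P1] := rem_last A Ra.
have R1 : removable (cnt w1) b.
  by apply: (@removable_neq _ b a); [lia|rewrite -cnt_rcons (cnt_perm P1)].
have A1' : adm w1 by move: A1; rewrite adm_rcons => /andP[].
have [w2 A2 P2] := rem_last A1' R1.
have A2' : adm w2 by move: A2; rewrite adm_rcons => /andP[].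
have C : cnt w = inc (inc (cnt w2) b) a.
  by rewrite -(cnt_perm P1) cnt_rcons -(cnt_perm P2) cnt_rcons.
have S2 := strict_cnt A2'.
have [x2 [/andP[bx xa] Rx tx]] : exists x, [/\ b <= x < a, removable (cnt w2) x & 1 < cnt w2 x].
  apply: removable_between => //; move: (strict_cnt A) Rb Ra; rewrite C.
  have E1 : inc (inc (cnt w2) b) a b = (cnt w2 b).+1 by rewrite inc_neq ?incE //; lia.
  have E2 : inc (inc (cnt w2) b) a a = (cnt w2 a).+1 by rewrite incE inc_neq //; lia.
  move=> St; have := @strict_add _ b.+1 (a - b.+1) St; rewrite subnKC // /removable E1 E2.
  by clear -ba; lia.
have [w3 A3 P3] := rem_last A2' Rx.
have A3' : adm w3 by move: A3; rewrite adm_rcons => /andP[].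
have [x1 x21 R3] : exists2 q, x2 <= q & removable (cnt w3) q.
  apply: removable_above; move: tx; rewrite -(cnt_perm P3) cnt_rcons incE; clia.
have [P A4 P4] := rem_last A3' R3.
have e : P ++ [:: x1; x2; b; a] = rcons (rcons (rcons (rcons P x1) x2) b) a.
  by rewrite -!cats1 -!catA.
have c3 := cnt_perm P4; have c2 := cnt_perm P3; have c1 := cnt_perm P2.
have Aba : adm (P ++ [:: x1; x2; b; a]).
  rewrite e adm_rcons adm_rcons adm_rcons A4 !cnt_rcons -(cnt_rcons P) c3 -cnt_rcons c2 -cnt_rcons c1.
  by move: A3 A2 A1; rewrite !adm_rcons => /andP[_ ->] /andP[_ ->] /andP[_ ->].
have Pba : perm_eq (P ++ [:: x1; x2; b; a]) w.
  by apply: perm_cnt; rewrite e !cnt_rcons -(cnt_rcons P) c3 -cnt_rcons c2 -C.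
exists P, x1, x2; split=> //.
have := adm_hop (size P) Aba.
by rewrite hop_at hop4_12 //; clear -bx xa x21; lia.
Qed.

Inductive hpath (lo hi : nat) (x : seq nat) : seq nat -> Prop :=
| HRefl : hpath lo hi x x
| HStep y k : hpath lo hi x y -> lo <= k -> k.+4 <= hi -> hpath lo hi x (hop k y).

Lemma hpath_trans lo hi x y z : hpath lo hi x y -> hpath lo hi y z -> hpath lo hi x z.
Proof. by move=> xy; elim=> // z' k _ IH k1 k2; apply: HStep. Qed.

Lemma hpath1 lo hi x k : lo <= k -> k.+4 <= hi -> hpath lo hi x (hop k x).
Proof. by move=> *; apply: HStep => //; apply: HRefl. Qed.

Lemma hpath_perm lo hi x y : hpath lo hi x y -> perm_eq x y.
Proof. by elim=> // {}y k _ IH _ _; rewrite perm_sym (perm_trans (hop_perm k y)) // perm_sym. Qed.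

Lemma hpath_adm lo hi x y : hpath lo hi x y -> adm x -> adm y.
Proof. by elim=> // {}y k _ IH _ _ /IH; apply: adm_hop. Qed.

Lemma hpath_cat lo hi x y s : hi <= size x -> hpath lo hi x y -> hpath lo hi (x ++ s) (y ++ s).
Proof.
move=> hx; elim=> [|{}y k xy IH k1 k2]; first exact: HRefl.
rewrite -hop_cat_r; first exact: HStep.
by rewrite -(perm_size (hpath_perm xy)) (leq_trans k2).
Qed.

Lemma hpath_weaken lo hi lo' hi' x y : lo' <= lo -> hi <= hi' -> hpath lo hi x y -> hpath lo' hi' x y.
Proof.
by move=> l h; elim=> [|{}y k _ IH k1 k2]; [exact: HRefl|apply: HStep => //; lia].
Qed.

(** Tableaux with the same last corner are connected by induction; between two last corners,
    [corner_pair] provides a single hop. Hence a component of a labeled graph contains every tableau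
    of its shape. *)
Lemma adm_connected x y : adm x -> adm y -> perm_eq x y -> hpath 0 (size x) x y.
Proof.
move: {2}(size x) (erefl (size x)) => m; elim: m x y => [|m IH] x y sx Ax Ay P.
  by move/size0nil: sx P => ->; rewrite perm_sym => /perm_nilP->; exact: HRefl.
have IHr u v a : size (rcons u a) = m.+1 -> adm (rcons u a) -> adm (rcons v a) ->
    perm_eq (rcons u a) (rcons v a) -> hpath 0 m.+1 (rcons u a) (rcons v a).
  rewrite size_rcons -!cats1 perm_cat2r !cats1 !adm_rcons => -[su] /andP[Au _] /andP[Av _] Puv.
  by rewrite -!cats1; apply: (@hpath_weaken 0 m) => //; apply: hpath_cat; rewrite -?su //; apply: IH.
have := perm_size P; rewrite sx.
case/lastP: x sx Ax P => [//|x a] sx Ax P; case/lastP: y Ay P => [//|y b] Ay P sy.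
have [E|/eqP nab] := eqVneq a b; first by subst b; apply: IHr.
have Ra := adm_removable Ax; have := adm_removable Ay; rewrite -(cnt_perm P) => Rb.
have Q z : adm z -> perm_eq z (rcons x a) -> size z = m.+1.
  by move=> _ /perm_size ->.
have key z z' : adm (z ++ [:: a]) -> adm (z' ++ [:: b]) -> z' ++ [:: b] = hop (m.+1 - 4) (z ++ [:: a]) ->
    4 <= m.+1 -> perm_eq (z ++ [:: a]) (rcons x a) -> hpath 0 m.+1 (rcons x a) (rcons y b).
  rewrite !cats1 => Az Az' E m4 Pz; apply: (@hpath_trans _ _ _ (rcons z a)).
    by apply: IHr; rewrite // perm_sym.
  have Pz' : perm_eq (rcons z' b) (rcons x a).
    by apply: perm_trans Pz; rewrite E hop_perm.
  apply: (@hpath_trans _ _ _ (rcons z' b)); first by rewrite E; apply: hpath1 => //; lia.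
  by apply: IHr => //; [rewrite (perm_size Pz')|apply: perm_trans P].
have [ba|ab] : b < a \/ a < b by lia.
  have [R [x1 [x2 [A1 A2 P1 [H1 H2 H3]]]]] := corner_pair Ax ba Rb Ra.
  have sR : size R + 4 = m.+1 by rewrite -sx -(perm_size P1) size_cat.
  apply: (key (R ++ [:: x1; x2; b]) (R ++ [:: x1; x2; a])); rewrite -?catA //; last by lia.
  have -> : m.+1 - 4 = size R by clear -sR; lia.
  by rewrite hop_at hop4_12 //; clear -H1 H2 H3; lia.
have [R [x1 [x2 [A1 A2 P1 [H1 H2 H3]]]]] := corner_pair Ax ab Ra Rb.
have E : R ++ [:: x1; x2; a; b] = hop (size R) (R ++ [:: x1; x2; b; a]).
  by rewrite hop_at hop4_12 //; clear -H1 H2 H3; lia.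
have sR : size R + 4 = m.+1 by rewrite -sx -(perm_size P1) size_cat.
apply: (key (R ++ [:: x1; x2; b]) (R ++ [:: x1; x2; a])); rewrite -?catA //=; [|lia|].
  by rewrite E; congr hop; clear -sR; lia.
by apply: perm_trans P1; rewrite E perm_sym hop_perm.
Qed.

(** The row [p = c'.-1] ends in a corner because [c'] is addable, and [q] is a corner at or above
    it. The last entry of [P ++ [:: q; p]] becomes a peak when the next letter is [c'] but not when
    it is [c], so peaks tell apart the possible next cells. *)
Lemma last_det u c c' : adm u -> addable (cnt u) c -> addable (cnt u) c' -> c < c' ->
  exists P q p, [/\ adm (P ++ [:: q; p]), perm_eq (P ++ [:: q; p]) u & p <= q /\ c <= p < c'].
Proof.
move=> A Ac Ac' cc.
have R : removable (cnt u) c'.-1.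
  by move: Ac'; rewrite /addable /removable prednK; last lia; lia.
have [w Aw Pw] := rem_last A R.
have A' : adm w by move: Aw; rewrite adm_rcons => /andP[].
have [q qc Rq] : exists2 q, c'.-1 <= q & removable (cnt w) q.
  apply: removable_above; have := cnt_perm Pw; rewrite cnt_rcons => /(congr1 (@^~ c'.-1)).
  by rewrite incE; move: Ac'; rewrite /addable; lia.
have [P AP PP] := rem_last A' Rq.
exists P, q, c'.-1; have e : P ++ [:: q; c'.-1] = rcons (rcons P q) c'.-1 by rewrite -!cats1 -catA.
split; [rewrite e|rewrite e|by clear -qc cc Ac'; lia].
  by move: Aw; rewrite adm_rcons => /andP[_ H]; rewrite adm_rcons AP (cnt_perm PP) H.
by apply: perm_trans Pw; rewrite -!cats1 perm_cat2r cats1.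
Qed.

(** * Labelings *)

(* A map to standard tableaux of size [n], compatible with the signatures and edges
   seen by the interval [1, n]; [con] is connection by colors seen by [lo + 1, hi]. *)
Record labeling (V : Type) (sig : V -> nat -> bool) (E : nat -> V -> V -> bool) (n : nat)
  (f : V -> seq nat) : Prop := Labeling {
  lab_adm : forall v, adm (f v);
  lab_size : forall v, size (f v) = n;
  lab_sig : forall v k, k.+3 <= n -> sig v k = pk (f v) k;
  lab_edge : forall k u v, k.+4 <= n -> E k u v -> f v = hop k (f u) /\ f v <> f u;
  lab_lift : forall k u, k.+4 <= n -> hop k (f u) <> f u -> exists v, E k u v
}.

Inductive con (V : Type) (E : nat -> V -> V -> bool) (lo hi : nat) (u : V) : V -> Prop :=
| ConRefl : con E lo hi u u
| ConStep v w k : con E lo hi u v -> lo <= k -> k.+4 <= hi -> E k v w -> con E lo hi u w.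

Definition faithful (V : Type) (E : nat -> V -> V -> bool) n (f : V -> seq nat) : Prop :=
  forall u v, con E 0 n u v -> f u = f v -> u = v.

Definition shiftE (V : Type) (E : nat -> V -> V -> bool) : nat -> V -> V -> bool := fun k => E k.+1.
Definition shiftS (V : Type) (sig : V -> nat -> bool) : V -> nat -> bool := fun v k => sig v k.+1.

Section Labelings.
Variable V : Type.
Implicit Types (sig : V -> nat -> bool) (E : nat -> V -> V -> bool) (f g : V -> seq nat).

Lemma con_trans E lo hi u v w : con E lo hi u v -> con E lo hi v w -> con E lo hi u w.
Proof. by move=> uv; elim=> // x y k _ IH k1 k2; apply: ConStep. Qed.

Lemma con1 E lo hi k u v : lo <= k -> k.+4 <= hi -> E k u v -> con E lo hi u v.
Proof. by move=> *; apply: (@ConStep _ _ _ _ _ u v k) => //; apply: ConRefl. Qed.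

Lemma con_sym E lo hi u v : (forall k x y, E k x y -> E k y x) ->
  con E lo hi u v -> con E lo hi v u.
Proof.
move=> S; elim=> [|x y k _ IH k1 k2 /S xy]; first exact: ConRefl.
by apply: con_trans IH; apply: con1 xy.
Qed.

Lemma con_weaken E lo hi lo' hi' u v : lo' <= lo -> hi <= hi' -> con E lo hi u v -> con E lo' hi' u v.
Proof.
move=> l h; elim=> [|x y k _ IH k1 k2]; first exact: ConRefl.
by apply: ConStep => //; lia.
Qed.

Lemma con_shift E lo hi u v : con (shiftE E) lo hi u v <-> con E lo.+1 hi.+1 u v.
Proof.
split; elim=> [|x y [|k] _ IH k1 k2 e //]; try exact: ConRefl.
- exact: (ConStep IH _ _ e).
- exact: (ConStep IH _ _ e).
- exact: (@ConStep _ (shiftE E) _ _ _ _ _ k IH).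
Qed.

Section One.
Variables (sig : V -> nat -> bool) (E : nat -> V -> V -> bool) (n : nat) (f : V -> seq nat).
Hypothesis L : labeling sig E n f.

Lemma con_hpath lo hi u v : hi <= n -> con E lo hi u v -> hpath lo hi (f u) (f v).
Proof.
move=> hn; elim=> [|x y k _ IH k1 k2 e]; first exact: HRefl.
by have [-> _] := lab_edge L (leq_trans k2 hn) e; apply: HStep.
Qed.

Lemma con_perm lo hi u v : hi <= n -> con E lo hi u v -> perm_eq (f u) (f v).
Proof. by move=> hn /(con_hpath hn); apply: hpath_perm. Qed.

Lemma lift_path lo hi u y : hi <= n -> hpath lo hi (f u) y ->
  exists2 v, con E lo hi u v & f v = y.
Proof.
move=> hn; elim=> [|{}y k _ [v uv fv] k1 k2]; first by exists u => //; exact: ConRefl.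
have [e|/eqP ne] := eqVneq (hop k y) y; first by exists v; rewrite ?e.
have kn : k.+4 <= n by apply: leq_trans hn.
have [w vw] : exists w, E k v w by apply: (lab_lift L kn); rewrite fv.
by exists w; [apply: ConStep vw|have [-> _] := lab_edge L kn vw; rewrite fv].
Qed.

Lemma exists_label u y : adm y -> perm_eq (f u) y -> exists2 v, con E 0 n u v & f v = y.
Proof.
move=> Ay P; apply: lift_path => //; rewrite -(lab_size L u).
exact: adm_connected (lab_adm L u) Ay P.
Qed.

End One.

Lemma take_hop k m w : k.+4 <= m -> m <= size w -> take m (hop k w) = hop k (take m w).
Proof.
move=> km mw; rewrite -{1}(cat_take_drop m w) hop_cat_r ?size_takel //.
by rewrite take_size_cat // size_hop size_takel.
Qed.

Lemma drop_hop k m w : k.+4 <= m -> m <= size w -> drop m (hop k w) = drop m w.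
Proof.
move=> km mw; rewrite -{1}(cat_take_drop m w) hop_cat_r ?size_takel //.
by rewrite drop_size_cat // size_hop size_takel.
Qed.

Lemma adm_take m w : adm w -> adm (take m w).
Proof. by rewrite -{1}(cat_take_drop m w) adm_cat => /andP[]. Qed.

Lemma pk_take m k w : k.+3 <= m -> pk (take m w) k = pk w k.
Proof. by move=> km; rewrite /pk !nth_take //; lia. Qed.

Lemma lab_take sig E n m f : m <= n -> labeling sig E n f -> labeling sig E m (fun v => take m (f v)).
Proof.
move=> mn L; split=> [v|v|v k km|k u v km e|k u km H].
- exact/adm_take/(lab_adm L).
- by rewrite size_takel // (lab_size L).
- by rewrite pk_take // -(lab_sig L) //; lia.
- have [e1 e2] := lab_edge L (leq_trans km mn) e.
  have T : take m (f v) = hop k (take m (f u)) by rewrite e1 take_hop // (lab_size L).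
  split=> // T'; apply: e2; rewrite -(cat_take_drop m (f v)) T' e1 drop_hop ?(lab_size L) //.
  exact: cat_take_drop.
- apply: (lab_lift L (leq_trans km mn)) => e; apply: H.
  by rewrite -take_hop ?(lab_size L) // e.
Qed.

(** Edges within the first [m] entries do not touch the dropped letters, which therefore agree on
    connected vertices. *)
Lemma faithful_take sig E n m f : m <= n -> labeling sig E n f -> faithful E n f ->
  faithful E m (fun v => take m (f v)).
Proof.
move=> mn L F u v uv e; apply: F; first exact: con_weaken uv.
have : drop m (f u) = drop m (f v).
  elim: uv {e} => [|x y k _ -> _ km xy] //.
  have [-> _] := lab_edge L (leq_trans km mn) xy.
  by rewrite drop_hop ?(lab_size L).
by move=> d; rewrite -(cat_take_drop m (f u)) e d cat_take_drop.
Qed.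

Lemma lab_demote sig E n f : labeling sig E n.+1 f ->
  labeling (shiftS sig) (shiftE E) n (fun v => demote (f v)).
Proof.
move=> L; have A := lab_adm L; have S := lab_size L.
split=> [v|v|v k km|k u v km e|k u km H].
- exact/adm_demote.
- by rewrite size_demote S.
- by rewrite demote_pk ?S // -(lab_sig L).
- have [e1 e2] := lab_edge L (k := k.+1) km e.
  have ks : k.+1 < size (f u) by rewrite S; clear -km; lia.
  rewrite e1; split; first by have [] := demote_hop (A u) ks.
  by rewrite -e1 => D; apply: e2; apply: demote_inj; rewrite // e1 hop_perm.
- have ks : k.+1 < size (f u) by rewrite S; clear -km; lia.
  apply: (lab_lift L (k := k.+1) km) => e; apply: H.
  by have [<- _] := demote_hop (A u) ks; rewrite e.
Qed.

Lemma faithful_demote sig E n f : labeling sig E n.+1 f -> faithful E n.+1 f ->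
  faithful (shiftE E) n (fun v => demote (f v)).
Proof.
move=> L F u v /con_shift uv D; have uv0 : con E 0 n.+1 u v by exact: con_weaken uv.
by apply: F => //; apply: demote_inj D; rewrite ?(lab_adm L) // (con_perm L _ uv0).
Qed.

Lemma rcons_take w n : size w = n.+1 -> w = rcons (take n w) (last 0 w).
Proof.
case/lastP: w => // w c; rewrite size_rcons last_rcons -cats1 => -[<-].
by rewrite take_size_cat // cats1.
Qed.

Lemma pk_last P q p c : pk (rcons (P ++ [:: q; p]) c) (size P) = (p <= q) && (p < c).
Proof. by elim: P. Qed.

(* Labelings agree by induction: the last letter is read off the peaks at the
   next to last entry, by [last_det]. *)
Lemma labeling_unique sig E n f g : labeling sig E n f -> labeling sig E n g -> f =1 g.
Proof.
elim: n f g => [|n IH] f g Lf Lg u.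
  by rewrite (size0nil (lab_size Lf u)) (size0nil (lab_size Lg u)).
have T := IH _ _ (lab_take (leqnSn n) Lf) (lab_take (leqnSn n) Lg).
rewrite (rcons_take (lab_size Lf u)) (rcons_take (lab_size Lg u)) T.
have last_con h v : labeling sig E n.+1 h -> con E 0 n u v -> last 0 (h v) = last 0 (h u).
  move=> Lh; elim=> // x y k _ <- _ kn xy.
  have [-> _] := lab_edge Lh (leqW kn) xy.
  by rewrite (rcons_take (lab_size Lh x)) hop_rcons ?last_rcons // size_takel // (lab_size Lh).
have addl h : labeling sig E n.+1 h -> addable (cnt (take n (h u))) (last 0 (h u)).
  move=> Lh; have := lab_adm Lh u; rewrite {1}(rcons_take (lab_size Lh u)) adm_rcons.
  by case/andP.
have key h h' : labeling sig E n.+1 h -> labeling sig E n.+1 h' ->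
    (forall v, take n (h v) = take n (h' v)) -> ~ last 0 (h u) < last 0 (h' u).
  move=> Lh Lh' Tv lt; have Ac' := addl _ Lh'; rewrite -Tv in Ac'.
  have [P [q [p [AP PP [pq cp]]]]] := last_det (adm_take n (lab_adm Lh u)) (addl _ Lh) Ac' lt.
  have [v uv hv] : exists2 v, con E 0 n u v & take n (h v) = P ++ [:: q; p].
    by apply: (exists_label (lab_take (leqnSn n) Lh)); rewrite // perm_sym.
  have sP : (size P).+3 = n.+1.
    have := congr1 size hv; rewrite size_takel ?(lab_size Lh) // size_cat /= addn2 => ->.
    by [].
  have := lab_sig Lh v (k := size P); have := lab_sig Lh' v (k := size P).
  rewrite sP => /(_ (leqnn _)) -> /(_ (leqnn _)).
  rewrite (rcons_take (lab_size Lh v)) (rcons_take (lab_size Lh' v)) -Tv hv.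
  by rewrite !pk_last (last_con _ _ Lh) // (last_con _ _ Lh') //; clear -pq cp; lia.
congr rcons; have := key _ _ Lf Lg T; have := key _ _ Lg Lf (fsym T); clia.
Qed.
End Labelings.

(** * Peaks under hops, and triples of corners *)

Lemma pk_nonconsec w k : pk w k -> ~~ pk w k.+1.
Proof. by rewrite /pk; lia. Qed.

Lemma pk_hop_far k j w : k.+4 <= j -> pk (hop k w) j = pk w j.
Proof.
move=> kj; have [lt|le] := ltnP (size w) k.+4; first by rewrite hop_id.
have N i : j <= i -> nth 0 (hop k w) i = nth 0 w i.
  move=> ji; have ki : k.+4 <= i by lia.
  rewrite -(subnK ki) addnC -!nth_drop drop_hop //.
by rewrite /pk !N //; lia.
Qed.

Lemma addable_gt1 t r q : strict t -> addable t r -> q < r -> 1 < t q.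
Proof.
move=> St A qr; have := @strict_add t q (r.-1 - q) St.
have -> : q + (r.-1 - q) = r.-1 by lia.
by move: A; rewrite /addable; lia.
Qed.

(** Meant for the labels [g], whose letters are not known while most of their peaks are shared with
    [f]. Only an exchange of the last two letters of the window can affect the peak [k.+3], and then
    the other peaks place the next letter no higher than either of them. *)
Lemma pk_exchange3 w k : size w = k + 6 -> pk w k.+1 -> pk (hop k w) k -> ~~ pk (hop k w) k.+2 ->
  pk (hop k w) k.+3 = pk w k.+3.
Proof.
elim: k w => [|k IH] [|z1 w] // [sw]; last by apply: IH.
case: w sw => [|z2 [|z3 [|z4 [|z5 [|c [|]]]]]] // _.
rewrite /hop [take 0 _]/= [drop 0 _]/= cat0s /hop4 /pk.
case: ifP => [|_]; last (case: ifP => [|_]; last case: ifP => [|_]); rewrite /=; lia.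
Qed.

(** The counterpart for the three successive hops of [sig_top_lt]; again only peaks are assumed, so
    that it applies to [g]. *)
Lemma pk_exchange2 w w1 w2 w3 k : size w = k + 7 ->
  w1 = hop k.+2 w -> w2 = hop k w1 -> w3 = hop k.+1 w2 ->
  pk w k -> pk w k.+2 -> pk w1 k -> pk w1 k.+3 -> pk w2 k.+1 -> pk w2 k.+3 -> pk w3 k.+2 ->
  pk w3 k.+4 -> pk w k.+4.
Proof.
elim: k w w1 w2 w3 => [|k IH] [|z1 w] w1 w2 w3 // [sw]; last first.
  by move=> -> -> ->; apply: (IH _ _ _ _ sw erefl erefl erefl).
case: w sw => [|z2 [|z3 [|z4 [|z5 [|z6 [|c [|]]]]]]] // _ -> -> ->.
have h2 a b d e k j i : hop 2 [:: a; b; d; e; k; j; i] = [:: a, b & hop4 d e k j ++ [:: i]] by [].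
have h0 a b d e k j i : hop 0 [:: a; b; d; e; k; j; i] = hop4 a b d e ++ [:: k; j; i] by [].
have h1 a b d e k j i : hop 1 [:: a; b; d; e; k; j; i] = a :: hop4 b d e k ++ [:: j; i] by [].
rewrite h2 /hop4.
case: ifP => [H1|H1]; last (case: ifP => [H2|H2]; last case: ifP => [H3|H3]);
 rewrite /cat h0 /hop4;
 (case: ifP => [K1|K1]; last (case: ifP => [K2|K2]; last case: ifP => [K3|K3]));
 rewrite /cat h1 /hop4;
 (case: ifP => [J1|J1]; last (case: ifP => [J2|J2]; last case: ifP => [J3|J3]));
 rewrite /pk /=; lia.
Qed.

Lemma adm_catl u v : adm (u ++ v) -> adm u.
Proof. by rewrite adm_cat => /andP[]. Qed.

Lemma adm_cat_perm u u' v : perm_eq u u' -> adm u' -> adm (u ++ v) -> adm (u' ++ v).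
Proof. by move=> P A; rewrite !adm_cat A (cnt_perm P) => /andP[]. Qed.

Lemma removable_end u r : adm (u ++ [:: r]) -> removable (cnt (u ++ [:: r])) r.
Proof. by rewrite cats1; apply: adm_removable. Qed.

Lemma cnt_cat1 u r : cnt (u ++ [:: r]) = inc (cnt u) r.
Proof. by rewrite cats1 cnt_rcons. Qed.

Lemma inc_injl t t' r : inc t r = inc t' r -> t = t'.
Proof.
move=> E; apply: functional_extensionality => s.
by have := congr1 (@^~ s) E; rewrite /inc; apply: addIn.
Qed.

(** [corner_pair] is used twice: for [r] and [r'], which yields [b] between them, and then for [b]
    and [q], the last premise saying that [q] is still a corner once [r] and [r'] are gone. *)
Lemma corner_triple w r r' q : adm w -> r < r' <= q -> removable (cnt w) r -> removable (cnt w) r' ->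
  (forall t, cnt w = inc (inc t r) r' -> removable t q) ->
  exists R x1 x2 b, [/\ adm (R ++ [:: x1; x2; q; b; r'; r]),
    perm_eq (R ++ [:: x1; x2; q; b; r'; r]) w, r <= b < r', b <= x2 < q & x2 <= x1].
Proof.
move=> A /andP[rr r'q] Rr Rr' Hq.
have [R1 [y [b [A1 A2 P1 [rb br _]]]]] := corner_pair A rr Rr Rr'.
have e1 : R1 ++ [:: y; b; r; r'] = ((R1 ++ [:: y; b]) ++ [:: r]) ++ [:: r'] by rewrite -!catA.
have e2 : R1 ++ [:: y; b; r'; r] = (R1 ++ [:: y; b]) ++ [:: r'; r] by rewrite -!catA.
rewrite e1 in A1 P1; rewrite e2 in A2.
have Aw : adm (R1 ++ [:: y; b]) by apply: adm_catl (adm_catl A1).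
have Rb : removable (cnt (R1 ++ [:: y; b])) b.
  by move: Aw; rewrite -cat_rcons; apply: removable_end.
have Rq : removable (cnt (R1 ++ [:: y; b])) q.
  by apply: Hq; rewrite -(cnt_perm P1) !cnt_cat1.
have bq : b < q by clear -br r'q; lia.
have [R [x1 [x2 [A3 A4 P3 [H1 H2 H3]]]]] := corner_pair Aw bq Rb Rq.
have P4 : perm_eq (R ++ [:: x1; x2; q; b]) (R1 ++ [:: y; b]).
  by apply: perm_trans P3; rewrite perm_cat2l !perm_cons; apply/permP => z /=; clia.
exists R, x1, x2, b; have -> : R ++ [:: x1; x2; q; b; r'; r] = (R ++ [:: x1; x2; q; b]) ++ [:: r'; r].
  by rewrite -catA.
split=> //; try by clear -rb br H1 H2; lia.
  by apply: adm_cat_perm A2; rewrite // perm_sym.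
apply: perm_trans P1; rewrite -[X in perm_eq _ X]catA perm_cat //.
by apply/permP => z /=; clia.
Qed.

Lemma max_exists (P : nat -> Prop) B : (forall r, P r -> r <= B) ->
  (exists r, P r /\ forall r', P r' -> r' <= r) \/ forall r, ~ P r.
Proof.
elim: B => [|B IH] ub.
  case: (classic (P 0)) => H; first by left; exists 0.
  by right=> r Pr; apply: H; have := ub r Pr; rewrite leqn0 => /eqP <-.
case: (classic (P B.+1)) => H; first by left; exists B.+1.
apply: IH => r Pr; have := ub r Pr; rewrite leq_eqVlt => /orP[/eqP E|//].
by case: H; rewrite -E.
Qed.

(** * Adding the last entry *)

(* [f] and [g] label the restrictions to the entries [1, n - 1] and [2, n], with [n = p.+2]. *)
Record glued (V : Type) (sig : V -> nat -> bool) (E : nat -> V -> V -> bool) (p : nat)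
  (f g : V -> seq nat) : Prop := Glued {
  gl_size : 8 <= p;
  gl_f : labeling sig E p.+1 f;
  gl_g : labeling (shiftS sig) (shiftE E) p.+1 g;
  gl_ff : faithful E p.+1 f;
  gl_fg : faithful (shiftE E) p.+1 g;
  gl_sym : forall k u v, E k u v -> E k v u;
  gl_com : forall k l u v w, k + 3 < l -> l.+4 <= p.+2 -> E k u v -> E l u w ->
    exists2 y, E l v y & E k w y
}.

Section Glued.
Variables (V : finType) (sig : V -> nat -> bool) (E : nat -> V -> V -> bool) (p : nat).
Variables f g : V -> seq nat.
Hypothesis G : glued sig E p f g.

Let p8 : 8 <= p := gl_size G.
Let Lf : labeling sig E p.+1 f := gl_f G.
Let Lg : labeling (shiftS sig) (shiftE E) p.+1 g := gl_g G.

(** Both sides label the restriction to [[2, n - 1]]. *)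
Lemma demote_f v : demote (f v) = take p (g v).
Proof.
exact: labeling_unique (lab_demote Lf) (lab_take (leqnSn p) Lg) v.
Qed.

(** In the 0-based indices, with [n = p.+2], [sig v (p - 1)] is the peak at [n - 1] and [E (p - 2)]
    is the top color [n - 3]. *)
Lemma sig_top v : sig v (p - 1) = pk (g v) (p - 2).
Proof. by rewrite -(lab_sig Lg); [rewrite /shiftS; congr sig; lia|lia]. Qed.

Lemma pk_fg v k : k.+4 <= p.+1 -> pk (f v) k.+1 = pk (g v) k.
Proof. by move=> kp; rewrite -(lab_sig Lf) // -(lab_sig Lg) //; lia. Qed.

Lemma edge_f k u v : k.+4 <= p.+1 -> E k u v -> f v = hop k (f u).
Proof. by move=> kp /(lab_edge Lf kp)[]. Qed.

Lemma edge_g k u v : k.+4 <= p.+1 -> E k.+1 u v -> g v = hop k (g u).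
Proof. by move=> kp /(lab_edge Lg kp (u := u) (v := v))[]. Qed.

Lemma size_f v : size (f v) = p.+1. Proof. exact: lab_size Lf v. Qed.
Lemma size_g v : size (g v) = p.+1. Proof. exact: lab_size Lg v. Qed.

Lemma top_active u : sig u (p - 1) -> exists w, E (p - 2) u w.
Proof.
rewrite sig_top => su; have e : (p - 3).+1 = p - 2 by lia.
have kp : (p - 3).+4 <= p.+1 by lia.
have [|w uw] := lab_lift Lg (u := u) kp; last by exists w; rewrite -e.
by apply/eqP; rewrite hop_pk ?size_g // e su orbT.
Qed.

(** An edge seen by [g] leaves distant peaks alone. Color 1 is not seen by [g], but it commutes with
    the top edge that the peak at [n - 1] provides: [v] has a top edge too, hence a peak at [n - 2]
    or [n - 1], and [f] excludes the former. *)
Lemma sig_top_step k u v : k.+4 <= p - 1 -> E k u v -> sig u (p - 1) -> sig v (p - 1).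
Proof.
case: k => [|k] kp uv su; last first.
  by move: su; rewrite !sig_top (edge_g _ uv) ?pk_hop_far //; lia.
have [w uw] := top_active su.
have [||y vy _] := gl_com G _ _ uv uw; try lia.
have e : (p - 3).+1 = p - 2 by lia.
have kp3 : (p - 3).+4 <= p.+1 by lia.
rewrite -e in vy; have [gy] := lab_edge Lg kp3 vy.
move=> /eqP; rewrite gy hop_pk ?size_g // e negbK => /orP[|]; last by rewrite sig_top.
rewrite -pk_fg // (edge_f _ uv) ?pk_hop_far; try lia; rewrite pk_fg //.
by move=> /pk_nonconsec; rewrite e -sig_top su.
Qed.

Lemma sig_top_con u v : con E 0 (p - 1) u v -> sig u (p - 1) = sig v (p - 1).
Proof.
elim=> [//|x y k _ -> _ kp xy]; apply/idP/idP; first exact: sig_top_step xy.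
by apply: sig_top_step kp _; exact: (gl_sym G xy).
Qed.

(** The first [p - 1] entries can be rearranged at will by colors that do not affect this peak. *)
Lemma sig_top_last2 u v P P' s : con E 0 p.+1 u v -> f u = P ++ s -> f v = P' ++ s ->
  size s = 2 -> sig u (p - 1) = sig v (p - 1).
Proof.
move=> uv fu fv ss; have sP : size P = p - 1.
  by have := size_f u; rewrite fu size_cat ss; lia.
have PP : perm_eq P P' by have := con_perm Lf (leqnn _) uv; rewrite fu fv perm_cat2r.
have AP : adm P by have := lab_adm Lf u; rewrite fu adm_cat => /andP[].
have AP' : adm P' by have := lab_adm Lf v; rewrite fv adm_cat => /andP[].
have H := adm_connected AP AP' PP; rewrite sP in H.
have [||w uw fw] := @lift_path _ _ _ _ _ Lf 0 (p - 1) u (P' ++ s); first by lia.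
  by rewrite fu; apply: hpath_cat; rewrite ?sP.
rewrite (sig_top_con uw); congr (sig _ _); apply: (gl_ff G); last by rewrite fv.
apply: con_trans uv; apply: con_sym; first exact: (gl_sym G).
by apply: con_weaken uw; lia.
Qed.

(** If [n - 1] were in a higher row than [n - 2], the smaller entries could be rearranged to make
    [n - 2] a peak next to the peak at [n - 1]. *)
Lemma sig_top_desc u P q r : f u = P ++ [:: q; r] -> sig u (p - 1) -> r <= q.
Proof.
move=> fu su; rewrite leqNgt; apply/negP => qr.
have := lab_adm Lf u; rewrite fu adm_cat /= => /and4P[AP Aq Ar _].
have SP := strict_cnt AP.
have [|x qx Rx] := @removable_above P q.
  by have := addable_gt1 (strict_inc SP Aq) Ar qr; rewrite incE; lia.
have [R AR PR] := rem_last AP Rx.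
have Ay : adm (rcons R x ++ [:: q; r]) by rewrite adm_cat AR (cnt_perm PR) /= Aq Ar.
have [|v uv fv] := exists_label Lf (u := u) Ay; first by rewrite fu perm_sym perm_cat2r.
rewrite (sig_top_last2 uv fu fv) // sig_top in su.
have sR : size R = p - 2 by have := size_f v; rewrite fv size_cat size_rcons /=; lia.
have : pk (f v) (p - 2).
  rewrite fv -cats1 -catA -sR; have := pk_last R x q r; rewrite -cats1 -catA => -> .
  by rewrite qx qr.
have e : (p - 3).+1 = p - 2 by lia.
rewrite -e pk_fg; last by lia.
by move/pk_nonconsec/negP; rewrite e.
Qed.

Lemma edge_fg k u y : k.+4 <= p -> hop k.+1 (f u) = y -> pk (f u) k.+1 || pk (f u) k.+2 ->
  exists v, [/\ con E 1 p.+1 u v, f v = y & g v = hop k (g u)].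
Proof.
move=> kp <- H; have kp' : k.+1.+4 <= p.+1 by lia.
have [|v uv] := lab_lift Lf (u := u) kp'.
  by apply/eqP; rewrite hop_pk ?size_f // H.
exists v; split; [exact: con1 uv|exact: edge_f uv|].
by apply: edge_g uv; lia.
Qed.

Lemma pk_at P a b c s : pk (P ++ [:: a, b, c & s]) (size P) = (b <= a) && (b < c).
Proof. by elim: P. Qed.

Lemma pk_at1 P x a b c s : pk (P ++ [:: x, a, b, c & s]) (size P).+1 = (b <= a) && (b < c).
Proof. by elim: P. Qed.

Lemma pk_at2 P x y a b c s : pk (P ++ [:: x, y, a, b, c & s]) (size P).+2 = (b <= a) && (b < c).
Proof. by elim: P. Qed.

Lemma pk_at3 P x y z a b c s : pk (P ++ [:: x, y, z, a, b, c & s]) (size P).+3 = (b <= a) && (b < c).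
Proof. by elim: P. Qed.

Lemma hop_at1 P x a b c d s : hop (size P).+1 (P ++ [:: x, a, b, c, d & s]) = P ++ x :: hop4 a b c d ++ s.
Proof. by have := hop_at (rcons P x) a b c d s; rewrite size_rcons -!cats1 -!catA. Qed.

Lemma hop_at2 P x y a b c d s : hop (size P).+2 (P ++ [:: x, y, a, b, c, d & s]) = P ++ [:: x, y & hop4 a b c d ++ s].
Proof. by have := hop_at1 (rcons P x) y a b c d s; rewrite size_rcons -!cats1 -!catA. Qed.

Lemma con_p1 u v : con E 1 p.+1 u v -> con E 0 p.+1 u v.
Proof. exact: con_weaken. Qed.

(** Two rows available for the entry [n - 2] are exchanged by a hop whose last entry is [n - 2];
    since [n - 1] is not above it on either side, [pk_exchange3] carries the peak over. *)
Lemma sig_top_same_last u v P P' q q' r : con E 0 p.+1 u v -> f u = P ++ [:: q; r] ->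
  f v = P' ++ [:: q'; r] -> r <= q -> r <= q' -> sig u (p - 1) -> sig v (p - 1).
Proof.
move=> uv fu fv rq rq' su.
have [E0|/eqP nq] := eqVneq q q'; first by subst q'; rewrite -(sig_top_last2 uv fu fv).
have := lab_adm Lf u; rewrite fu adm_cat /= => /and4P[AP Aq Ar _].
have AQ : adm (rcons P q) by rewrite adm_rcons AP.
have := lab_adm Lf v; rewrite fv adm_cat /= => /and4P[AP' Aq' Ar' _].
have AQ' : adm (rcons P' q') by rewrite adm_rcons AP'.
have PQ : perm_eq (rcons P q) (rcons P' q').
  have := con_perm Lf (leqnn _) uv; rewrite fu fv -![_ ++ [:: _; _]]cat_rcons.
  by rewrite perm_cat2r.
have R1 := adm_removable AQ; have R2 := adm_removable AQ'; rewrite -(cnt_perm PQ) in R2.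
(* both orders of the corners [q] and [q'] *)
have [R [x1 [x2 [lo [hi [A1 A2 P1 [H1 H2 H3 H4]]]]]]] : exists R x1 x2 lo hi,
    [/\ adm (R ++ [:: x1; x2; lo; hi]), adm (R ++ [:: x1; x2; hi; lo]),
        perm_eq (R ++ [:: x1; x2; lo; hi]) (rcons P q) &
        [/\ lo <= x2, x2 < hi, x2 <= x1 & (lo, hi) = (q, q') \/ (lo, hi) = (q', q)]].
  have [lt|lt] : q < q' \/ q' < q by clear -nq; lia.
    have [R [x1 [x2 [A1 A2 P1 [H1 H2 H3]]]]] := corner_pair AQ lt R1 R2.
    by exists R, x1, x2, q, q'; split=> //; split=> //; left.
  have [R [x1 [x2 [A1 A2 P1 [H1 H2 H3]]]]] := corner_pair AQ lt R2 R1.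
  by exists R, x1, x2, q', q; split=> //; split=> //; right.
have Au1 : adm ((R ++ [:: x1; x2; lo; hi]) ++ [:: r]).
  by rewrite adm_cat A1 (cnt_perm P1) cnt_rcons /= Ar.
have [|u1 uu1 fu1] := exists_label Lf (u := u) Au1.
  by rewrite fu -cat_rcons perm_cat2r perm_sym.
rewrite -catA /= in fu1.
have sR : size R = p - 4 by have := size_f u1; rewrite fu1 size_cat /=; clia.
have e5 : (p - 5).+1 = size R by move: p8 sR; clia.
have hu1 : hop (size R) (f u1) = R ++ [:: x1; x2; hi; lo; r].
  by rewrite fu1 hop_at hop4_12 //; clear -H1 H2 H3; lia.
have [|||v1 [uv1 fv1 gv1]] := @edge_fg (p - 5) u1 (R ++ [:: x1; x2; hi; lo; r]).
- by move: p8; clia.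
- by rewrite e5.
- by rewrite e5 fu1 pk_at1; clear -H1 H2; lia.
have r1 : r <= lo by case: H4 => -[-> _].
have k1 : (p - 5).+4 <= p.+1 by move: p8; clia.
have k2 : (p - 5).+1.+4 <= p.+1 by move: p8; clia.
have k3 : (p - 5).+2.+4 <= p.+1 by move: p8; clia.
have T : sig u1 (p - 1) = sig v1 (p - 1).
  rewrite !sig_top gv1; have -> : p - 2 = (p - 5).+3 by move: p8; clia.
  symmetry; apply: pk_exchange3.
  - by rewrite size_g; move: p8; clia.
  - by rewrite -pk_fg // e5 fu1 pk_at1; clear -H1 H2; lia.
  - by rewrite -gv1 -pk_fg // e5 fv1 pk_at; clear -H2 H3; lia.
  - by rewrite -gv1 -pk_fg // e5 fv1 pk_at2; clear -r1; lia.
have uv1' : con E 0 p.+1 u v1 by apply: con_trans (con_p1 uv1).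
have fu1' : f u1 = (R ++ [:: x1; x2; lo]) ++ [:: hi; r] by rewrite fu1 -catA.
have fv1' : f v1 = (R ++ [:: x1; x2; hi]) ++ [:: lo; r] by rewrite fv1 -catA.
have S := con_sym (gl_sym G).
case: H4 => -[Elo Ehi]; subst lo hi.
  rewrite -(sig_top_last2 (con_trans (S _ _ _ _ uu1) uv) fu1' fv) // T.
  by rewrite (sig_top_last2 (S _ _ _ _ uv1') fv1' fu).
rewrite -(sig_top_last2 (con_trans (S _ _ _ _ uv1') uv) fv1' fv) // -T.
by rewrite (sig_top_last2 (S _ _ _ _ uu1) fu1' fu).
Qed.

Lemma con_exists u y : adm y -> perm_eq (f u) y -> exists2 v, con E 0 p.+1 u v & f v = y.
Proof. exact: (exists_label Lf). Qed.

(** Three hops lead from a tableau ending in [r] to one ending in [r'], and the peak is pulled back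
    along them. So the rows of [n - 1] where it is a peak form an initial segment of those
    possible. *)
Lemma sig_top_lt u v P P' q q' r r' : con E 0 p.+1 u v -> f u = P ++ [:: q; r] ->
  f v = P' ++ [:: q'; r'] -> r <= q -> r' <= q' -> r < r' -> sig v (p - 1) -> sig u (p - 1).
Proof.
move=> uv fu fv rq rq' rr sv; have S := con_sym (gl_sym G).
have Au := lab_adm Lf u; have Av := lab_adm Lf v; have Puv := con_perm Lf (leqnn _) uv.
have Rr : removable (cnt (f u)) r.
  by move: Au; rewrite fu -cat_rcons; apply: removable_end.
have Rr' : removable (cnt (f u)) r'.
  by rewrite (cnt_perm Puv); move: Av; rewrite fv -cat_rcons; apply: removable_end.
have [|t|R [x1 [x2 [b [A1 P1 /andP[H1 H2] /andP[H3 H4] H5]]]]] := @corner_triple (f u) r r' q' Au _ Rr Rr'.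
- by rewrite rr.
- rewrite (cnt_perm Puv) fv -cat_rcons cnt_cat1 => /inc_injl E0.
  apply: (@removable_neq _ q' r); first by clear -rr rq'; lia.
  by rewrite -E0; apply: adm_removable; apply: (adm_catl (v := [:: r'])); rewrite cat_rcons -fv.
have [|t ut ft] := con_exists (u := u) A1; first by rewrite perm_sym.
have sR : size R = p - 5 by have := size_f t; rewrite ft size_cat /=; clia.
have e6 : (p - 6).+1 = size R by move: p8 sR; clia.
have k0 : (p - 6).+4 <= p by move: p8; clia.
have k1 : (p - 6).+1.+4 <= p by move: p8; clia.
have k2 : (p - 6).+2.+4 <= p by move: p8; clia.
have k3 : (p - 6).+3.+4 <= p.+1 by move: p8; clia.
have [q0 q1 q2] := And3 (leqW k0) (leqW k1) (leqW k2).
have [||t1 [tt1 ft1 gt1]] := @edge_fg (p - 6).+2 t (R ++ [:: x1; x2; q'; b; r; r']) k2.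
- by rewrite e6 ft hop_at2 hop4_12 //; clear -rq' H1 H2; lia.
- by rewrite e6 ft pk_at2; clear -H2 H3 H4; lia.
have [||t2 [tt2 ft2 gt2]] := @edge_fg (p - 6) t1 (R ++ [:: x1; x2; b; q'; r; r']) k0.
- by rewrite e6 ft1 hop_at hop4_12 //; clear -H3 H4 H5; lia.
- by rewrite e6 ft1 pk_at; clear -H4 H5; lia.
have [||t3 [tt3 ft3 gt3]] := @edge_fg (p - 6).+1 t2 (R ++ [:: x1; x2; b; r; q'; r']) k1.
- by rewrite e6 ft2 hop_at1 hop4_12 //; clear -H1 H3 H4; lia.
- by rewrite e6 ft2 pk_at1; clear -H3 H4; lia.
have ct1 := con_trans ut (con_p1 tt1); have ct2 := con_trans ct1 (con_p1 tt2).
have ct3 := con_trans ct2 (con_p1 tt3).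
have st3 : sig t3 (p - 1).
  rewrite -(@sig_top_last2 v t3 P' (R ++ [:: x1; x2; b; r]) [:: q'; r']) //.
  - exact: con_trans (S _ _ _ _ uv) ct3.
  - by rewrite ft3 -catA.
apply: (@sig_top_same_last t u (R ++ [:: x1; x2; q'; b]) P r' q r) => //.
- exact: S.
- by rewrite ft -catA.
- by clear -rr; lia.
move: st3; rewrite !sig_top; have -> : p - 2 = (p - 6).+4 by move: p8; clia.
apply: (pk_exchange2 _ gt1 gt2 gt3).
- by rewrite size_g; move: p8; clia.
- by rewrite -pk_fg // e6 ft pk_at; clear -H4 H5; lia.
- by rewrite -pk_fg // e6 ft pk_at2; clear -H2 H3 H4; lia.
- by rewrite -pk_fg // e6 ft1 pk_at; clear -H4 H5; lia.
- by rewrite -pk_fg // e6 ft1 pk_at3; clear -H1 rr; lia.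
- by rewrite -pk_fg // e6 ft2 pk_at1; clear -H3 H4; lia.
- by rewrite -pk_fg // e6 ft2 pk_at3; clear -rr rq'; lia.
- by rewrite -pk_fg // e6 ft3 pk_at2; clear -H1 H2 rq'; lia.
Qed.

Definition fits u c := addable (cnt (f u)) c /\
  forall v, con E 0 p.+1 u v -> sig v (p - 1) = pk (rcons (f v) c) (p - 1).

Lemma fits_con u v c : con E 0 p.+1 u v -> fits u c -> fits v c.
Proof.
move=> uv [A H]; split; first by rewrite -(cnt_perm (con_perm Lf (leqnn _) uv)).
by move=> w vw; apply: H; apply: con_trans vw.
Qed.

Lemma fits_uniq u c c' : fits u c -> fits u c' -> c = c'.
Proof.
have key d d' : fits u d -> fits u d' -> ~ d < d'.
  move=> [A H] [A' H'] lt; have [P [q [r [AP PP [rq dr]]]]] := last_det (lab_adm Lf u) A A' lt.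
  have [|v uv fv] := con_exists (u := u) AP; first by rewrite perm_sym.
  have sP : size P = p - 1 by have := size_f v; rewrite fv size_cat /=; clia.
  have := H v uv; rewrite (H' v uv) fv -sP !pk_last; clear -rq dr; lia.
by move=> F F'; have := key _ _ F F'; have := key _ _ F' F; clia.
Qed.

Lemma f_last2 v : exists P q r, f v = P ++ [:: q; r].
Proof.
have := size_f v; case/lastP: (f v) => // w r; case/lastP: w => [|P q _].
  by rewrite /=; move: p8; clia.
by exists P, q, r; rewrite -!cats1 -catA.
Qed.

(** The new cell goes in the row just above the highest row in which [n - 1] is a peak somewhere in
    the component, or in row 0 if it never is. Higher rows are excluded by maximality, and the
    others are peaks by [sig_top_lt] and [sig_top_same_last]. *)
Lemma fits_exists u : exists c, fits u c.
Proof.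
pose good r := exists v P q, [/\ con E 0 p.+1 u v, f v = P ++ [:: q; r] & sig v (p - 1)].
have [[r [[v [P [q [uv fv sv]]]] max]]|none] : (exists r, good r /\ forall r', good r' -> r' <= r) \/
    forall r, ~ good r.
  apply: (@max_exists good (\max_(x <- f u) x)) => r [v [P [q [uv fv _]]]].
  apply: (@leq_bigmax_seq _ _ xpredT id r _ isT).
  by rewrite (perm_mem (con_perm Lf (leqnn _) uv)) fv mem_cat !inE eqxx !orbT.
- exists r.+1; have rq := sig_top_desc fv sv.
  have Av := lab_adm Lf v; have Puv := con_perm Lf (leqnn _) uv.
  split.
    have := Av; rewrite (cnt_perm Puv) fv -cat_rcons => /[dup] /adm_catl /strict_cnt St /removable_end.
    rewrite cnt_cat1 /removable /addable /= incE inc_neq; last by clia.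
    have : 0 < cnt (rcons P q) r by apply: (strict_gt0 St rq); rewrite cnt_rcons incE.
    by clia.
  move=> w uw; have [Q [q' [r' fw]]] := f_last2 w.
  have sQ : size Q = p - 1 by have := size_f w; rewrite fw size_cat /=; clia.
  rewrite fw -sQ pk_last ltnS sQ; apply/idP/andP => [sw|[H1 H2]].
    by split; [exact: sig_top_desc fw sw|apply: max; exists w, Q, q'].
  have vw : con E 0 p.+1 v w by apply: con_trans uw; apply: (con_sym (gl_sym G)).
  have wv := con_sym (gl_sym G) vw.
  move: H2; rewrite leq_eqVlt => /orP[/eqP E0|lt]; last exact: sig_top_lt wv fw fv _ _ lt sv.
  by subst r'; apply: sig_top_same_last vw fv fw _ _ sv.
- exists 0; split=> // w uw; have [Q [q [r fw]]] := f_last2 w.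
  have sQ : size Q = p - 1 by have := size_f w; rewrite fw size_cat /=; clia.
  rewrite fw -sQ pk_last ltn0 andbF sQ; apply/negbTE/negP => sw.
  by apply: (none r); exists w, Q, q.
Qed.

End Glued.

Variant hop4_spec a b c d : seq nat -> Prop :=
| Hop12 of b <= a & d <= b < c \/ c <= b < d : hop4_spec a b c d [:: a; b; d; c]
| Hop14 lo hi of lo < hi & (b, c) = (lo, hi) \/ (b, c) = (hi, lo) & lo <= a & lo < d &
    a < hi \/ d <= hi : hop4_spec a b c d [:: a; c; b; d]
| Hop43 lo hi of (a, b) = (lo, hi) \/ (a, b) = (hi, lo) & lo < c <= hi & c < d :
    hop4_spec a b c d [:: b; a; c; d]
| HopId : hop4_spec a b c d [:: a; b; c; d].

Lemma hop4P a b c d : hop4_spec a b c d (hop4 a b c d).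
Proof.
rewrite /hop4; case: ifP => [H|_]; first by apply: Hop12; lia.
case: ifP => [H|_].
  by apply: (@Hop14 _ _ _ _ (minn b c) (maxn b c)); try lia; case: (leqP b c) => bc; [left|right]; congr pair; lia.
case: ifP => [H|_]; last exact: HopId.
by apply: (@Hop43 _ _ _ _ (minn a b) (maxn a b)); try lia; case: (leqP a b) => bc; [left|right]; congr pair; lia.
Qed.

Lemma adm_ext (P : seq nat) r : adm P -> 0 < cnt P r ->
  exists Q s, [/\ adm (Q ++ [:: s]), perm_eq (Q ++ [:: s]) P & r <= s].
Proof.
move=> A /removable_above[s rs Rs]; have [Q AQ PQ] := rem_last A Rs.
by exists Q, s; rewrite cats1.
Qed.
Lemma adm_swap_gt0 P x y : adm (P ++ [:: y; x]) -> y < x -> 0 < cnt P y.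
Proof.
rewrite adm_cat /= => /and4P[AP Ay Ax _] yx.
by have := addable_gt1 (strict_inc (strict_cnt AP) Ay) Ax yx; rewrite incE.
Qed.

Lemma adm_lt_gt0 P x y : adm (P ++ [:: x]) -> y < x -> 0 < cnt P y.
Proof.
rewrite adm_cat /= => /and3P[AP Ax _] yx.
by have := addable_gt1 (strict_cnt AP) Ax yx; clia.
Qed.

(* When a hop does not move the last letter, a suitable choice of the prefix
   makes it a composite of hops away from that letter. *)
Lemma hop_path P r1 r2 r3 c t1 t2 t3 : 4 <= size P -> adm (P ++ [:: r1; r2; r3; c]) ->
  hop4 r1 r2 r3 c = [:: t1; t2; t3; c] -> [:: r1; r2; r3] <> [:: t1; t2; t3] ->
  exists P0, [/\ adm P0, perm_eq P0 P &
    hpath 1 (size P + 3) (P0 ++ [:: r1; r2; r3]) (P0 ++ [:: t1; t2; t3])].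
Proof.
move=> sP A E12 ne.
have A' : adm (P ++ [:: t1; t2; t3; c]).
  by have := adm_hop (size P) A; rewrite hop_at E12.
have AP := adm_catl A.
have one s y1 y2 y3 : 0 < cnt P s -> (forall s0, s <= s0 -> hop4 s0 r1 r2 r3 = [:: s0; y1; y2; y3]) ->
    exists P0, [/\ adm P0, perm_eq P0 P & hpath 1 (size P + 3) (P0 ++ [:: r1; r2; r3]) (P0 ++ [:: y1; y2; y3])].
  move=> cs H; have [Q [s0 [AQ PQ ss]]] := adm_ext AP cs.
  exists (Q ++ [:: s0]); split=> //.
  have sQ : size Q + 1 = size P by rewrite -(perm_size PQ) size_cat.
  have -> : (Q ++ [:: s0]) ++ [:: y1; y2; y3] = hop (size Q) ((Q ++ [:: s0]) ++ [:: r1; r2; r3]).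
    by rewrite -!catA hop_at (H s0 ss).
  by apply: hpath1; move: sP sQ; clia.
have cl x y z : adm (P ++ [:: x; y; z; c]) -> [/\ adm (P ++ [:: x]), adm (P ++ [:: x; y]) & adm (P ++ [:: x; y; z])].
  move=> H; split; [apply: (adm_catl (v := [:: y; z; c]))|apply: (adm_catl (v := [:: z; c]))|
    apply: (adm_catl (v := [:: c]))]; by rewrite -catA.
have [A1 A2 A3] := cl _ _ _ A; have [A1' A2' A3'] := cl _ _ _ A'.
move: E12 ne; case: hop4P => [H1 H2|lo hi lh E H1 H2 H3|lo hi E H1 H2|] [] *; subst.
- by exfalso; move: H2; clia.
(* If [t1 < hi], one hop of the preceding color makes the exchange, provided that a high enough
   letter stands before the window. Otherwise the exchange is conjugated by hops swapping [t1] with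
   a letter [b] between [lo] and [hi]. *)
- have [lt|le] := ltnP t1 hi.
    apply: (one t1).
      by case: E => -[? ?]; subst; [apply: adm_swap_gt0 A2' lt|apply: adm_swap_gt0 A2 lt].
    move=> s0 ss; apply: hop4_12 => //.
    by case: E => -[? ?]; subst; move: H1 lt; clia.
  have cb : c <= hi by case: H3 => //; move: le; clia.
  have [Au Av] : adm ((P ++ [:: t1; lo]) ++ [:: hi]) /\ adm ((P ++ [:: t1; hi]) ++ [:: lo]).
    by rewrite -!catA /=; case: E => -[? ?]; subst.
  have [|||t|R [x1 [x2 [b [A4 P4 H4 H5 H6]]]]] := @corner_triple _ lo hi t1 Au.
  + by rewrite lh le.
  + have -> : cnt ((P ++ [:: t1; lo]) ++ [:: hi]) = cnt ((P ++ [:: t1; hi]) ++ [:: lo]).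
      by apply: cnt_perm; rewrite -!catA perm_cat2l !perm_cons; apply/permP => z /=; clia.
    exact: removable_end.
  + exact: removable_end.
  + have -> : (P ++ [:: t1; lo]) ++ [:: hi] = ((P ++ [:: t1]) ++ [:: lo]) ++ [:: hi] by rewrite -!catA.
    rewrite !cnt_cat1 => /inc_injl/inc_injl <-; rewrite -cnt_cat1.
    exact: removable_end.
  have h1 u v : hop (size R) (R ++ [:: x1; x2; b; t1; u; v]) = R ++ [:: x1; x2; t1; b; u; v].
    by rewrite hop_at hop4_12 //; move: H5 H6; clia.
  have h1' u v : hop (size R) (R ++ [:: x1; x2; t1; b; u; v]) = R ++ [:: x1; x2; b; t1; u; v].
    by rewrite -h1 hopK.
  have A5 : adm (R ++ [:: x1; x2; b; t1; hi; lo]) by rewrite -h1'; apply: adm_hop.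
  have P5 : perm_eq (R ++ [:: x1; x2; b]) P.
    rewrite -(perm_cat2r [:: t1; hi; lo]) -catA /= -h1' (perm_trans (hop_perm _ _)) //.
    apply: perm_trans P4 _; rewrite -!catA perm_cat2l !perm_cons.
    by apply/permP => z /=; clia.
  exists (R ++ [:: x1; x2; b]); split=> //; first by apply: (adm_catl (v := [:: t1; hi; lo])); rewrite -catA.
  have sR : size R + 3 = size P by rewrite -(perm_size P5) size_cat.
  rewrite -!catA /=.
  have h2 : hop (size R).+2 (R ++ [:: x1; x2; t1; b; t3; t2]) = R ++ [:: x1; x2; t1; b; t2; t3].
    by rewrite hop_at2 hop4_12 //; case: E => -[? ?]; subst; move: H4 H5 lh; clia.
  rewrite -[X in hpath _ _ _ X]h1' -h2 -h1; 
  apply: HStep; [apply: HStep; [apply: HStep; [exact: HRefl| |]| |]| |];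
    move: sP sR; clia.
- apply: (one lo).
    by case: E => -[? ?]; subst; [apply: adm_lt_gt0 A1' _|apply: adm_lt_gt0 A1 _]; move: H1; clia.
  move=> s0 ss; apply: hop4_14.
  by case: E => -[? ?]; subst; move: H1 ss; clia.
- by congruence.
Qed.

Lemma demote_rcons w c : adm (rcons w c) -> 0 < size w ->
  demote (rcons w c) = demote w ++ (slide (cnt (demote w)) (hole w) [:: c]).1.
Proof.
move=> A; case: w A => // a w _ _.
by rewrite /demote /hole /= -cats1 slide_cat.
Qed.

Lemma size_slide1 t h c : exists q, (slide t h [:: c]).1 = [:: q].
Proof. by rewrite slide_cons /=; exists (if (c != h) && addable t c then (c, h) else (h, c)).1. Qed.

(* A labeling [T] of the whole graph compatible with [f] and [g]; it remains to
   see that it follows the edges of the top color. *)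
Record capped (V : Type) (sig : V -> nat -> bool) (E : nat -> V -> V -> bool) (p : nat)
  (f g T : V -> seq nat) : Prop := Capped {
  cp_glued : glued sig E p f g;
  cp_adm : forall v, adm (T v);
  cp_size : forall v, size (T v) = p.+2;
  cp_sig : forall v k, k.+3 <= p.+2 -> sig v k = pk (T v) k;
  cp_f : forall v, f v = take p.+1 (T v);
  cp_last : forall u v, con E 0 p.+1 u v -> last 0 (T u) = last 0 (T v);
  cp_g : forall v, demote (T v) = g v
}.

Section Cap.
Variables (V : finType) (sig : V -> nat -> bool) (E : nat -> V -> V -> bool) (p : nat).
Variables f g : V -> seq nat.
Hypothesis Gl : glued sig E p f g.

(** By [demote_f], the rectification of the new label can differ from [g v] only in the last letter.
    Both candidates for it are constant along the colors common to [f] and [g] and give the same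
    peak at [n - 1], so [last_det] rules out two values. *)
Lemma capped_exists : exists T, capped sig E p f g T.
Proof.
have [c Hc] := fin_all_exists (fits_exists Gl).
have p8 := gl_size Gl; have S := con_sym (gl_sym Gl).
have cc u v : con E 0 p.+1 u v -> c u = c v.
  by move=> uv; exact: (fits_uniq Gl (fits_con Gl uv (Hc u)) (Hc v)).
have Lf := gl_f Gl; have Lg := gl_g Gl.
pose T v := rcons (f v) (c v).
have AT v : adm (T v) by rewrite adm_rcons (lab_adm Lf) (Hc v).1.
have sT v : size (T v) = p.+2 by rewrite size_rcons (lab_size Lf).
have fT v : take p.+1 (T v) = f v by rewrite /T -cats1 take_size_cat ?(lab_size Lf).
have sigT v k : k.+3 <= p.+2 -> sig v k = pk (T v) k.
  rewrite leq_eqVlt => /orP[/eqP E0|kp].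
    have [_ H] := Hc v; have -> : k = p - 1 by move: E0 p8; clia.
    by rewrite H //; apply: ConRefl.
  by rewrite (lab_sig Lf) // -fT pk_take.
exists T; split=> //.
- by move=> u v uv; rewrite !last_rcons; apply: cc.
move=> v; have sf u : 0 < size (f u) by rewrite (lab_size Lf).
have dT u := demote_rcons (AT u) (sf u).
have [q Eq] := size_slide1 (cnt (demote (f v))) (hole (f v)) (c v).
have df := demote_f Gl; rewrite dT Eq df.
have Tg := rcons_take (lab_size Lg v); rewrite cats1 [RHS]Tg; congr rcons.
set q' := last 0 (g v) in Tg *.
have lastM u : con E 1 p.+1 v u -> last 0 (g u) = q' /\ (slide (cnt (demote (f u))) (hole (f u)) [:: c u]).1 = [:: q].
  move=> vu; have vu0 := con_p1 vu.
  have [h1 P1] : hole (f u) = hole (f v) /\ last 0 (g u) = q'.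
    elim: vu {vu0} => // x y k _ [<- <-] k1 k2 xy; case: k k1 k2 xy => // k _ kp xy.
    rewrite (edge_f Gl kp xy) (demote_hop (lab_adm Lf x) _).2; last by rewrite (lab_size Lf); move: kp; clia.
    rewrite (edge_g Gl _ xy); last by move: kp; clia.
    split=> //; rewrite {1}(rcons_take (lab_size Lg x)) hop_rcons ?last_rcons //.
    by rewrite size_takel ?(lab_size Lg).
  split=> //; rewrite -(cc _ _ vu0) h1 -Eq; congr (slide _ _ _).1.
  have Pf := con_perm Lf (leqnn _) vu0.
  have [_ I1] := demote_hole (lab_adm Lf v) (sf v); have [_ I2] := demote_hole (lab_adm Lf u) (sf u).
  by apply: (@inc_injl _ _ (hole (f v))); rewrite I1 -{1}h1 I2 (cnt_perm Pf).
have Ag : addable (cnt (demote (f v))) q'.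
  by have := lab_adm Lg v; rewrite Tg adm_rcons df => /andP[].
have Aq : addable (cnt (demote (f v))) q.
  by have := adm_demote (AT v); rewrite dT Eq cats1 adm_rcons => /andP[].
have key d d' : (d, d') = (q, q') \/ (d, d') = (q', q) -> d < d' -> False.
  move=> Ed lt; have [Ad Ad'] : addable (cnt (demote (f v))) d /\ addable (cnt (demote (f v))) d'.
    by case: Ed => -[-> ->].
  have [P [q1 [r [AP PP [rq dr]]]]] := last_det (adm_demote (lab_adm Lf v)) Ad Ad' lt.
  have [|u vu fu] := exists_label (lab_demote Lf) (u := v) AP; first by rewrite perm_sym.
  have /con_shift vu1 := vu; have [g1 g2] := lastM u vu1.
  have sP : size P = p - 2.
    by have := congr1 size fu; rewrite size_demote (lab_size Lf) size_cat /=; clia.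
  have s1 : sig u (p - 1) = pk (rcons (P ++ [:: q1; r]) q') (size P).
    rewrite (sig_top Gl) sP (rcons_take (lab_size Lg u)) g1 -(demote_f Gl) fu //.
  have s2 : sig u (p - 1) = pk (rcons (P ++ [:: q1; r]) q) (size P).
    rewrite sigT; last by move: p8; clia.
    have e : (p - 2).+1 = p - 1 by move: p8; clia.
    rewrite -e -demote_pk ?sT //; last by move: p8; clia.
    by rewrite dT g2 fu cats1 sP.
  move: s1; rewrite s2 !pk_last; case: Ed => -[? ?]; subst d d'; move: rq dr; clia.
case: (ltngtP q q') => // lt.
- by case: (key q q' (or_introl erefl) lt).
- by case: (key q' q (or_intror erefl) lt).
Qed.

End Cap.

(** * Edges of the top color *)

Section Capped.
Variables (V : finType) (sig : V -> nat -> bool) (E : nat -> V -> V -> bool) (p : nat).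
Variables f g T : V -> seq nat.
Hypothesis H : capped sig E p f g T.

Let Gl := cp_glued H.
Let Lf := gl_f Gl.
Let Lg := gl_g Gl.
Let p8 : 8 <= p := gl_size Gl.
Let S lo hi u v : con E lo hi u v -> con E lo hi v u := con_sym (gl_sym Gl).

Lemma T_rcons v : T v = rcons (f v) (last 0 (T v)).
Proof. by rewrite (cp_f H); apply: rcons_take; apply: cp_size H v. Qed.

Lemma T_edge k u v : k.+4 <= p.+1 -> E k u v -> T v = hop k (T u).
Proof.
move=> kp uv; rewrite (T_rcons v) (T_rcons u) (edge_f Gl kp uv) hop_rcons ?(lab_size Lf) //.
by rewrite (cp_last H (con1 (leq0n k) kp uv)).
Qed.

Lemma T_con lo u v : con E lo p.+1 u v -> hpath lo p.+1 (T u) (T v).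
Proof.
elim=> [|x y k _ IH k1 k2 xy]; first exact: HRefl.
by rewrite (T_edge k2 xy); apply: HStep.
Qed.

Lemma T_lift lo hi u x y s : T u = x ++ s -> 0 < size s -> hi <= size x -> hpath lo hi x y ->
  exists2 v, con E lo hi u v & T v = y ++ s.
Proof.
case/lastP: s => // s c Tu _ hx xy.
have [fu lu] : f u = x ++ s /\ last 0 (T u) = c.
  have e : rcons (f u) (last 0 (T u)) = rcons (x ++ s) c by rewrite -T_rcons Tu rcons_cat.
  by case: (rcons_inj e).
have hp : hi <= p.+1.
  by have := lab_size Lf u; rewrite fu size_cat; move: hx; clia.
have [|v uv fv] := lift_path Lf (lo := lo) (u := u) (y := y ++ s) hp.
  by rewrite fu; apply: hpath_cat.
exists v => //; rewrite (T_rcons v) fv -(cp_last H (u := u)) ?lu ?rcons_cat //.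
by apply: con_weaken uv.
Qed.

Lemma T_exists u x y s : T u = x ++ s -> 0 < size s -> adm y -> perm_eq x y ->
  exists2 v, con E 0 (size x) u v & T v = y ++ s.
Proof.
move=> Tu ss Ay P; apply: (T_lift Tu) => //; apply: adm_connected => //.
by apply: (@adm_catl x s); rewrite -Tu; apply: cp_adm H u.
Qed.

Lemma R_inj u v : con E 1 p.+2 u v -> g u = g v -> u = v.
Proof. by move=> uv; apply: (gl_fg Gl); apply/con_shift. Qed.

Lemma L_inj u v : con E 0 p.+1 u v -> T u = T v -> u = v.
Proof. by move=> uv e; apply: (gl_ff Gl uv); rewrite !(cp_f H) e. Qed.

Let e3 : (p - 3).+1 = p - 2. Proof. by move: p8; clia. Qed.
Let k3 : (p - 3).+4 <= p.+1. Proof. by move: p8; clia. Qed.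
Let k2 : (p - 2).+4 <= p.+2. Proof. by move: p8; clia. Qed.
Let q2 : 1 <= p - 2. Proof. by move: p8; clia. Qed.

Lemma demote_top v : demote (hop (p - 2) (T v)) = hop (p - 3) (g v).
Proof.
rewrite -e3 -(cp_g H); apply: (demote_hop (cp_adm H v) _).1.
by rewrite (cp_size H); move: k3; clia.
Qed.

Lemma top_edge v w : E (p - 2) v w -> g w = demote (hop (p - 2) (T v)).
Proof. by rewrite demote_top -e3 => /(edge_g Gl k3). Qed.

Lemma top_con v w : E (p - 2) v w -> con E 1 p.+2 v w.
Proof. exact: con1. Qed.

Lemma top_lift v : hop (p - 2) (T v) <> T v -> exists w, E (p - 2) v w.
Proof.
move=> ne; have [e|w vw] := lab_lift Lg (u := v) k3; last by exists w; rewrite -e3.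
apply: ne; apply: demote_inj; rewrite ?hop_perm ?adm_hop ?(cp_adm H) //.
by rewrite demote_top e (cp_g H).
Qed.

Lemma top_nontrivial v w : E (p - 2) v w -> hop (p - 2) (T v) <> T v.
Proof.
move=> vw e; have := vw; rewrite -e3 => /(lab_edge Lg k3 (u := v) (v := w))[_]; apply.
by rewrite (top_edge vw) e (cp_g H).
Qed.

Lemma top_uniq v w w' : E (p - 2) v w -> E (p - 2) v w' -> w = w'.
Proof.
move=> vw vw'; apply: R_inj; last by rewrite !(top_edge vw) (top_edge vw').
by apply: con_trans (top_con vw'); apply: S; apply: top_con.
Qed.

Lemma top_transport v w v' : E (p - 2) v w -> con E 0 (p - 2) v v' ->
  exists2 w', E (p - 2) v' w' & con E 0 (p - 2) w w'.
Proof.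
move=> vw; elim=> [|x y k _ [w' xw ww] k0 kp xy]; first by exists w => //; apply: ConRefl.
have [||z yz wz] := gl_com Gl _ _ xy xw; [by move: kp; clia|exact: k2|].
by exists z => //; apply: ConStep wz.
Qed.

Lemma take_hop_top v P r1 r2 r3 c : T v = P ++ [:: r1; r2; r3; c] -> size P = p - 2.
Proof. by move/(congr1 size); rewrite (cp_size H) size_cat /=; clia. Qed.

Lemma hop_top v P r1 r2 r3 c : T v = P ++ [:: r1; r2; r3; c] ->
  hop (p - 2) (T v) = P ++ hop4 r1 r2 r3 c.
Proof. by move=> e; rewrite -(take_hop_top e) e hop_at cats0. Qed.

(** The edge is transported by low colors to a vertex where [hop_path] realizes the hop by colors
    seen by both [f] and [g]. The end of that path and the end of the edge have equal labels in one
    component of [g], so they coincide; this fixes the shape at [w], and [demote_inj] gives the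
    label. *)
Lemma noncrossing v w P r1 r2 r3 c t1 t2 t3 : T v = P ++ [:: r1; r2; r3; c] ->
  hop4 r1 r2 r3 c = [:: t1; t2; t3; c] -> E (p - 2) v w ->
  con E 0 p.+1 v w /\ T w = hop (p - 2) (T v).
Proof.
move=> Tv h4 vw; have sP := take_hop_top Tv.
have Av := cp_adm H v; rewrite Tv in Av.
have ne : [:: r1; r2; r3] <> [:: t1; t2; t3].
  by move=> [? ? ?]; subst; apply: (top_nontrivial vw); rewrite (hop_top Tv) h4 Tv.
have [|P0 [A0 P0P path]] := hop_path _ Av h4 ne; first by rewrite sP; move: p8; clia.
have [|v0 vv0 Tv0] := T_exists Tv isT A0; first by rewrite perm_sym.
rewrite sP in vv0 path; have [w0 vw0 ww0] := top_transport vw vv0.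
have Tv0' : T v0 = (P0 ++ [:: r1; r2; r3]) ++ [:: c] by rewrite Tv0 -catA.
have e1 : p - 2 + 3 = p.+1 by move: p8; clia.
rewrite e1 in path.
have [|v1 v01 Tv1] := T_lift Tv0' isT _ path.
  by rewrite size_cat (perm_size P0P) sP e1.
have h0 : hop (p - 2) (T v0) = T v1.
  by rewrite Tv1 -catA (hop_top Tv0) h4.
have E1 : w0 = v1.
  apply: R_inj; last by rewrite (top_edge vw0) h0 (cp_g H).
  by apply: con_trans (con_weaken _ _ v01) => //; apply: S; apply: top_con.
have cvw : con E 0 p.+1 v w.
  apply: con_trans (con_trans (con_weaken (leqnn 0) _ vv0) (con_p1 v01)) _; first by clia.
  by rewrite -E1; apply: S; apply: con_weaken ww0; clia.
split=> //; rewrite (T_rcons w) -(cp_last H cvw) Tv last_cat /= -Tv (hop_top Tv) h4.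
have -> : P ++ [:: t1; t2; t3; c] = rcons (P ++ [:: t1; t2; t3]) c by rewrite -cats1 -catA.
congr rcons; have Ah := adm_hop (p - 2) (cp_adm H v); rewrite (hop_top Tv) h4 in Ah.
have At : adm (P ++ [:: t1; t2; t3]) by apply: (adm_catl (v := [:: c])); rewrite -catA.
have fv : f v = P ++ [:: r1; r2; r3].
  have e : rcons (f v) (last 0 (T v)) = rcons (P ++ [:: r1; r2; r3]) c.
    by rewrite -T_rcons Tv -cats1 -catA.
  by case: (rcons_inj e).
apply: demote_inj; rewrite ?(lab_adm Lf) //.
  apply: perm_trans (_ : perm_eq (f v) _); first by rewrite perm_sym; exact: (con_perm Lf (leqnn _) cvw).
  rewrite fv perm_cat2l -(perm_cat2r [:: c]) /= -h4 perm_sym.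
  exact: (hop4s_perm [:: r1; r2; r3; c]).
rewrite (demote_f Gl) (top_edge vw) (hop_top Tv) h4.
have -> : P ++ [:: t1; t2; t3; c] = rcons (P ++ [:: t1; t2; t3]) c by rewrite -cats1 -catA.
rewrite demote_rcons ?take_size_cat //.
- by rewrite size_demote size_cat sP e1.
- by rewrite -cats1 -catA.
- by rewrite size_cat addn3.
Qed.

(** The case [Hop12] of [hop4], the only one in which the entry [n] changes place. *)
Definition crossing v d c := exists P r1 r2,
  [/\ T v = P ++ [:: r1; r2; d; c], r2 <= r1 & d <= r2 < c \/ c <= r2 < d].

Lemma crossing_top v d c : crossing v d c ->
  exists2 U, T v = U ++ [:: d; c] & hop (p - 2) (T v) = U ++ [:: c; d].
Proof.
case=> P [r1 [r2 [Tv r21 dc]]]; exists (P ++ [:: r1; r2]); rewrite -?catA //.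
by rewrite (hop_top Tv) hop4_12 //; case: dc; [right|left].
Qed.

Lemma size_crossing v U d c : T v = U ++ [:: d; c] -> size U = p.
Proof. by move/(congr1 size); rewrite (cp_size H) size_cat /=; clia. Qed.

Lemma crossing_neq v d c : crossing v d c -> d <> c.
Proof. by case=> P [r1 [r2 [_ _]]]; clia. Qed.

Lemma crossing_edge v d c : crossing v d c -> exists w, E (p - 2) v w.
Proof.
move=> C; apply: top_lift; have [U -> ->] := crossing_top C => /eqP.
by rewrite eqseq_cat // eqxx /= !eqseq_cons => /and3P[/eqP e]; case: (crossing_neq C).
Qed.

(** The path from [v] to [v'] moves none of the entries 1, [n - 1] and [n]. It can be replayed from
    [w] on the labels [g], with [d] and [c] exchanged, and ends at [w'] because [g] is faithful. *)
Lemma crossing_step v w v' w' d c : con E 1 p v v' -> crossing v d c -> crossing v' d c ->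
  E (p - 2) v w -> E (p - 2) v' w' -> con E 0 p.+1 w w'.
Proof.
move=> vv' C C' vw vw'; have [U Tv hv] := crossing_top C; have [U' Tv' hv'] := crossing_top C'.
have sU := size_crossing Tv; have sU' := size_crossing Tv'.
have Ay : adm (U ++ [:: c; d]) by rewrite -hv; apply: adm_hop; apply: cp_adm H v.
have [w2 ww2 gw2] : exists2 w2, con E 1 p w w2 & g w2 = demote (take p (T v') ++ [:: c; d]).
  have : perm_eq (take p (T v')) U.
    elim: vv' => [|x y k _ IH k1 kp xy]; first by rewrite Tv take_size_cat.
    rewrite (T_edge (leqW kp) xy) take_hop ?(cp_size H) //; last by clia.
    exact: perm_trans (hop_perm _ _) IH.
  elim: vv' => [|x y k vx IH k1 kp xy] Py.
    by exists w; [exact: ConRefl|rewrite Tv take_size_cat // (top_edge vw) hv].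
  have sx : size (take p (T x)) = p by rewrite size_takel // (cp_size H); clia.
  have ey : take p (T y) = hop k (take p (T x)).
    by rewrite (T_edge (leqW kp) xy) take_hop ?(cp_size H) //; clia.
  have Px : perm_eq (take p (T x)) U.
    by apply: perm_trans Py; rewrite ey perm_sym hop_perm.
  have [z wz gz] := IH Px.
  have Ax : adm (take p (T x) ++ [:: c; d]).
    apply: adm_cat_perm Ay; first by rewrite perm_sym.
    by apply: adm_take; apply: cp_adm H x.
  case: k k1 kp ey {xy} => // k _ kp ey.
  have dy : demote (take p (T y) ++ [:: c; d]) = hop k (g z).
    rewrite ey -hop_cat_r ?sx // gz; apply: (demote_hop Ax _).1.
    by rewrite size_cat sx; move: kp; clia.
  have [e|/eqP ne] := eqVneq (hop k (g z)) (g z); first by exists z; rewrite ?dy.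
  have kp' : k.+4 <= p.+1 by move: kp; clia.
  have [y' zy] := lab_lift Lg kp' ne; exists y'; first exact: (ConStep wz _ kp zy).
  by rewrite dy; have [] := lab_edge Lg kp' zy.
have E2 : w2 = w'.
  apply: R_inj; last by rewrite gw2 (top_edge vw') hv' Tv' take_size_cat.
  have cW a b : con E 1 p a b -> con E 1 p.+2 a b by apply: con_weaken; clia.
  apply: con_trans (top_con vw'); apply: con_trans (cW _ _ vv'); apply: con_trans (S (top_con vw)).
  exact: S (cW _ _ ww2).
by rewrite -E2; apply: con_weaken ww2.
Qed.

(** Tableaux that share their last four letters are joined by colors commuting with the top one. *)
Lemma crossing_prefix v w v' w' P P' r1 r2 d c : con E 0 p.+1 v v' -> T v = P ++ [:: r1; r2; d; c] ->
  T v' = P' ++ [:: r1; r2; d; c] -> E (p - 2) v w -> E (p - 2) v' w' -> con E 0 (p - 2) w w'.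
Proof.
move=> vv' Tv Tv' vw vw'; have sP := take_hop_top Tv.
have PP : perm_eq P P' by have := hpath_perm (T_con vv'); rewrite Tv Tv' perm_cat2r.
have AP' : adm P' by apply: (adm_catl (v := [:: r1; r2; d; c])); rewrite -Tv'; apply: cp_adm H v'.
have [v2 vv2 Tv2] := T_exists Tv isT AP' PP; rewrite sP in vv2.
have E2 : v2 = v'.
  apply: L_inj; last by rewrite Tv2 Tv'.
  by apply: con_trans vv'; apply: S; apply: con_weaken vv2; clia.
by subst v2; have [w2 vw2 ww2] := top_transport vw vv2; rewrite (top_uniq vw' vw2).
Qed.

(** A change of [r1] or of [r2] is made at intermediate vertices, whose prefixes come from
    [corner_pair] or [corner_triple], by a path to which [crossing_step] applies; [crossing_prefix]
    links these vertices to the given ones. *)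
Lemma crossing_con v w v' w' d c : con E 0 p.+1 v v' -> crossing v d c -> crossing v' d c ->
  E (p - 2) v w -> E (p - 2) v' w' -> con E 0 p.+1 w w'.
Proof.
have wk a b : con E 0 (p - 2) a b -> con E 0 p.+1 a b by apply: con_weaken; clia.
have wk1 a b : con E 1 p a b -> con E 0 p.+1 a b by apply: con_weaken; clia.
have same x y x' y' P P' r1 r1' r2 : con E 0 p.+1 x x' -> T x = P ++ [:: r1; r2; d; c] ->
    T x' = P' ++ [:: r1'; r2; d; c] -> r2 <= r1 -> r2 <= r1' -> d <= r2 < c \/ c <= r2 < d ->
    E (p - 2) x y -> E (p - 2) x' y' -> con E 0 p.+1 y y'.
  move=> xx' Tx Tx' r21 r21' dc xy xy'.
  have [e|/eqP ne] := eqVneq r1 r1'; first by subst r1'; apply: wk; apply: crossing_prefix xx' Tx Tx' xy xy'.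
  have A1 : adm (P ++ [:: r1]) by apply: (adm_catl (v := [:: r2; d; c])); rewrite -catA -Tx; apply: cp_adm H x.
  have A1' : adm (P' ++ [:: r1']) by apply: (adm_catl (v := [:: r2; d; c])); rewrite -catA -Tx'; apply: cp_adm H x'.
  have PP : perm_eq (P ++ [:: r1]) (P' ++ [:: r1']).
    have := hpath_perm (T_con xx'); rewrite Tx Tx' -(cat1s r1) -(cat1s r1') !catA.
    by rewrite perm_cat2r.
  have R1 := removable_end A1; have R1' := removable_end A1'; rewrite -(cnt_perm PP) in R1'.
  have main lo hi : (lo, hi) = (r1, r1') \/ (lo, hi) = (r1', r1) -> lo < hi -> con E 0 p.+1 y y'.
    move=> Elh lt; have [Rl Rh] : removable (cnt (P ++ [:: r1])) lo /\ removable (cnt (P ++ [:: r1])) hi.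
      by case: Elh => -[-> ->].
    have [lr hr] : r2 <= lo /\ r2 <= hi by case: Elh => -[-> ->].
    have [R [x1 [x2 [B1 B2 PR [H1 H2 H3]]]]] := corner_pair A1 lt Rl Rh.
    have Tx2 : T x = (P ++ [:: r1]) ++ [:: r2; d; c] by rewrite -catA.
    have [|z xz Tz] := T_exists Tx2 isT B1; first by rewrite perm_sym.
    have sR : size R + 4 = p - 1.
      by have := congr1 size Tz; rewrite (cp_size H) !size_cat /=; clia.
    have h' : hpath 1 (p - 1) (R ++ [:: x1; x2; lo; hi]) (R ++ [:: x1; x2; hi; lo]).
      have -> : R ++ [:: x1; x2; hi; lo] = hop (size R) (R ++ [:: x1; x2; lo; hi]).
        by rewrite hop_at hop4_12 //; move: H1 H2 H3; clia.
      by apply: hpath1; move: sR p8; clia.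
    have [|z' zz' Tz'] := T_lift Tz isT _ h'; first by rewrite size_cat /= sR.
    have xz0 : con E 0 p.+1 x z.
      by apply: con_weaken xz => //; rewrite size_cat (take_hop_top Tx) /=; clia.
    have zz1 : con E 1 p z z' by apply: con_weaken zz' => //; clia.
    have Cz : crossing z d c by exists (R ++ [:: x1; x2; lo]), hi, r2; rewrite Tz -!catA.
    have Cz' : crossing z' d c by exists (R ++ [:: x1; x2; hi]), lo, r2; rewrite Tz' -!catA.
    have [t zt] := crossing_edge Cz; have [t' zt'] := crossing_edge Cz'.
    have tt' := crossing_step zz1 Cz Cz' zt zt'.
    have Tz1 : T z = (R ++ [:: x1; x2; lo]) ++ [:: hi; r2; d; c] by rewrite Tz -!catA.
    have Tz1' : T z' = (R ++ [:: x1; x2; hi]) ++ [:: lo; r2; d; c] by rewrite Tz' -!catA.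
    have xz1 := con_trans xz0 (wk1 _ _ zz1).
    case: Elh => -[? ?]; subst lo hi.
      have a1 := wk _ _ (crossing_prefix xz1 Tx Tz1' xy zt').
      have a2 := wk _ _ (crossing_prefix (con_trans (S xz0) xx') Tz1 Tx' zt xy').
      exact: con_trans a1 (con_trans (S tt') a2).
    have a1 := wk _ _ (crossing_prefix xz0 Tx Tz1 xy zt).
    have a2 := wk _ _ (crossing_prefix (con_trans (S xz1) xx') Tz1' Tx' zt' xy').
    exact: con_trans a1 (con_trans tt' a2).
  have [lt|lt] : r1 < r1' \/ r1' < r1 by move: ne; clia.
    by apply: (main r1 r1') => //; left.
  by apply: (main r1' r1) => //; right.
have diff x y x' y' P P' r1 r1' r2 r2' : con E 0 p.+1 x x' -> T x = P ++ [:: r1; r2; d; c] ->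
    T x' = P' ++ [:: r1'; r2'; d; c] -> r2 <= r1 -> r2' <= r1' -> d <= r2 < c \/ c <= r2 < d ->
    d <= r2' < c \/ c <= r2' < d -> r2 < r2' ->
    E (p - 2) x y -> E (p - 2) x' y' -> con E 0 p.+1 y y'.
  move=> xx' Tx Tx' r21 r21' dc dc' lt xy xy'.
  have Tx2 : T x = (P ++ [:: r1; r2]) ++ [:: d; c] by rewrite -catA.
  have Tx2' : T x' = (P' ++ [:: r1'; r2']) ++ [:: d; c] by rewrite -catA.
  have A1 : adm (P ++ [:: r1; r2]) by apply: (adm_catl (v := [:: d; c])); rewrite -Tx2; apply: cp_adm H x.
  have A1' : adm (P' ++ [:: r1'; r2']) by apply: (adm_catl (v := [:: d; c])); rewrite -Tx2'; apply: cp_adm H x'.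
  have PP : perm_eq (P ++ [:: r1; r2]) (P' ++ [:: r1'; r2']).
    by have := hpath_perm (T_con xx'); rewrite Tx2 Tx2' perm_cat2r.
  have [|||u|R [x1 [x2 [b [B1 PR /andP[H1 H2] /andP[H3 H4] H5]]]]] := @corner_triple _ r2 r2' r1' A1.
  - by rewrite lt.
  - by move: A1; rewrite -cat_rcons; apply: removable_end.
  - by rewrite (cnt_perm PP); move: A1'; rewrite -cat_rcons; apply: removable_end.
  - rewrite (cnt_perm PP) -cat_rcons cnt_cat1 => /inc_injl e.
    apply: (@removable_neq _ r1' r2); first by move: lt r21'; clia.
    by rewrite -e; apply: adm_removable; apply: (adm_catl (v := [:: r2'])); rewrite cat_rcons.
  have [|z xz Tz] := T_exists Tx2 isT B1; first by rewrite perm_sym.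
  have sR : size R + 6 = p.
    by have := congr1 size Tz; rewrite (cp_size H) !size_cat /=; clia.
  have h : hpath 1 p (R ++ [:: x1; x2; r1'; b; r2'; r2]) (R ++ [:: x1; x2; b; r2; r1'; r2']).
    have h1 : hop (size R).+2 (R ++ [:: x1; x2; r1'; b; r2'; r2]) = R ++ [:: x1; x2; r1'; b; r2; r2'].
      by rewrite hop_at2 hop4_12 //; move: H1 H2 r21'; clia.
    have h2 : hop (size R) (R ++ [:: x1; x2; r1'; b; r2; r2']) = R ++ [:: x1; x2; b; r1'; r2; r2'].
      by rewrite hop_at hop4_12 //; move: H3 H4 H5; clia.
    have h3 : hop (size R).+1 (R ++ [:: x1; x2; b; r1'; r2; r2']) = R ++ [:: x1; x2; b; r2; r1'; r2'].
      by rewrite hop_at1 hop4_12 //; move: H1 H3 H4; clia.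
    rewrite -h3 -h2 -h1.
    apply: HStep; [apply: HStep; [apply: hpath1| |]| |]; move: sR p8; clia.
  have [|z' zz' Tz'] := T_lift Tz isT _ h; first by rewrite size_cat /= sR.
  have xz0 : con E 0 p.+1 x z.
    by apply: con_weaken xz => //; rewrite size_cat (take_hop_top Tx) /=; clear -p8; move: p8; lia.
  have Cz : crossing z d c by exists (R ++ [:: x1; x2; r1'; b]), r2', r2; rewrite Tz -!catA; split=> //; exact: ltnW.
  have Cz' : crossing z' d c by exists (R ++ [:: x1; x2; b; r2]), r1', r2'; rewrite Tz' -!catA.
  have [t zt] := crossing_edge Cz; have [t' zt'] := crossing_edge Cz'.
  have tt' := crossing_step zz' Cz Cz' zt zt'.
  have a1 : con E 0 p.+1 y t.
    apply: (same x y z t P (R ++ [:: x1; x2; r1'; b]) r1 r2' r2) => //; last exact: ltnW.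
    by rewrite Tz -!catA.
  have a2 : con E 0 p.+1 t' y'.
    apply: (same z' t' x' y' (R ++ [:: x1; x2; b; r2]) P' r1' r1' r2') => //.
      exact: con_trans (S (con_trans xz0 (wk1 _ _ zz'))) xx'.
    by rewrite Tz' -!catA.
  exact: con_trans a1 (con_trans tt' a2).
move=> vv' [P [r1 [r2 [Tv r21 dc]]]] [P' [r1' [r2' [Tv' r21' dc']]]] vw vw'.
case: (ltngtP r2 r2') => [lt|lt|e].
- exact: diff vv' Tv Tv' _ _ _ _ lt vw vw'.
- by apply: S; apply: diff (S vv') Tv' Tv _ _ _ _ lt vw' vw.
- by subst r2'; apply: same vv' Tv Tv' _ _ _ vw vw'.
Qed.

End Capped.

(** * The hole of a rectification *)

(** Whether a next letter [r] slides into the hole. The shape [cnt W] includes the vacated corner,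
    hence [.+2] where [slide_rule] has [.+1]. *)
Definition blocked (W : seq nat) (r : nat) : bool :=
  (r == hole W) || (r == (hole W).+1) && (cnt W (hole W) == (cnt W (hole W).+1).+2).

Lemma demote_step W r : adm (W ++ [:: r]) -> 0 < size W ->
  demote (W ++ [:: r]) = demote W ++ [:: if blocked W r then hole W else r] /\
  hole (W ++ [:: r]) = if blocked W r then r else hole W.
Proof.
move=> A sW; have AW := adm_catl A; have [Ah Eh] := demote_hole AW sW.
have Ar : addable (inc (cnt (demote W)) (hole W)) r.
  by move: A; rewrite Eh adm_cat /= => /and3P[].
have B := slide_rule (strict_cnt (adm_demote AW)) Ah Ar.
have T : (cnt (demote W) (hole W) == (cnt (demote W) (hole W).+1).+1) =
    (cnt W (hole W) == (cnt W (hole W).+1).+2).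
  by rewrite -Eh incE inc_neq ?eqSS //; clia.
rewrite T -/(blocked W r) in B.
have E1 : demote (W ++ [:: r]) = demote W ++ (slide (cnt (demote W)) (hole W) [:: r]).1.
  by rewrite cats1 demote_rcons // -cats1.
have E2 : hole (W ++ [:: r]) = (slide (cnt (demote W)) (hole W) [:: r]).2.
  by case: W sW {A AW Ah Eh Ar B T E1} => // a W _; rewrite /hole /= slide_cat.
by rewrite E1 E2 slide_cons B; case: blocked.
Qed.

Lemma hole_removable W : adm W -> 0 < size W -> removable (cnt W) (hole W).
Proof.
move=> A sW; have [Ah <-] := demote_hole A sW.
exact: removable_inc (strict_cnt (adm_demote A)) Ah.
Qed.

(** An entry sliding down into the hole from row [k.+1] would cover the end of row [k], which would
    no longer be a corner. *)
Lemma hole_stay W r k : adm (W ++ [:: r]) -> 0 < size W -> hole W = k -> r <> k ->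
  removable (cnt (W ++ [:: r])) k -> hole (W ++ [:: r]) = k.
Proof.
move=> A sW hW rk R; have [_ ->] := demote_step A sW; rewrite /blocked hW.
case: ifP => // /orP[/eqP //|/andP[/eqP E T]]; exfalso; subst r.
move: R T; rewrite cnt_cat1 /removable incE inc_neq; last by clia.
by clia.
Qed.

Lemma hole_le W r : adm (W ++ [:: r]) -> 0 < size W -> hole W <= hole (W ++ [:: r]).
Proof.
move=> A sW; have [_ ->] := demote_step A sW; case: ifP => // /orP[/eqP-> //|/andP[/eqP-> _]].
exact: leqnSn.
Qed.

(** If there is another corner, the last entry is put there and does not disturb the hole found by
    induction; a shape with a single corner leaves no choice. *)
Lemma hole_exists P x : adm P -> removable (cnt P) x ->
  exists P1, [/\ adm P1, perm_eq P1 P & hole P1 = x].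
Proof.
move: {2}(size P) (leqnn (size P)) => m; elim: m P => [|m IH] P sP A R.
  by move: R; have -> : P = [::] by apply: size0nil; move: sP; rewrite leqn0 => /eqP.
have P0 : 0 < size P by case: P R {sP A}.
case: (classic (exists r, r <> x /\ removable (cnt P) r)) => [[r [rx Rr]]|no]; last first.
  exists P; split=> //; apply: NNPP => n; apply: no; exists (hole P).
  by split; [exact: n|exact: hole_removable].
have [Q AQ PQ] := rem_last A Rr; have AQ0 : adm Q by apply: (@adm_catl Q [:: r]); rewrite cats1.
have C : cnt P = inc (cnt Q) r by rewrite -(cnt_perm PQ) cnt_rcons.
have RQ : removable (cnt Q) x by apply: (@removable_neq _ x r); [exact: not_eq_sym|rewrite -C].
have [|Q1 [A1 P1 h1]] := IH Q _ AQ0 RQ.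
  by move: sP; rewrite -(perm_size PQ) size_rcons.
have A2 : adm (Q1 ++ [:: r]) by apply: (adm_cat_perm _ A1 (u := Q)); rewrite ?cats1 // perm_sym.
have P2 : perm_eq (Q1 ++ [:: r]) P by apply: perm_trans PQ; rewrite -cats1 perm_cat2r.
exists (Q1 ++ [:: r]); split=> //; apply: hole_stay => //.
  rewrite (perm_size P1); case: (Q) RQ => //.
by rewrite (cnt_perm P2).
Qed.

(** Both letters must slide into the hole: one from its right, in the same row, the other from
    above. *)
Lemma demote_ambiguous W a b : adm (W ++ [:: a]) -> adm (W ++ [:: b]) -> 0 < size W -> a < b ->
  demote (W ++ [:: a]) = demote (W ++ [:: b]) ->
  [/\ hole W = a, b = a.+1 & cnt W a = (cnt W a.+1).+2].
Proof.
move=> A B sW ab; have [-> _] := demote_step A sW; have [-> _] := demote_step B sW.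
move/eqP; rewrite eqseq_cat // eqxx /= eqseq_cons andbT /blocked.
case: ifP => [Ba|Ba]; case: ifP => [Bb|Bb] e; try by move: Ba Bb e ab; clia.
have Ea : a = hole W by move: Ba Bb ab; clia.
by split; move: Ba Bb ab; rewrite Ea; clia.
Qed.

Lemma cnt_gt_size P r : (forall s, r < s -> cnt P s = 0) -> all (fun s => s <= r) P.
Proof.
move=> H; apply/allP => s sP; rewrite leqNgt; apply/negP => /H.
by rewrite cntE => /count_memPn; rewrite sP.
Qed.

Lemma size_row1 P : adm P -> cnt P 1 = 0 -> size P = cnt P 0.
Proof.
move=> A c1; have {c1} : all (fun s => s <= 0) P.
  apply: cnt_gt_size => s s0; apply/eqP; rewrite -leqn0 leqNgt; apply/negP => cs.
  by have := strict_gt0 (strict_cnt A) s0 cs; rewrite c1.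
by rewrite cntE {A}; elim: P => //= -[|a] P IH //= /IH ->.
Qed.

Lemma size_row2 P : adm P -> cnt P 2 = 0 -> size P = cnt P 0 + cnt P 1.
Proof.
move=> A c1; have {c1} : all (fun s => s <= 1) P.
  apply: cnt_gt_size => s s0; apply/eqP; rewrite -leqn0 leqNgt; apply/negP => cs.
  by have := strict_gt0 (strict_cnt A) s0 cs; rewrite c1.
by rewrite !cntE {A}; elim: P => //= -[|[|a]] P IH //= /IH ->; clia.
Qed.

Lemma addable_removable t k : addable t k.+1 -> removable t k.
Proof. by rewrite /addable /removable /=; lia. Qed.

(** Any corner of [P] can be made the hole by [hole_exists], and one more letter cannot bring them
    all to [h] unless [P] is small. The largest exception has rows of lengths 3 and 2, with [r = 0]
    and [h = 1]; hence the bound 6. *)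
Lemma hole_not_const2 P r h : adm (P ++ [:: r]) -> 6 <= size P ->
  addable (cnt (P ++ [:: r])) h ->
  cnt (P ++ [:: r]) h = (cnt (P ++ [:: r]) h.+1).+2 ->
  ~ forall P1, adm P1 -> perm_eq P1 P -> hole (P1 ++ [:: r]) = h.
Proof.
move=> A s6 Ah T all; have AP := adm_catl A; have SP := strict_cnt AP.
have C := cnt_cat1 P r.
have Aat P1 : adm P1 -> perm_eq P1 P -> adm (P1 ++ [:: r]) /\ 0 < size P1.
  move=> A1 P1P; split; first by apply: adm_cat_perm A; rewrite // perm_sym.
  by rewrite (perm_size P1P); apply: leq_trans s6.
case: h Ah T all => [|k] Ah T all; last first.
  have Rk := addable_removable Ah.
  have [Erk|nrk] := eqVneq r k; last first.
    have RkP : removable (cnt P) k by apply: (@removable_neq _ k r); [move: nrk; clia|rewrite -C].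
    have [P1 [A1 PP1 h1]] := hole_exists AP RkP; have [A2 s1] := Aat _ A1 PP1.
    have PP : perm_eq (P1 ++ [:: r]) (P ++ [:: r]) by rewrite perm_cat2r.
    have := hole_stay A2 s1 h1 _; rewrite (cnt_perm PP) (all _ A1 PP1) => /(_ _ Rk).
    by move=> H; have := H (fun e => negP nrk (introT eqP e)); clia.
  subst r; have only x : removable (cnt P) x -> x = k.+1.
    move=> Rx; have [P1 [A1 PP1 h1]] := hole_exists AP Rx; have [A2 s1] := Aat _ A1 PP1.
    have [_ ] := demote_step A2 s1; rewrite (all _ A1 PP1) h1.
    by case: ifP => _; clia.
  move: T; rewrite C !inc_neq; try by clia.
  move=> T; have c2 : cnt P k.+2 = 0.
    apply/eqP; rewrite -leqn0 leqNgt; apply/negP => /removable_above[q qk /only]; move: qk; clia.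
  rewrite c2 in T.
  have c3 : cnt P k = 3.
    case R: (removable (cnt P) k); first by have := only _ R; clia.
    by move: R (SP k) Rk; rewrite /removable C incE inc_neq ?T; clia.
  have [k0|k0] := posnP k.
    by subst k; move: s6; rewrite (size_row2 AP c2) T c3.
  have : removable (cnt P) k.-1.
    apply: addable_removable; rewrite prednK //.
    by move: A; rewrite adm_cat /= => /and3P[].
  by move/only; clia.
have only x : removable (cnt P) x -> x = 0.
  move=> Rx; have [P1 [A1 PP1 h1]] := hole_exists AP Rx; have [A2 s1] := Aat _ A1 PP1.
  by have := hole_le A2 s1; rewrite (all _ A1 PP1) h1; clia.
have c1 : cnt P 1 = 0.
  apply/eqP; rewrite -leqn0 leqNgt; apply/negP => /removable_above[q qk /only]; move: qk; clia.
have := size_row1 AP c1; move: T s6; rewrite C /inc c1; clia.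
Qed.

Lemma cnt_cat2 P r s : cnt (P ++ [:: r; s]) = inc (inc (cnt P) r) s.
Proof. by rewrite -cat_rcons cnt_cat1 cnt_rcons. Qed.

(** For [h > 0], row [h.-1] is a corner because [h] is addable, and a hole placed there survives two
    letters different from [h.-1]. As the letter before [r2] may vary too, only [r2 = h.-1] remains,
    which is excluded by listing the possible corners. *)
Lemma hole_not_const3 P r1 r2 h : adm (P ++ [:: r1; r2]) -> 6 <= size P -> r2 <= r1 ->
  addable (cnt (P ++ [:: r1; r2])) h ->
  cnt (P ++ [:: r1; r2]) h = (cnt (P ++ [:: r1; r2]) h.+1).+2 ->
  ~ forall P' r1', adm (P' ++ [:: r1'; r2]) -> perm_eq (P' ++ [:: r1'; r2]) (P ++ [:: r1; r2]) ->
    r2 <= r1' -> hole (P' ++ [:: r1'; r2]) = h.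
Proof.
move=> A s6 r21 Ah T all; have AP := adm_catl A; have SP := strict_cnt AP.
have split2 Q s : Q ++ [:: s; r2] = (Q ++ [:: s]) ++ [:: r2] by rewrite -catA.
have A1 : adm (P ++ [:: r1]) by apply: (@adm_catl _ [:: r2]); rewrite -catA.
have Aat Q s P1 : adm (Q ++ [:: s; r2]) -> perm_eq (Q ++ [:: s; r2]) (P ++ [:: r1; r2]) ->
    adm P1 -> perm_eq P1 Q ->
    [/\ adm (P1 ++ [:: s]), adm (P1 ++ [:: s; r2]), 0 < size P1 & perm_eq (P1 ++ [:: s; r2]) (P ++ [:: r1; r2])].
  move=> AQ PQ AP1 P1Q; have A2 : adm (P1 ++ [:: s; r2]).
    by apply: adm_cat_perm AQ; rewrite // perm_sym.
  split=> //; first by apply: (@adm_catl _ [:: r2]); rewrite -catA.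
    rewrite (perm_size P1Q); have := perm_size PQ; rewrite !size_cat /= => /addIn ->.
    exact: leq_trans s6.
  by apply: perm_trans PQ; rewrite perm_cat2r.
case: h Ah T all => [|k] Ah T all.
  have only x : removable (cnt P) x -> x = 0.
    move=> Rx; have [P1 [AP1 PP1 h1]] := hole_exists AP Rx.
    have [B1 B2 s1 B3] := Aat _ _ _ A (perm_refl _) AP1 PP1.
    have l1 := hole_le B1 s1; have := hole_le (W := P1 ++ [:: r1]) (r := r2).
    rewrite -split2 => /(_ B2); rewrite (all _ _ B2 B3 r21) size_cat addn1 => /(_ isT).
    by move: l1; rewrite h1; clia.
  have c1 : cnt P 1 = 0.
    apply/eqP; rewrite -leqn0 leqNgt; apply/negP => /removable_above[q qk /only]; move: qk; clia.
  have := size_row1 AP c1; move: T s6; rewrite cnt_cat2 /inc c1; clia.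
have Rk := addable_removable Ah.
have Rh : removable (cnt (P ++ [:: r1; r2])) k.+1.
  by rewrite -(all P r1 A (perm_refl _) r21); apply: hole_removable; rewrite ?size_cat ?addn2.
have alt : r2 <> k.+1 -> exists Q, adm (Q ++ [:: k.+1; r2]) /\ perm_eq (Q ++ [:: k.+1; r2]) (P ++ [:: r1; r2]).
  move=> nr; have R1 : removable (cnt (P ++ [:: r1])) k.+1.
    by apply: (@removable_neq _ k.+1 r2); [exact: not_eq_sym|rewrite -cnt_cat1 -split2].
  have [Q AQ PQ] := rem_last A1 R1; exists Q; rewrite -cat_rcons split2 perm_cat2r; split=> //.
  by apply: (adm_cat_perm (u := P ++ [:: r1])); rewrite ?(perm_sym _ (rcons _ _)) // -split2.
have stay Q s : adm (Q ++ [:: s; r2]) -> perm_eq (Q ++ [:: s; r2]) (P ++ [:: r1; r2]) -> r2 <= s ->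
    s <> k -> r2 <> k -> False.
  move=> AQ PQ rs sk rk; have AQ0 := adm_catl AQ.
  have R2 : removable (cnt (Q ++ [:: s])) k.
    by apply: (@removable_neq _ k r2); [exact: not_eq_sym|rewrite -cnt_cat1 -split2 (cnt_perm PQ)].
  have R3 : removable (cnt Q) k by apply: (@removable_neq _ k s); [exact: not_eq_sym|rewrite -cnt_cat1].
  have [P1 [AP1 PP1 h1]] := hole_exists AQ0 R3.
  have [B1 B2 s1 B3] := Aat _ _ _ AQ PQ AP1 PP1.
  have h2 : hole (P1 ++ [:: s]) = k.
    apply: hole_stay => //; rewrite (_ : cnt _ = cnt (Q ++ [:: s])) //.
    by apply: cnt_perm; rewrite perm_cat2r.
  have h3 : hole ((P1 ++ [:: s]) ++ [:: r2]) = k.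
    by apply: hole_stay => //; rewrite -?split2 ?(cnt_perm B3) // size_cat addn1.
  by have := all _ _ B2 B3 rs; rewrite split2 h3; clia.
have [Er2|/eqP nr2] := eqVneq r2 k; last first.
  have [Er1|/eqP nr1] := eqVneq r1 k; last exact: (stay P r1).
  have r2k : r2 < k by move: r21 nr2; rewrite Er1; clia.
  have [|Q [AQ PQ]] := alt; first by move: r2k; clia.
  apply: (stay Q k.+1) => //; move: r2k; clia.
subst r2; have [|Q [AQ PQ]] := alt; first by clia.
have AQ0 := adm_catl AQ; have SQ := strict_cnt AQ0.
have sQ : size Q = size P by have := perm_size PQ; rewrite !size_cat => /addIn.
have C := cnt_cat2 Q k.+1 k; rewrite -(cnt_perm PQ) C in T Ah.
move: T Ah; rewrite /addable /= incE !(@inc_neq _ k) ?incE; try by clia.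
rewrite !(@inc_neq _ k.+1); try by clia.
move=> T Ah; have RQ : removable (cnt Q) k by move: T Ah; rewrite /removable; clia.
have blk x : removable (cnt Q) x -> x = k.+1 \/ x = k /\ cnt Q k = (cnt Q k.+1).+2.
  move=> Rx; have [P1 [AP1 PP1 h1]] := hole_exists AQ0 Rx.
  have [B1 B2 s1 B3] := Aat _ _ _ AQ PQ AP1 PP1.
  have hh := all _ _ B2 B3 (leqnSn k); rewrite split2 in B2 hh.
  have s2 : 0 < size (P1 ++ [:: k.+1]) by rewrite size_cat addn1.
  have [_] := demote_step B2 s2; rewrite hh; have [_ ->] := demote_step B1 s1.
  case Eb: (blocked P1 k.+1); last first.
    by rewrite h1; case: ifP => _ e; [case: (n_Sn k)|left].
  move: Eb; rewrite /blocked h1 (cnt_perm PP1) => /orP[/eqP|/andP[/eqP[->] /eqP ->]].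
    by left.
  by right.
have [|[_ t]] := blk _ RQ; first by clia.
have c2 : cnt Q k.+2 = 0.
  apply/eqP; rewrite -leqn0 leqNgt; apply/negP => /removable_above[q qk /blk]; move: qk; clia.
rewrite c2 in T; have c1 : cnt Q k.+1 = 1 by move: T; clia.
have [k0|k0] := posnP k.
  by subst k; move: s6; rewrite -sQ (size_row2 AQ0 c2) t c1.
have : removable (cnt Q) k.-1.
  apply: addable_removable; rewrite prednK //.
  move: AQ; rewrite split2 adm_cat /= => /and3P[_ + _]; rewrite cnt_cat1 /addable inc_neq; last by clia.
  by rewrite inc_neq //; move: k0; clia.
by move/blk; move: k0; clia.
Qed.

Lemma demote_take n w : demote (take n.+1 w) = take n (demote w).
Proof.
case: w => [|a w] //; rewrite /demote /=; have [le|lt] := leqP (size w) n.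
  by rewrite !take_oversize ?size_slide.
rewrite -[in RHS](cat_take_drop n w) slide_cat /= take_size_cat //.
by rewrite size_slide size_takel // ltnW.
Qed.

Section Crossing.
Variables (V : finType) (sig : V -> nat -> bool) (E : nat -> V -> V -> bool) (p : nat).
Variables f g T : V -> seq nat.
Hypothesis H : capped sig E p f g T.

Let Gl := cp_glued H.
Let Lf := gl_f Gl.
Let Lg := gl_g Gl.
Let p8 : 8 <= p := gl_size Gl.
Let S lo hi u v : con E lo hi u v -> con E lo hi v u := con_sym (gl_sym Gl).
Let e3 : (p - 3).+1 = p - 2. Proof. by move: p8; clia. Qed.
Let k3 : (p - 3).+4 <= p.+1. Proof. by move: p8; clia. Qed.
Let k2 : (p - 2).+4 <= p.+2. Proof. by move: p8; clia. Qed.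

Lemma pk_hop_near k j w : j + 3 <= k -> pk (hop k w) j = pk w j.
Proof.
move=> jk; have [lt|le] := ltnP (size w) k; first by rewrite hop_id //; move: lt; clia.
rewrite -(pk_take (m := k)) -1?[RHS](pk_take (m := k)); try by move: jk; clia.
congr pk; have sk : size (take k w) = k by rewrite size_takel.
have := hop_cat_l (take k w) (drop k w) 0; rewrite addn0 sk cat_take_drop => ->.
by rewrite take_size_cat.
Qed.

(** Peaks from 3 on are read by [g]. A peak at 2 provides an edge of color 1, which commutation
    moves across the top edge; the other end then has a peak at 2 or 3, and [g] excludes 3. *)
Lemma top_sig v w k : k.+3 <= p - 2 -> E (p - 2) v w -> sig v k = sig w k.
Proof.
case: k => [|k] kp vw.
  have key x y : E (p - 2) x y -> sig y 1 = sig x 1 -> sig x 0 -> sig y 0.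
    move=> xy s1 x0; have h4 : 4 <= p.+1 by move: p8; clia.
    have [|z xz] := lab_lift Lf (k := 0) (u := x) h4.
      apply/eqP; rewrite hop_pk ?(lab_size Lf) // -(lab_sig Lf) ?x0 //.
      by move: p8; clia.
    have [||t zt yt] := gl_com Gl _ _ xz xy; [by move: p8; clia|exact: k2|].
    have [h ne] := lab_edge Lf h4 yt; have : hop 0 (f y) != f y by rewrite -h; apply/eqP.
    rewrite hop_pk ?(lab_size Lf) // negbK -!(lab_sig Lf); try by move: p8; clia.
    case/orP=> //; rewrite s1 (lab_sig Lf); last by move: p8; clia.
    move: x0; rewrite (lab_sig Lf); last by move: p8; clia.
    by move/pk_nonconsec/negP.
  have s1 : sig w 1 = sig v 1.
    rewrite (cp_sig H); last by move: p8; clia.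
    rewrite [RHS](cp_sig H); last by move: p8; clia.
    rewrite -!demote_pk ?(cp_adm H) ?(cp_size H) ?(cp_g H) //; try by move: p8; clia.
    rewrite (top_edge H vw) (demote_top H) pk_hop_near //; move: p8; clia.
  by apply/idP/idP; [exact: key vw s1|exact: key (gl_sym Gl vw) (esym s1)].
have e u : sig u k.+1 = pk (g u) k.
  by rewrite -(lab_sig Lg) //; move: kp; clia.
by rewrite !e (top_edge H vw) (demote_top H) pk_hop_near //; move: kp; clia.
Qed.

(** Replacing each label by the one at the other end of the top edge, where there is such an edge,
    gives a second labeling of the restriction to [[1, n - 4]], because the low colors commute with
    the top one; labelings are unique. *)
Lemma top_take v w : E (p - 2) v w -> take (p - 2) (f w) = take (p - 2) (f v).
Proof.
pose F v := take (p - 2) (f v).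
pose F' v := if [pick w | E (p - 2) v w] is Some w then F w else F v.
have LF : labeling sig E (p - 2) F by apply: lab_take Lf; clia.
have F'1 x y : E (p - 2) x y -> F' x = F y.
  rewrite /F'; case: pickP => [z xz xy|/(_ y) ->] //.
  by rewrite (top_uniq H xz xy).
have F'0 x : (forall y, ~ E (p - 2) x y) -> F' x = F x.
  by rewrite /F'; case: pickP => [z xz /(_ z xz)|].
have com k x y z : k.+4 <= p - 2 -> E k x y -> E (p - 2) x z -> exists2 t, E (p - 2) y t & E k z t.
  move=> kp xy xz; apply: (gl_com Gl _ _ xy xz); [move: kp; clia|exact: k2].
have cases x : (exists y, E (p - 2) x y) \/ forall y, ~ E (p - 2) x y.
  case: (classic (exists y, E (p - 2) x y)); first by left.
  by right=> y xy; case: b; exists y.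
have L' : labeling sig E (p - 2) F'.
  have both x : exists2 y, F' x = F y & forall k, k.+3 <= p - 2 -> sig x k = sig y k.
    case: (cases x) => [[y xy]|no]; last by exists x; rewrite ?F'0.
    by exists y; rewrite ?(F'1 _ _ xy) // => k kp; apply: top_sig xy.
  split=> [x|x|x k kp|k x y kp xy|k x kp ne].
  - by have [y -> _] := both x; apply: lab_adm LF y.
  - by have [y -> _] := both x; apply: lab_size LF y.
  - by have [y -> ->] := both x; rewrite // (lab_sig LF).
  - case: (cases x) => [[z xz]|no].
      have [t yt zt] := com _ _ _ _ kp xy xz.
      by rewrite (F'1 _ _ xz) (F'1 _ _ yt); apply: (lab_edge LF).
    rewrite !F'0 //; first exact: (lab_edge LF).
    move=> z yz; have [t xt _] := com _ _ _ _ kp (gl_sym Gl xy) yz; exact: no xt.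
  - case: (cases x) => [[z xz]|no].
      move: ne; rewrite (F'1 _ _ xz) => /(lab_lift LF kp)[t zt].
      by have [y _ xy] := com _ _ _ _ kp zt (gl_sym Gl xz); exists y.
    by move: ne; rewrite F'0 // => /(lab_lift LF kp).
move=> vw; have := labeling_unique LF L' v; rewrite (F'1 _ _ vw) /F => ->.
by [].
Qed.

Lemma cat3 (x : seq nat) n : size x = n + 3 -> exists a b c, x = take n x ++ [:: a; b; c].
Proof.
move=> sx; have := size_drop n x; rewrite sx; have -> : n + 3 - n = 3 by clia.
case E0: (drop n x) => [|a [|b [|c []]]] // _; exists a, b, c.
by rewrite -E0 cat_take_drop.
Qed.

Let p3 : p.+1 = p - 2 + 3. Proof. by move: p8; clia. Qed.

(* By commutation the letters [t1], [t2], [t3] do not depend on the prefix [P]. *)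
Lemma crossing_rebase v w P r1 r2 d c t1 t2 t3 P' : T v = P ++ [:: r1; r2; d; c] ->
  r2 <= r1 -> d <= r2 < c \/ c <= r2 < d -> E (p - 2) v w -> f w = P ++ [:: t1; t2; t3] ->
  adm P' -> perm_eq P' P -> exists v' w', [/\ T v' = P' ++ [:: r1; r2; d; c], E (p - 2) v' w',
    f w' = P' ++ [:: t1; t2; t3] & demote (P' ++ [:: t1; t2; t3]) = demote (P' ++ [:: r1; r2; c])].
Proof.
move=> Tv r21 dc vw fw A' PP; have sP := take_hop_top H Tv.
have [|v' vv' Tv'] := T_exists H Tv isT A'; first by rewrite perm_sym.
rewrite sP in vv'; have [w' vw' ww'] := top_transport H vw vv'.
have fw' : f w' = P' ++ [:: t1; t2; t3].
  have sP' := perm_size PP; rewrite sP in sP'.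
  have fv' : take (p - 2) (f v') = P'.
    by rewrite (cp_f H) Tv' take_takel ?take_size_cat //; clia.
  have s1 : size (f w') = p - 2 + 3 by rewrite -p3; apply: lab_size Lf w'.
  rewrite -(cat_take_drop (p - 2) (f w')) (top_take vw') fv'; congr cat.
  have -> : drop (p - 2) (f w') = drop (p - 2) (f w).
    elim: {vw'} ww' s1 => // x y k xx IH _ kp xy s1.
    have sx : size (f x) = p - 2 + 3 by rewrite -p3; apply: lab_size Lf x.
    rewrite (edge_f Gl _ xy); last by move: kp; clia.
    by rewrite drop_hop ?sx ?leq_addr // IH.
  by rewrite fw drop_size_cat.
exists v', w'; split=> //; rewrite -fw' (demote_f Gl) (top_edge H vw') (hop_top H Tv') hop4_12 //; last first.
  by case: dc; [right|left].
rewrite -demote_take p3; have -> : P' ++ [:: r1; r2; c; d] = (P' ++ [:: r1; r2; c]) ++ [:: d] by rewrite -catA.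
by rewrite take_size_cat // size_cat (perm_size PP) sP.
Qed.

Lemma demote_prefix W W' u u' : size W = size W' -> 0 < size W -> demote (W ++ u) = demote (W' ++ u') ->
  demote W = demote W'.
Proof.
case: W W' => [|a W] [|b W'] // [sW] _ e.
have := congr1 (take (size W)) e; rewrite -!demote_take take_size_cat //.
by rewrite sW take_size_cat.
Qed.

(** A wrong second letter would, by [demote_ambiguous], fix the hole for all rearrangements of [P],
    against [hole_not_const2]. The third letter resists this argument, since [r1] would have to vary
    as well. *)
Lemma crossing_label2 v w P r1 r2 d c : T v = P ++ [:: r1; r2; d; c] -> r2 <= r1 ->
  d <= r2 < c \/ c <= r2 < d -> E (p - 2) v w -> exists t, [/\ f w = P ++ [:: r1; r2; t],
  adm (P ++ [:: r1; r2; t]), adm (P ++ [:: r1; r2; c]) &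
  demote (P ++ [:: r1; r2; t]) = demote (P ++ [:: r1; r2; c])].
Proof.
move=> Tv r21 dc vw; have sP := take_hop_top H Tv.
have [t1 [t2 [t3]]] : exists a b c, f w = take (p - 2) (f w) ++ [:: a; b; c].
  by apply: cat3; rewrite -p3; apply: lab_size Lf w.
rewrite (top_take vw) (cp_f H v) Tv take_takel ?take_size_cat //; last by clia.
move=> fw; have R P' A' PP := crossing_rebase (P' := P') Tv r21 dc vw fw A' PP.
have Av := cp_adm H v; rewrite Tv in Av; have AP := adm_catl Av.
have Aw : adm (f w) := lab_adm Lf w; rewrite fw in Aw.
have Ah : adm (P ++ [:: r1; r2; c; d]).
  by have := adm_hop (p - 2) (cp_adm H v); rewrite (hop_top H Tv) hop4_12 //; case: dc; [right|left].
have P6 : 6 <= size P by rewrite sP; move: p8; clia.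
(* the first letter is read off the peaks *)
have key a b : (a, b) = (t1, r1) \/ (a, b) = (r1, t1) -> a < b -> False.
  move=> ab lt; have [Aa Ab] : addable (cnt P) a /\ addable (cnt P) b.
    have : addable (cnt P) t1 /\ addable (cnt P) r1.
      by move: Av Aw; rewrite !adm_cat /= => /and3P[_ -> _] /and3P[_ -> _].
    by case: ab => -[-> ->] [].
  have [P0 [q [x [A0 PP [xq ax]]]]] := last_det AP Aa Ab lt.
  have [v' [w' [Tv' vw' fw' _]]] := R _ A0 PP.
  have s0 : (size P0).+4 = p by have := perm_size PP; rewrite size_cat sP /= addn2; move: p8; clia.
  have s1 : sig w' (size P0) = (x <= q) && (x < t1).
    rewrite (lab_sig Lf); last by move: s0; clia.
    by rewrite fw' -catA cat_cons cat_cons pk_at.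
  have s2 : sig w' (size P0) = (x <= q) && (x < r1).
    case E0 : (size P0) s0 => [|n] s0; first by move: s0 p8; clia.
    transitivity (pk (hop (p - 2) (T v')) n.+1); last first.
      rewrite (hop_top H Tv') hop4_12 //; last by case: dc; [right|left].
      by rewrite -E0 -catA cat_cons cat_cons pk_at.
    rewrite -demote_pk ?adm_hop ?(cp_adm H) //; last by rewrite size_hop (cp_size H); move: s0; clia.
    by rewrite -(top_edge H vw') -(lab_sig Lg) //; move: s0; clia.
  by move: s1; rewrite s2; case: ab => -[? ?]; subst a b; move: xq ax; clia.
have t1r : t1 = r1.
  case: (ltngtP t1 r1) => // lt; [by case: (key t1 r1 (or_introl erefl) lt)|].
  by case: (key r1 t1 (or_intror erefl) lt).
subst t1.
have A1 P' : adm P' -> perm_eq P' P -> [/\ adm (P' ++ [:: r1]), adm (P' ++ [:: r1; t2]),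
    adm (P' ++ [:: r1; r2]) & 0 < size (P' ++ [:: r1])].
  move=> A' PP; have Q := perm_trans PP (perm_refl P); rewrite perm_sym in Q.
  have B1 := adm_cat_perm Q A' Aw; have B2 := adm_cat_perm Q A' Ah.
  split; last by rewrite size_cat addn1.
  - by apply: (@adm_catl _ [:: t2; t3]); rewrite -catA.
  - by apply: (@adm_catl _ [:: t3]); rewrite -catA.
  - by apply: (@adm_catl _ [:: c; d]); rewrite -catA.
have t2r : t2 = r2.
  apply: NNPP => ne.
  have amb a b : (a, b) = (t2, r2) \/ (a, b) = (r2, t2) -> a < b -> False.
    move=> ab lt.
    have con P' : adm P' -> perm_eq P' P -> [/\ hole (P' ++ [:: r1]) = a, b = a.+1 &
        cnt (P' ++ [:: r1]) a = (cnt (P' ++ [:: r1]) a.+1).+2] /\ adm ((P' ++ [:: r1]) ++ [:: a]).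
      move=> A' PP; have [B1 B2 B3 s1] := A1 _ A' PP.
      have [v' [w' [_ _ _ D]]] := R _ A' PP.
      have D2 : demote ((P' ++ [:: r1]) ++ [:: t2]) = demote ((P' ++ [:: r1]) ++ [:: r2]).
        rewrite -!catA; apply: (@demote_prefix _ _ [:: t3] [:: c]); rewrite ?size_cat ?addn2 //.
        by rewrite -!catA.
      case: ab => -[? ?]; subst a b; split; rewrite -?catA //.
        by apply: demote_ambiguous => //; rewrite -catA.
      by apply: demote_ambiguous => //; rewrite -catA.
    have [[h1 h2 h3] h4] := con P AP (perm_refl _).
    apply: (hole_not_const2 (P := P) (r := r1) (h := a)) => //.
    - exact: adm_catl h4.
    - by move: h4; rewrite adm_cat /= => /and3P[].
    - by move=> P1 B1 B2; have [[]] := con P1 B1 B2.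
  case: (ltngtP t2 r2) => // lt; [by apply: (amb t2 r2) => //; left|by apply: (amb r2 t2) => //; right].
subst t2; exists t3; split=> //; first by apply: (@adm_catl _ [:: d]); rewrite -catA.
by have [v' [w' [_ _ _]]] := R _ AP (perm_refl _).
Qed.

(** The rearrangements now involve [r1], so they are not all reached by colors commuting with the
    top one; instead [crossing_con] keeps the other ends in one component, so that [t3] is the same
    for all of them, and [hole_not_const3] applies. *)
Lemma crossing_label v w P r1 r2 d c : T v = P ++ [:: r1; r2; d; c] -> r2 <= r1 ->
  d <= r2 < c \/ c <= r2 < d -> E (p - 2) v w -> f w = P ++ [:: r1; r2; c].
Proof.
move=> Tv r21 dc vw; have sP := take_hop_top H Tv.
have Av := cp_adm H v; rewrite Tv in Av.
have P6 : 6 <= size P by rewrite sP; move: p8; clia.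
have [t3 [fw _ _ _]] := crossing_label2 Tv r21 dc vw; rewrite fw.
congr (_ ++ [:: _; _; _]).
have U2 x : P ++ [:: r1; r2; x] = (P ++ [:: r1; r2]) ++ [:: x] by rewrite -catA.
have Tv2 : T v = (P ++ [:: r1; r2]) ++ [:: d; c] by rewrite -catA.
have C : crossing T v d c by exists P, r1, r2.
have amb a b : (a, b) = (t3, c) \/ (a, b) = (c, t3) -> a < b -> False.
  move=> ab lt.
  have con P' r1' : adm (P' ++ [:: r1'; r2]) -> perm_eq (P' ++ [:: r1'; r2]) (P ++ [:: r1; r2]) ->
      r2 <= r1' -> [/\ hole (P' ++ [:: r1'; r2]) = a, b = a.+1 &
        cnt (P' ++ [:: r1'; r2]) a = (cnt (P' ++ [:: r1'; r2]) a.+1).+2] /\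
        adm ((P' ++ [:: r1'; r2]) ++ [:: a]).
    move=> A' PP r21'.
    have [|v' vv' Tv'] := T_exists H Tv2 isT A'; first by rewrite perm_sym.
    have Tv2' : T v' = P' ++ [:: r1'; r2; d; c] by rewrite Tv' -catA.
    have C' : crossing T v' d c by exists P', r1', r2.
    have vv2 : con E 0 p.+1 v v' by apply: con_weaken vv' => //; rewrite size_cat sP /=; move: p8; clia.
    have [w' vw'] := crossing_edge H C'.
    have PW := con_perm Lf (leqnn _) (crossing_con H vv2 C C' vw vw').
    have [s3 [fw' B1 B2 D]] := crossing_label2 Tv2' r21' dc vw'.
    have Es : s3 = t3.
      move: PW; rewrite fw fw' !U2 (catA P' [:: r1'; r2] [:: s3]) => PW.
      have : perm_eq ((P ++ [:: r1; r2]) ++ [:: t3]) ((P ++ [:: r1; r2]) ++ [:: s3]).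
        by apply: perm_trans PW _; rewrite perm_cat2r.
      by rewrite perm_cat2l => /perm_mem/(_ s3); rewrite !inE eqxx => /eqP.
    subst s3; have s0 : 0 < size (P' ++ [:: r1'; r2]) by rewrite size_cat addn2.
    have X x : P' ++ [:: r1'; r2; x] = (P' ++ [:: r1'; r2]) ++ [:: x] by rewrite -catA.
    rewrite !X in B1 B2 D.
    by case: ab => -[? ?]; subst a b; split=> //; apply: demote_ambiguous.
  have A2 : adm (P ++ [:: r1; r2]) by apply: (adm_catl (v := [:: d; c])); rewrite -catA.
  have [[h1 h2 h3] h4] := con P r1 A2 (perm_refl _) r21.
  apply: (hole_not_const3 (P := P) (r1 := r1) (r2 := r2) (h := a)) => //.
  - by move: h4; rewrite adm_cat /= => /and3P[].
  - by move=> P1 x B1 B2 B3; have [[]] := con P1 x B1 B2 B3.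
case: (ltngtP t3 c) => // lt; [by case: (amb t3 c (or_introl erefl) lt)|].
by case: (amb c t3 (or_intror erefl) lt).
Qed.
End Crossing.

(** * Tableaux adapted to three given corners *)

Lemma between_corners t l m : strict t -> strict (inc (inc t l) m) -> l < m ->
  removable (inc (inc t l) m) l -> removable (inc (inc t l) m) m ->
  exists x, [/\ l <= x < m, removable t x & 1 < t x].
Proof.
move=> St Su lm; set u := inc _ m => Rl Rm.
have ul : u l = (t l).+1 by rewrite /u inc_neq ?incE //; move: lm; clia.
have um : u m = (t m).+1 by rewrite /u incE inc_neq //; move: lm; clia.
have := @strict_add u l.+1 (m - l.+1) Su; have -> : l.+1 + (m - l.+1) = m by move: lm; clia.
rewrite um => /(_ isT).
move=> g; apply: removable_between => //; move: Rl g lm; rewrite /removable ul; clia.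
Qed.

Lemma perm_snoc2 Q (l m : nat) w1 w : perm_eq (rcons Q l) w1 -> perm_eq (rcons w1 m) w ->
  perm_eq (Q ++ [:: l; m]) w.
Proof. by move=> P1; apply: perm_trans; rewrite -cat_rcons -[rcons w1 m]cats1 perm_cat2r. Qed.

Lemma removable_two w l m : adm w -> l <> m -> removable (cnt w) l -> removable (cnt w) m ->
  exists Q, [/\ adm (Q ++ [:: l; m]), adm (Q ++ [:: m; l]) & perm_eq (Q ++ [:: l; m]) w].
Proof.
move=> A lm Rl Rm; have [w1 A1 P1] := rem_last A Rm.
have R1 : removable (cnt w1) l.
  by apply: (@removable_neq _ l m) => //; rewrite -cnt_rcons (cnt_perm P1).
have A1' : adm w1 by move: A1; rewrite adm_rcons => /andP[].
have [Q AQ PQ] := rem_last A1' R1; have PQ' : perm_eq w1 (rcons Q l) by rewrite perm_sym.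
have A2 : adm (Q ++ [:: l; m]) by rewrite -cat_rcons; apply: adm_cat_perm PQ' AQ _; rewrite cats1.
have P2 := perm_snoc2 PQ P1.
exists Q; split=> //.
have P3 : perm_eq (Q ++ [:: m; l]) w.
  apply: perm_trans P2; rewrite perm_cat2l; apply/permP => z /=; clia.
have [w2 A3 P4] := rem_last A Rl.
have A3' : adm w2 by move: A3; rewrite adm_rcons => /andP[].
have R3 : removable (cnt w2) m.
  by apply: (@removable_neq _ m l); [exact: not_eq_sym|rewrite -cnt_rcons (cnt_perm P4)].
have [Q' AQ' PQ2] := rem_last A3' R3.
have A4 : adm (Q' ++ [:: m; l]).
  by rewrite -cat_rcons; apply: (@adm_cat_perm w2); rewrite ?cats1 // perm_sym.
apply: (adm_cat_perm _ _ A4); last by apply: adm_catl A2.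
rewrite -(perm_cat2r [:: m; l]); apply: perm_trans (_ : perm_eq w _); last by rewrite perm_sym.
exact: perm_snoc2 PQ2 P4.
Qed.

Lemma hpath_win lo hi R s s' t i : hop i s = s' -> lo <= size R + i -> size R + i + 4 <= hi ->
  hpath lo hi (R ++ s') t -> hpath lo hi (R ++ s) t.
Proof.
move=> <- h1 h2; rewrite -hop_cat_l => h; apply: hpath_trans h; apply: hpath1 => //.
by move: h2; clia.
Qed.

(* Starting from this word, the three crossings and the hops of [triangle_sorted]
   form a closed loop; the inequalities are those under which they do. *)
Lemma loop_word w l m h : adm w -> l < m < h -> removable (cnt w) l -> removable (cnt w) m ->
  removable (cnt w) h -> exists R Z z y x B b, [/\ adm (R ++ [:: Z; z; y; x; B; h; b; m; l]),
    perm_eq (R ++ [:: Z; z; y; x; B; h; b; m; l]) w &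
    [/\ z <= Z, x <= z < y, b <= x < B, B <= y & (l <= b < m) && (m <= B < h)]].
Proof.
move=> A /andP[lm mh] Rl Rm Rh.
have lm' : l <> m by move: lm; clia.
have [w1 A1 P1] := rem_last A Rh; have A1' : adm w1 by move: A1; rewrite adm_rcons => /andP[].
have C1 : cnt w = inc (cnt w1) h by rewrite -(cnt_perm P1) cnt_rcons.
have Rl1 : removable (cnt w1) l by apply: (@removable_neq _ l h); [move: lm mh; clia|rewrite -C1].
have Rm1 : removable (cnt w1) m by apply: (@removable_neq _ m h); [move: lm mh; clia|rewrite -C1].
have [Q [A2 A2' P2]] := removable_two A1' lm' Rl1 Rm1; have AQ := adm_catl A2.
have SQ := strict_cnt AQ.
have C2 : cnt w1 = inc (inc (cnt Q) l) m by rewrite -(cnt_perm P2) cnt_cat2.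
have [b [/andP[lb bm] Rb cb]] : exists x, [/\ l <= x < m, removable (cnt Q) x & 1 < cnt Q x].
  by apply: between_corners => //; rewrite -C2 //; apply: strict_cnt.
have Am : addable (cnt Q) m by move: A2'; rewrite adm_cat /= => /and3P[].
have Sm := strict_inc SQ Am.
have C3 : cnt w = inc (inc (inc (cnt Q) m) h) l.
  by rewrite C1 C2 [RHS]/inc /inc; apply: functional_extensionality => s; clia.
have Rm2 : removable (inc (inc (cnt Q) m) h) m by apply: (@removable_neq _ m l); [exact: not_eq_sym|rewrite -C3].
have Rh2 : removable (inc (inc (cnt Q) m) h) h.
  by apply: (@removable_neq _ h l); [move: lm mh; clia|rewrite -C3].
have [AQl Smh] : addable (inc (inc (cnt Q) m) h) l /\ strict (inc (inc (cnt Q) m) h).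
  by apply: removable_addable C3 => //; apply: strict_cnt.
have [B [/andP[mB Bh] RB cB]] : exists x, [/\ m <= x < h, removable (cnt Q) x & 1 < cnt Q x].
  exact: between_corners.
have nbB : b <> B by move: bm mB; clia.
have [Q1 [B1 B1' PQ1]] := removable_two AQ nbB Rb RB; have AQ1 := adm_catl B1.
have C4 : cnt Q = inc (inc (cnt Q1) b) B by rewrite -(cnt_perm PQ1) cnt_cat2.
have [x [/andP[bx xB] Rx cx]] : exists x, [/\ b <= x < B, removable (cnt Q1) x & 1 < cnt Q1 x].
  apply: between_corners; rewrite -?C4 //; first exact: strict_cnt.
  by move: bm mB; clia.
have [y By Ry] : exists2 y, B <= y & removable (cnt Q1) y.
  apply: removable_above; move: cB; rewrite C4 incE inc_neq //; clia.
have nxy : x <> y by move: xB By; clia.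
have [Q2 [D1 D1' PQ2]] := removable_two AQ1 nxy Rx Ry; have AQ2 := adm_catl D1.
have C5 : cnt Q1 = inc (inc (cnt Q2) x) y by rewrite -(cnt_perm PQ2) cnt_cat2.
have [z [/andP[xz zy] Rz cz]] : exists z, [/\ x <= z < y, removable (cnt Q2) z & 1 < cnt Q2 z].
  apply: between_corners; rewrite -?C5 //; try exact: strict_cnt.
  by move: xB By; clia.
have [Q3 AQ3 PQ3] := rem_last AQ2 Rz; have AQ3' : adm Q3 by move: AQ3; rewrite adm_rcons => /andP[].
have [Z zZ RZ] : exists2 Z, z <= Z & removable (cnt Q3) Z.
  by apply: removable_above; move: cz; rewrite -(cnt_perm PQ3) cnt_rcons incE.
have [R AR PR] := rem_last AQ3' RZ.
have E2 : adm (R ++ [:: Z; z]) /\ perm_eq (R ++ [:: Z; z]) Q2.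
  split; last exact: perm_snoc2 PR PQ3.
  by rewrite -cat_rcons; apply: (@adm_cat_perm Q3); rewrite ?cats1 // perm_sym.
have E4 : adm (R ++ [:: Z; z; y; x]) /\ perm_eq (R ++ [:: Z; z; y; x]) Q1.
  have -> : R ++ [:: Z; z; y; x] = (R ++ [:: Z; z]) ++ [:: y; x] by rewrite -catA.
  split; first by apply: adm_cat_perm D1'; rewrite ?E2.1 // perm_sym E2.2.
  apply: perm_trans PQ2; apply: perm_cat; first exact: E2.2.
  by apply/permP => s /=; clia.
have E6 : adm (R ++ [:: Z; z; y; x; B; b]) /\ perm_eq (R ++ [:: Z; z; y; x; B; b]) Q.
  have -> : R ++ [:: Z; z; y; x; B; b] = (R ++ [:: Z; z; y; x]) ++ [:: B; b] by rewrite -catA.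
  split; first by apply: adm_cat_perm B1'; rewrite ?E4.1 // perm_sym E4.2.
  apply: perm_trans PQ1; apply: perm_cat; first exact: E4.2.
  by apply/permP => s /=; clia.
have Amh : addable (inc (cnt Q) m) h by apply: strict_addable.
have Ah : addable (cnt Q) h && addable (inc (cnt Q) h) m.
  apply: addable_swap => //; first by move: mh; clia.
  move=> [e1 e2]; move: Rm2; by rewrite /removable /inc -e1 e2; move: mh; clia.
exists R, Z, z, y, x, B, b; split; last by split; rewrite ?zZ ?xz ?bx ?lb ?bm ?mB ?Bh.
  have -> : R ++ [:: Z; z; y; x; B; h; b; m; l] = (R ++ [:: Z; z; y; x; B]) ++ [:: h; b; m; l] by rewrite -catA.
  have AB : adm (R ++ [:: Z; z; y; x; B]) by apply: (@adm_catl _ [:: b]); rewrite -catA; exact: E6.1.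
  have cQ : cnt Q = inc (cnt (R ++ [:: Z; z; y; x; B])) b.
    by rewrite -(cnt_perm E6.2) -cnt_cat1 -catA.
  case/andP: Ah => Ah Ahm.
  have Abh : addable (cnt (R ++ [:: Z; z; y; x; B])) h && addable (inc (cnt (R ++ [:: Z; z; y; x; B])) h) b.
    apply: addable_swap; rewrite -?cQ //; try by move: bm mh; clia.
    by have := E6.1; rewrite -[_ ++ _]/(R ++ [:: Z; z; y; x; B] ++ [:: b]) catA adm_cat /= => /and3P[].
  rewrite adm_cat AB /= andbT; case/andP: Abh => -> ->.
  by rewrite (incC _ h b) -cQ Ahm (incC _ h m) AQl.
have -> : R ++ [:: Z; z; y; x; B; h; b; m; l] = (R ++ [:: Z; z; y; x; B]) ++ [:: h; b; m; l] by rewrite -catA.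
apply: perm_trans P1; rewrite -cats1; apply: perm_trans (_ : perm_eq (Q ++ [:: l; m] ++ [:: h]) _); last first.
  by rewrite catA perm_cat2r.
apply: perm_trans (_ : perm_eq ((R ++ [:: Z; z; y; x; B; b]) ++ [:: l; m; h]) _); last first.
  by rewrite perm_cat2r; exact: E6.2.
by rewrite -!catA perm_cat2l; apply/permP => s /=; clia.
Qed.

(** * Faithfulness *)

Section Faithful.
Variables (V : finType) (sig : V -> nat -> bool) (E : nat -> V -> V -> bool) (p : nat).
Variables f g T : V -> seq nat.
Hypothesis H : capped sig E p f g T.

Let Gl := cp_glued H.
Let Lf := gl_f Gl.
Let Lg := gl_g Gl.
Let p8 : 8 <= p := gl_size Gl.
Let S lo hi u v : con E lo hi u v -> con E lo hi v u := con_sym (gl_sym Gl).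
Let k2 : (p - 2).+4 <= p.+2. Proof. by move: p8; clia. Qed.

Lemma split4 v : exists P a b c d, T v = P ++ [:: a; b; c; d].
Proof.
have := size_drop (p - 2) (T v); rewrite (cp_size H).
have -> : p.+2 - (p - 2) = 4 by move: p8; clia.
case E0: (drop (p - 2) (T v)) => [|a [|b [|c [|d []]]]] // _.
by exists (take (p - 2) (T v)), a, b, c, d; rewrite -E0 cat_take_drop.
Qed.

(* By [noncrossing] and [crossing_label] applied from both ends. *)
Lemma top_label v w : E (p - 2) v w -> T w = hop (p - 2) (T v).
Proof.
move=> vw; have [P [r1 [r2 [d [c Tv]]]]] := split4 v; have sP := take_hop_top H Tv.
have fv x t1 t2 t3 t4 : T x = P ++ [:: t1; t2; t3; t4] -> f x = P ++ [:: t1; t2; t3].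
  move=> Tx; rewrite (cp_f H) Tx.
  have -> : P ++ [:: t1; t2; t3; t4] = (P ++ [:: t1; t2; t3]) ++ [:: t4] by rewrite -catA.
  rewrite take_size_cat //.
  by rewrite size_cat /= sP; move: p8; clia.
move h4: (hop4 r1 r2 d c) (hop4P r1 r2 d c) => t Ht.
case: Ht h4 => [r21 dc|lo hi _ _ _ _ _|lo hi _ _ _|] h4.
- have fw := crossing_label H Tv r21 (iffLR (or_comm _ _) dc) vw.
  have Tw : T w = P ++ [:: r1; r2; c; last 0 (T w)].
    by rewrite {1}(T_rcons H w) fw -cats1 -catA.
  rewrite Tw (hop_top H Tv) h4; congr (_ ++ [:: _; _; _; _]); set c' := last 0 (T w) in Tw *.
  (* If the edge were not a crossing when seen from [w], the labels [f v] and [f w] would have the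
     same shape, though they differ only by ending in [d] and in [c]. *)
  have non t1 t2 t3 : hop4 r1 r2 c c' = [:: t1; t2; t3; c'] -> c' = d.
    move=> e; have [wv _] := noncrossing H Tw e (gl_sym Gl vw).
    have := con_perm Lf (leqnn _) wv; rewrite fw (fv _ _ _ _ _ Tv) perm_cat2l !perm_cons.
    by move/perm_mem/(_ d); rewrite !inE eqxx => /eqP; move: dc; clia.
  move h5: (hop4 r1 r2 c c') (hop4P r1 r2 c c') => t' Ht.
  case: Ht h5 => [_ cc|lo hi _ _ _ _ _|lo hi _ _ _|] h5.
  + have := crossing_label H Tw r21 (iffLR (or_comm _ _) cc) (gl_sym Gl vw).
    by rewrite (fv _ _ _ _ _ Tv) => /(congr1 (last 0)); rewrite !last_cat.
  + exact: non h5.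
  + exact: non h5.
  + exact: non h5.
- by have [] := noncrossing H Tv h4 vw.
- by have [] := noncrossing H Tv h4 vw.
- by have [] := noncrossing H Tv h4 vw.
Qed.

Lemma lab_T : labeling sig E p.+2 T.
Proof.
split; [exact: cp_adm H|exact: cp_size H|exact: cp_sig H| |].
  move=> k u v; rewrite leq_eqVlt => /orP[/eqP kp|kp] uv.
    have ek : k = p - 2 by move: kp; clia.
    subst k; have Tv := top_label uv; split=> //; rewrite Tv; exact: (top_nontrivial H uv).
  have kp' : k.+4 <= p.+1 by move: kp; clia.
  split; first exact: (T_edge H kp' uv).
  by move=> e; have [_] := lab_edge Lf kp' uv; apply; rewrite !(cp_f H) e.
move=> k u; rewrite leq_eqVlt => /orP[/eqP kp|kp] ne.
  have ek : k = p - 2 by move: kp; clia.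
  by subst k; apply: (top_lift H ne).
have kp' : k.+4 <= p.+1 by move: kp; clia.
apply: (lab_lift Lf kp') => e; apply: ne.
by rewrite (T_rcons H u) hop_rcons ?(lab_size Lf) // e.
Qed.

(** A relation between components of the restriction to [[1, n - 1]], written on their vertices. *)
Definition cross u u' := exists x x' d c,
  [/\ con E 0 p.+1 u x, crossing T x d c, E (p - 2) x x' & con E 0 p.+1 x' u'].

Lemma crossing_back x d c x' : crossing T x d c -> E (p - 2) x x' -> crossing T x' c d.
Proof.
move=> [P [r1 [r2 [Tx r21 dc]]]] xx'; exists P, r1, r2; split=> //; last by case: dc; [right|left].
by rewrite (top_label xx') (hop_top H Tx) hop4_12 //; case: dc; [right|left].
Qed.

Lemma crossing_last x d c : crossing T x d c -> last 0 (T x) = c.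
Proof. by case=> P [r1 [r2 [-> _ _]]]; rewrite last_cat. Qed.

Lemma cross_sym u u' : cross u u' -> cross u' u.
Proof.
case=> x [x' [d [c [ux C xx' xu']]]]; exists x', x, c, d.
split; [exact: S|exact: crossing_back C xx'|exact: (gl_sym Gl xx')|exact: S].
Qed.

Lemma cross_con u v v' u' : con E 0 p.+1 u v -> cross v v' -> con E 0 p.+1 v' u' -> cross u u'.
Proof.
move=> uv [x [x' [d [c [vx C xx' xv']]]]] vu; exists x, x', d, c.
split=> //; [exact: con_trans vx|exact: con_trans vu].
Qed.

Lemma cross_last u u' : cross u u' -> exists d c, [/\ last 0 (T u) = c, last 0 (T u') = d & d <> c].
Proof.
case=> x [x' [d [c [ux C xx' xu']]]]; exists d, c.
rewrite (cp_last H ux) -(cp_last H xu') (crossing_last C) (crossing_last (crossing_back C xx')).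
by split=> //; apply: (crossing_neq C).
Qed.

Lemma cross_uniq u v v' : cross u v -> cross u v' -> last 0 (T v) = last 0 (T v') -> con E 0 p.+1 v v'.
Proof.
case=> x [x' [d [c [ux C xx' xv]]]] [y [y' [d' [c' [uy C' yy' yv]]]]].
rewrite -(cp_last H xv) -(cp_last H yv) (crossing_last (crossing_back C xx')).
rewrite (crossing_last (crossing_back C' yy')) => e; subst d'.
have e : c = c' by rewrite -(crossing_last C) -(crossing_last C') -(cp_last H ux) (cp_last H uy).
subst c'; have := crossing_con H (con_trans (S ux) uy) C C' xx' yy'.
by move=> h; apply: con_trans (S xv) _; apply: con_trans h yv.
Qed.

(** A crossing followed by hops that fix the entries 1 and [n]: the whole is seen by [g], and the
    component of [[1, n - 1]] changes only at the crossing. *)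
Definition segment X Y := exists P r1 r2 d c, [/\ X = P ++ [:: r1; r2; d; c], r2 <= r1,
  d <= r2 < c \/ c <= r2 < d & hpath 1 p.+1 (P ++ [:: r1; r2; c; d]) Y].

Lemma segment_lift u X Y : T u = X -> segment X Y ->
  exists v, [/\ T v = Y, con E 1 p.+2 u v & cross u v].
Proof.
move=> Tu [P [r1 [r2 [d [c [eX r21 dc path]]]]]]; rewrite eX in Tu.
have C : crossing T u d c by exists P, r1, r2.
have [w uw] := crossing_edge H C.
have Tw : T w = P ++ [:: r1; r2; c; d].
  by rewrite (top_label uw) (hop_top H Tu) hop4_12 //; case: dc; [right|left].
have [|v wv Tv] := lift_path lab_T (leqnSn p.+1) (u := w) (y := Y) (lo := 1); first by rewrite Tw.
exists v; split=> //.
  by apply: con_trans (top_con H uw) _; apply: con_weaken wv.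
exists u, w, d, c; split=> //; [exact: ConRefl|exact: con_weaken wv].
Qed.

Lemma segment_loop X0 X1 X2 u : T u = X0 -> segment X0 X1 -> segment X1 X2 -> segment X2 X0 ->
  exists u1 u2, [/\ T u1 = X1, T u2 = X2, cross u u1, cross u1 u2 & cross u2 u].
Proof.
move=> Tu s0 s1 s2; have [u1 [T1 c1 x1]] := segment_lift Tu s0.
have [u2 [T2 c2 x2]] := segment_lift T1 s1.
have [u3 [T3 c3 x3]] := segment_lift T2 s2.
exists u1, u2; suff e : u3 = u by subst u3.
apply: (R_inj H); last by rewrite -!(cp_g H) T3 Tu.
by apply: S; apply: con_trans c3; apply: con_trans c2.
Qed.

Lemma last_removable u : removable (cnt (T u)) (last 0 (T u)).
Proof.
have [P [r1 [r2 [d [c Tu]]]]] := split4 u; have := cp_adm H u; rewrite Tu.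
rewrite -(cat1s r1) -(cat1s r2) -(cat1s d) !catA last_cat /=; exact: removable_end.
Qed.

Ltac bounds := repeat match goal with o : is_true (leq _ _) |- _ => move: {o}(o) end; clia.
Ltac win R e s i := apply: (@hpath_win _ _ R _ s _ i);
  [rewrite /hop /=; first [by rewrite hop4_12 //; bounds | by rewrite hop4_14 //; bounds] | rewrite e; move: p8; clia | rewrite e; move: p8; clia | ].

(* The loop avoids the first letter, so it closes up in the graph because [g]
   is faithful. *)
Lemma triangle_sorted u l m h : l < m < h -> removable (cnt (T u)) l -> removable (cnt (T u)) m ->
  removable (cnt (T u)) h -> last 0 (T u) \in [:: l; m; h] -> exists ul um uh,
  [/\ last 0 (T ul) = l, last 0 (T um) = m, last 0 (T uh) = h,
      [\/ con E 0 p.+1 u ul, con E 0 p.+1 u um | con E 0 p.+1 u uh] &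
      [/\ cross ul um, cross um uh & cross uh ul]].
Proof.
move=> lmh Rl Rm Rh Lu.
have [R [Z [z [y [x [B [b [A0 P0 [o1 /andP[o2 o3] /andP[o4 o5] o6 /andP[/andP[o7 o8] /andP[o9 o10]]]]]]]]]]] :=
  loop_word (cp_adm H u) lmh Rl Rm Rh.
(* As [8 <= p], at least one letter precedes the nine of the loop, so the entry 1 does not move. *)
have sR : size R = p - 7.
  by have := perm_size P0; rewrite (cp_size H) size_cat /=; clia.
pose X0 := R ++ [:: Z; z; y; x; B; h; b; m; l].
pose X1 := R ++ [:: Z; z; x; b; l; y; B; h; m].
pose X2 := R ++ [:: Z; z; y; x; b; B; m; l; h].
have s0 : segment X0 X1.
  exists (R ++ [:: Z; z; y; x; B]), h, b, m, l; split; rewrite -?catA //; try by move: o7 o8 o9 o10; clia.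
  win R sR [:: Z; z; x; y; B; h; b; l; m] 0.
  win R sR [:: Z; z; x; y; B; b; h; l; m] 3.
  win R sR [:: Z; z; y; x; B; b; h; l; m] 0.
  win R sR [:: Z; z; y; x; B; b; l; h; m] 4.
  win R sR [:: Z; z; y; x; b; B; l; h; m] 2.
  win R sR [:: Z; z; x; y; b; B; l; h; m] 0.
  win R sR [:: Z; z; x; y; b; l; B; h; m] 3.
  win R sR [:: Z; z; x; b; y; l; B; h; m] 1.
  win R sR [:: Z; z; x; b; l; y; B; h; m] 2.
  exact: HRefl.
have s1 : segment X1 X2.
  exists (R ++ [:: Z; z; x; b; l]), y, B, h, m; split; rewrite -?catA //; try by move: o6 o7 o8 o9 o10; clia.
  win R sR [:: Z; z; x; b; y; l; B; m; h] 2.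
  win R sR [:: Z; z; x; y; b; l; B; m; h] 1.
  win R sR [:: Z; z; y; x; b; l; B; m; h] 0.
  win R sR [:: Z; z; y; x; b; B; l; m; h] 3.
  win R sR [:: Z; z; y; x; B; b; l; m; h] 2.
  win R sR [:: Z; z; y; x; B; b; m; l; h] 4.
  win R sR [:: Z; z; y; x; b; B; m; l; h] 2.
  exact: HRefl.
have s2 : segment X2 X0.
  exists (R ++ [:: Z; z; y; x; b]), B, m, l, h; split; rewrite -?catA //; try by move: o6 o7 o8 o9 o10; clia.
  win R sR [:: Z; z; x; y; b; B; m; h; l] 0.
  win R sR [:: Z; z; x; b; y; B; m; h; l] 1.
  win R sR [:: Z; z; x; b; y; B; h; m; l] 4.
  win R sR [:: Z; z; x; y; b; B; h; m; l] 1.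
  win R sR [:: Z; z; y; x; b; B; h; m; l] 0.
  win R sR [:: Z; z; y; x; B; b; h; m; l] 2.
  win R sR [:: Z; z; y; x; B; h; b; m; l] 4.
  exact: HRefl.
have [P01 P02] : perm_eq X1 (T u) /\ perm_eq X2 (T u).
  by split; apply: perm_trans P0; rewrite perm_cat2l; apply/permP => s /=; clia.
have A1 : adm X1 by move: s0 => [P [r1 [r2 [d [c [e r21 dc path]]]]]]; apply: (hpath_adm path);
  have := adm_hop (size P) A0; rewrite -/X0 e hop_at hop4_12 ?cats0 //; case: dc; [right|left].
have A2 : adm X2 by move: s1 => [P [r1 [r2 [d [c [e r21 dc path]]]]]]; apply: (hpath_adm path);
  have := adm_hop (size P) A1; rewrite e hop_at hop4_12 ?cats0 //; case: dc; [right|left].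
have start Y a : adm (Y ++ [:: a]) -> perm_eq (Y ++ [:: a]) (T u) -> last 0 (T u) = a ->
    exists2 v, con E 0 p.+1 u v & T v = Y ++ [:: a].
  move=> AY PY la; have Tu := T_rcons H u; rewrite la -cats1 in Tu.
  have PY' : perm_eq (f u) Y by rewrite perm_sym -(perm_cat2r [:: a]) -Tu.
  have [v uv Tv] := T_exists H Tu isT (adm_catl AY) PY'.
  by exists v => //; move: uv; rewrite (lab_size Lf).
move: Lu; rewrite !inE => /or3P[/eqP e|/eqP e|/eqP e].
- have [||v uv Tv] := start (R ++ [:: Z; z; y; x; B; h; b; m]) l _ _ e; rewrite -?catA //.
  have [u1 [u2 [T1 T2 c1 c2 c3]]] := segment_loop (etrans Tv (esym (catA _ _ _))) s0 s1 s2.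
  exists v, u1, u2; split; rewrite ?Tv ?T1 ?T2 ?last_cat //; by [constructor 1|].
- have [||v uv Tv] := start (R ++ [:: Z; z; x; b; l; y; B; h]) m _ _ e; rewrite -?catA //.
  have [u1 [u2 [T1 T2 c1 c2 c3]]] := segment_loop (etrans Tv (esym (catA _ _ _))) s1 s2 s0.
  exists u2, v, u1; split; rewrite ?Tv ?T1 ?T2 ?last_cat //; by [constructor 2|].
- have [||v uv Tv] := start (R ++ [:: Z; z; y; x; b; B; m; l]) h _ _ e; rewrite -?catA //.
  have [u1 [u2 [T1 T2 c1 c2 c3]]] := segment_loop (etrans Tv (esym (catA _ _ _))) s2 s0 s1.
  exists u1, u2, v; split; rewrite ?Tv ?T1 ?T2 ?last_cat //; by [constructor 3|].
Qed.

(** A triangle of linked components with these three last corners exists and meets the component of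
    [u]; by [cross_uniq] it also contains those of [v] and [w]. *)
Lemma triangle u v w : cross u v -> cross v w -> last 0 (T u) <> last 0 (T w) -> cross u w.
Proof.
move=> uv vw; have [b [a [Lu Lv nba]]] := cross_last uv.
have [c [b' [Lv' Lw ncb]]] := cross_last vw; rewrite Lv in Lv'; subst b'; rewrite Lu Lw => nac.
have cP x y : cross x y -> cnt (T x) = cnt (T y).
  case=> z [z' [d' [c' [xz C zz' zy]]]]; apply: cnt_perm.
  apply: (con_perm lab_T (leqnn _)) => //; apply: con_trans (con_weaken (leqnn _) (leqnSn _) xz) _.
  by apply: con_trans (con1 (leq0n _) k2 zz') (con_weaken (leqnn _) (leqnSn _) zy).
have Ra := last_removable u; have Rb := last_removable v; have Rc := last_removable w.
rewrite -(cP _ _ vw) -(cP _ _ uv) Lw in Rc; rewrite -(cP _ _ uv) Lv in Rb; rewrite Lu in Ra.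
(* the triangle may be run through in either direction *)
have done ta tb tc : last 0 (T ta) = a -> last 0 (T tb) = b -> last 0 (T tc) = c ->
    con E 0 p.+1 u ta -> cross ta tb -> cross tb tc -> cross ta tc -> cross u w.
  move=> La Lb Lc uta ab bc ac; have R x : con E 0 p.+1 x x by exact: ConRefl.
  have vtb : con E 0 p.+1 v tb by apply: cross_uniq uv (cross_con uta ab (R _)) _; rewrite Lv Lb.
  have wtc : con E 0 p.+1 w tc by apply: cross_uniq vw (cross_con vtb bc (R _)) _; rewrite Lw Lc.
  exact: cross_con uta ac (S wtc).
have srt l m h : l < m < h -> [/\ a \in [:: l; m; h], b \in [:: l; m; h] & c \in [:: l; m; h]] ->
    [/\ removable (cnt (T u)) l, removable (cnt (T u)) m & removable (cnt (T u)) h] -> cross u w.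
  move=> lmh [la lb lc] [Rl Rm Rh]; rewrite -Lu in la.
  have [ul [um [uh [Ll Lm Lh cu [c1 c2 c3]]]]] := triangle_sorted lmh Rl Rm Rh la; rewrite Lu in la.
  have [s1 s2 s3] : [/\ cross um ul, cross uh um & cross ul uh] by split; exact: cross_sym.
  have cu' : exists2 ta, con E 0 p.+1 u ta & [|| ta == ul, ta == um | ta == uh].
    by case: cu => cu; [exists ul|exists um|exists uh]; rewrite ?eqxx ?orbT.
  case: cu' => ta uta ht; have Lta : last 0 (T ta) = a by rewrite -(cp_last H uta).
  have find x : x \in [:: l; m; h] -> exists2 t, last 0 (T t) = x & [|| t == ul, t == um | t == uh].
    by rewrite !inE => /or3P[/eqP->|/eqP->|/eqP->]; [exists ul|exists um|exists uh]; rewrite ?eqxx ?orbT.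
  have [tb Ltb hb] := find b lb; have [tc Ltc hc] := find c lc.
  have adj s t : [|| s == ul, s == um | s == uh] -> [|| t == ul, t == um | t == uh] ->
      last 0 (T s) <> last 0 (T t) -> cross s t.
    by move=> /or3P[/eqP->|/eqP->|/eqP->] /or3P[/eqP->|/eqP->|/eqP->].
  by apply: (done ta tb tc) => //; apply: adj; rewrite // ?Lta ?Ltb ?Ltc //; apply: not_eq_sym.
case: (ltngtP a b) nba => [ab _|ab _|-> //]; case: (ltngtP b c) ncb => [bc _|bc _|-> //];
  case: (ltngtP a c) nac => [ac _|ac _|-> //];
  try by exfalso; move: ab bc ac; clia.
- by apply: (srt a b c); rewrite ?ab ?bc ?inE ?eqxx ?orbT.
- by apply: (srt a c b); rewrite ?ac ?bc ?inE ?eqxx ?orbT.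
- by apply: (srt c a b); rewrite ?ac ?ab ?inE ?eqxx ?orbT.
- by apply: (srt b a c); rewrite ?ac ?ab ?inE ?eqxx ?orbT.
- by apply: (srt b c a); rewrite ?ac ?bc ?inE ?eqxx ?orbT.
- by apply: (srt c b a); rewrite ?ab ?bc ?inE ?eqxx ?orbT.
Qed.

(** By [triangle], vertices joined by arbitrary colors lie in the same component of [[1, n - 1]] or
    in two linked ones, and in the latter case the last letters of their labels differ. *)
Lemma faithful_T : faithful E p.+2 T.
Proof.
have R x : con E 0 p.+1 x x by exact: ConRefl.
have key u v : con E 0 p.+2 u v -> con E 0 p.+1 u v \/ cross u v.
  elim=> [|x y k _ IH _ kp xy]; first by left.
  have step : con E 0 p.+1 x y \/ cross x y.
    move: kp; rewrite leq_eqVlt => /orP[/eqP kp|kp]; last first.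
      by left; apply: (con1 (leq0n k) _ xy); move: kp; clia.
    have ek : k = p - 2 by move: kp; clia.
    subst k; have [P [r1 [r2 [d [c Tx]]]]] := split4 x.
    move h4: (hop4 r1 r2 d c) (hop4P r1 r2 d c) => t Ht.
    case: Ht h4 => [r21 dc|lo hi _ _ _ _ _|lo hi _ _ _|] h4;
      try by left; have [] := noncrossing H Tx h4 xy.
    right; exists x, y, d, c; split=> //; exists P, r1, r2.
    by split=> //; case: dc; [right|left].
  case: IH step => [ux|ux] [xy'|xy'].
  - by left; apply: con_trans xy'.
  - by right; apply: cross_con ux xy' (R _).
  - by right; apply: cross_con (R _) ux xy'.
  have [e|/eqP ne] := eqVneq (last 0 (T u)) (last 0 (T y)).
    by left; apply: cross_uniq (cross_sym ux) xy' e.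
  by right; apply: triangle ux xy' ne.
move=> u v /key[uv|uv] e; first exact: (L_inj H uv e).
by have [d [c []]] := cross_last uv; rewrite e => -> ->.
Qed.

End Faithful.

(** * Passage between the intervals and the whole graph *)

Section Global.
Variable V : finType.
Implicit Types (sig : V -> nat -> bool) (E : nat -> V -> V -> bool).

Lemma labeling0 sig E f : (forall v, f v = [::]) -> labeling sig E 0 f /\ faithful E 0 f.
Proof.
move=> f0; split; first by split=> // v; rewrite f0.
by move=> u v; case.
Qed.

Theorem local_to_global n sig E :
  (forall k u v, E k u v -> E k v u) ->
  (forall k l u v w, k + 3 < l -> l.+4 <= n -> E k u v -> E l u w -> exists2 y, E l v y & E k w y) ->
  (forall a m, m <= 9 -> a + m <= n -> exists f,
    labeling (fun v k => sig v (a + k)) (fun k => E (a + k)) m f /\ faithful (fun k => E (a + k)) m f) ->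
  exists f, labeling sig E n f /\ faithful E n f.
Proof.
elim: n sig E => [|n IH] sig E sym com loc; first exact: (loc 0 0).
have [n9|n9] := leqP n.+1 9; first exact: (loc 0 n.+1).
have [f [Lf Ff]] : exists f, labeling sig E n f /\ faithful E n f.
  apply: IH => // [k l u v w kl ln|a m m9 am]; first by apply: com => //; apply: leqW.
  by apply: loc => //; apply: leqW.
have [g [Lg Fg]] : exists g, labeling (shiftS sig) (shiftE E) n g /\ faithful (shiftE E) n g.
  apply: IH => [k u v|k l u v w kl ln|a m m9 am]; first exact: sym.
    by apply: com.
  exact: (loc a.+1 m).
case: n n9 {IH} com loc Lf Ff Lg Fg => [//|p] n9 com loc Lf Ff Lg Fg.
have G : glued sig E p f g by split.
have [T HT] := capped_exists G.
by exists T; split; [exact: lab_T HT|exact: faithful_T HT].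
Qed.

Lemma labeling_window n sig E f a m : labeling sig E n f -> faithful E n f -> a + m <= n ->
  exists g, labeling (fun v k => sig v (a + k)) (fun k => E (a + k)) m g /\
    faithful (fun k => E (a + k)) m g.
Proof.
elim: a n sig E f => [|a IH] n sig E f Lf Ff am.
  exists (fun v => take m (f v)); split; [exact: lab_take Lf|exact: faithful_take Lf Ff].
case: n Lf Ff am => // n Lf Ff am.
exact: (IH n (shiftS sig) (shiftE E) _ (lab_demote Lf) (faithful_demote Lf Ff) am).
Qed.

(** The two orders of travel end at connected vertices, whose labels agree because distant hops
    commute; faithfulness identifies them. *)
Lemma labeling_com n sig E f k l u v w : labeling sig E n f -> faithful E n f ->
  (forall k u v, E k u v -> E k v u) -> (k + 3 < l) || (l + 3 < k) -> k.+4 <= n -> l.+4 <= n ->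
  E k u v -> E l u w -> exists2 y, E l v y & E k w y.
Proof.
move=> Lf Ff sym kl kn ln uv uw.
have [ev nv] := lab_edge Lf kn uv; have [ew nw] := lab_edge Lf ln uw.
have [|y vy] := lab_lift Lf ln (u := v).
  by rewrite ev; apply/eqP; rewrite hop_far 1?orbC //; apply/eqP; rewrite -ew.
have [|z wz] := lab_lift Lf kn (u := w).
  by rewrite ew; apply/eqP; rewrite hop_far //; apply/eqP; rewrite -ev.
have [ey _] := lab_edge Lf ln vy; have [ez _] := lab_edge Lf kn wz.
exists y => //; suff -> : y = z by [].
apply: Ff; last first.
  by rewrite ey ez ev ew; case/orP: kl => kl; [symmetry|]; exact: hop_comm.
apply: con_trans (con1 (leq0n _) ln (sym _ _ _ vy)) _.
apply: con_trans (con1 (leq0n _) kn (sym _ _ _ uv)) _.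
exact: con_trans (con1 (leq0n _) ln uw) (con1 (leq0n _) kn wz).
Qed.

End Global.

(** * Tableaux and reading words *)

(* The order of the entries [1, size w] in the reading word of a tableau whose
   entry [k] lies in row [nth 0 w k.-1]. *)
Definition bef (w : seq nat) : rel nat := fun x y =>
  (nth 0 w y.-1 < nth 0 w x.-1) || (nth 0 w x.-1 == nth 0 w y.-1) && (x < y).

Definition reads (w W : seq nat) : Prop :=
  sorted (bef w) W /\ forall x, (x \in W) = (0 < x <= size w).

Lemma bef_trans w : transitive (bef w).
Proof. by move=> y x z; rewrite /bef; lia. Qed.

Lemma bef_irr w : irreflexive (bef w).
Proof. by move=> x; rewrite /bef; lia. Qed.

Lemma reads_eq w W W' : reads w W -> reads w W' -> W = W'.
Proof.
move=> [s m] [s' m']; apply: (irr_sorted_eq (@bef_trans w) (@bef_irr w)) => // x.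
by rewrite m m'.
Qed.

Lemma reads_index w W x y : reads w W -> 0 < x -> x < y -> y <= size w ->
  (index x W < index y W) = (nth 0 w y.-1 <= nth 0 w x.-1).
Proof.
move=> [s m] x0 xy ys.
have [mx my] : x \in W /\ y \in W by rewrite !m; move: x0 xy ys; clia.
have L := sorted_ltn_index (@bef_trans w) s.
have [lt|le] := ltnP (index x W) (index y W).
  by have := L x y mx my lt; rewrite /bef; move: xy; clia.
have : index y W < index x W.
  rewrite ltn_neqAle le andbT; apply/eqP => e; have := nth_index 0 mx; rewrite -e nth_index //.
  by move: xy; clia.
by move/(L y x my mx); rewrite /bef; move: xy; clia.
Qed.

Definition sw (v x : nat) : nat := if x == v then v.+1 else if x == v.+1 then v else x.

Lemma swK v : involutive (sw v).
Proof. by move=> x; rewrite /sw; case: (eqVneq x v) => [->|]; repeat case: eqP; lia. Qed.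

Lemma hop4_id a b c d : ~~ (pk [:: a; b; c; d] 0 || pk [:: a; b; c; d] 1) -> hop4 a b c d = [:: a; b; c; d].
Proof. by rewrite -hop4_fixed => /eqP. Qed.

Ltac hcase H := rewrite /sorted /path /bef /= andbT in H; first
  [ left; split; [by []|by rewrite hop4_id //; move: H; rewrite /pk /=; clia]
  | right; exists 3; rewrite hop4_12; [split; [by []|by rewrite !inE eqxx|by case; move: H; clia]
      |by move: H; clia|by move: H; clia]
  | right; exists 2; rewrite hop4_14; [split; [by []|by rewrite !inE eqxx|by case; move: H; clia]
      |by move: H; clia]
  | right; exists 1; rewrite hop4_43; [split; [by []|by rewrite !inE eqxx|by case; move: H; clia]
      |by move: H; clia|by move: H; clia]].

(** In each form of [h1] the two values exchanged are consecutive, [v] and [v.+1]. Exchanging them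
    in the reading word amounts to exchanging the rows of these two entries, which is checked on the
    24 words. *)
Lemma h1_hop4 s a b c d : perm_eq s [:: 1; 2; 3; 4] -> sorted (bef [:: a; b; c; d]) s ->
  (h1 s = s /\ hop4 a b c d = [:: a; b; c; d]) \/
  exists v, [/\ h1 s = map (sw v) s,
    (v, hop4 a b c d) \in [:: (1, [:: b; a; c; d]); (2, [:: a; c; b; d]); (3, [:: a; b; d; c])] &
    hop4 a b c d <> [:: a; b; c; d]].
Proof.
have perms : permutations [:: 1; 2; 3; 4] =i
  [:: [:: 1; 2; 3; 4]; [:: 1; 2; 4; 3]; [:: 1; 3; 2; 4]; [:: 1; 3; 4; 2]; [:: 1; 4; 2; 3]; [:: 1; 4; 3; 2];
      [:: 2; 1; 3; 4]; [:: 2; 1; 4; 3]; [:: 2; 3; 1; 4]; [:: 2; 3; 4; 1]; [:: 2; 4; 1; 3]; [:: 2; 4; 3; 1];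
      [:: 3; 1; 2; 4]; [:: 3; 1; 4; 2]; [:: 3; 2; 1; 4]; [:: 3; 2; 4; 1]; [:: 3; 4; 1; 2]; [:: 3; 4; 2; 1];
      [:: 4; 1; 2; 3]; [:: 4; 1; 3; 2]; [:: 4; 2; 1; 3]; [:: 4; 2; 3; 1]; [:: 4; 3; 1; 2]; [:: 4; 3; 2; 1]].
  by apply: perm_mem; vm_compute.
rewrite -mem_permutations perms !inE => Hs.
repeat case/orP: Hs => Hs; move/eqP: Hs => -> H; hcase H.
Qed.

Lemma split_hop k w : k.+4 <= size w -> exists P a b c d s,
  [/\ w = P ++ [:: a, b, c, d & s], size P = k & hop k w = P ++ hop4 a b c d ++ s].
Proof.
move=> kw; have := cat_take_drop k w; have := size_takel (leq_trans (leqW (leqW (leqW (leqnSn k)))) kw).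
have : 4 <= size (drop k w) by rewrite size_drop; move: kw; clia.
move: (take k w) (drop k w) => P [|a [|b [|c [|d s]]]] // _ sP <-.
by exists P, a, b, c, d, s; split=> //; rewrite -sP hop_at.
Qed.

Lemma nth_hop_sw k w P a b c d s v : w = P ++ [:: a, b, c, d & s] -> size P = k ->
  hop k w = P ++ hop4 a b c d ++ s ->
  (v, hop4 a b c d) \in [:: (1, [:: b; a; c; d]); (2, [:: a; c; b; d]); (3, [:: a; b; d; c])] ->
  hop4 a b c d <> [:: a; b; c; d] ->
  (forall x, 0 < x -> nth 0 (hop k w) (sw (v + k) x).-1 = nth 0 w x.-1) /\
  nth 0 w (v + k).-1 <> nth 0 w (v + k).
Proof.
move=> ew sP -> h ne; rewrite ew.
have at_ t x : nth 0 (P ++ t) x = if x < k then nth 0 P x else nth 0 t (x - k) by rewrite nth_cat sP.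
have ifF x t (u : nat) : (if k + x < k then t else u) = u by rewrite ltnNge leq_addr.
have nthk t i : nth 0 (P ++ t) (k + i) = nth 0 t i by rewrite at_ ifF addKn.
have lo t x : x < k -> nth 0 (P ++ t) x = nth 0 P x by move=> xk; rewrite at_ xk.
have sw_lo x : 0 < v -> x <= k -> sw (v + k) x = x by rewrite /sw; move=> v0 xk; do ![case: eqP]; move: v0 xk; clia.
have sw_hi x : v <= 3 -> k.+4 < x -> sw (v + k) x = x by rewrite /sw; move=> v0 xk; do ![case: eqP]; move: v0 xk; clia.
have [v1 v3] : 0 < v /\ v <= 3 by move: h; rewrite !inE => /or3P[] /eqP[-> _].
split.
  move=> x x0; have [xk|xk] := leqP x k.
    by rewrite sw_lo // !lo //; move: x0 xk; clia.
  have [hx|hx] := ltnP k.+4 x.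
    rewrite sw_hi //; have -> : x.-1 = k + (4 + (x - k.+1 - 4)) by move: hx; clia.
    rewrite !nthk; move: h; rewrite !inE => /or3P[] /eqP[_ ->] //.
  have S (i : nat) : sw (v + k) (i + k.+1) = (if i.+1 == v then i.+1 else if i == v then i.-1 else i) + k.+1.
    rewrite /sw; do ![case: eqP]; move: v1; clia.
  have N t i : nth 0 (P ++ t) (i + k.+1).-1 = nth 0 t i by rewrite addnS /= addnC nthk.
  have : x = 0 + k.+1 \/ x = 1 + k.+1 \/ x = 2 + k.+1 \/ x = 3 + k.+1 by move: xk hx; clia.
  by move: h; rewrite !inE => /or3P[] /eqP[ev ->] [|[|[|]]] ->; rewrite S ev N N.
have -> : (v + k).-1 = k + v.-1 by move: v1; clia.
rewrite (addnC v) !nthk; move: h; rewrite !inE => /or3P[] /eqP[-> e] /= e2; apply: ne; rewrite e ?e2 //.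
Qed.

Lemma reads_h w W i : reads w W -> 1 <= i -> i + 3 <= size w -> reads (hop i.-1 w) (h i W).
Proof.
case: i => // p [sW mW] _ ps /=; rewrite addSn addn3 in ps.
have [P [a [b [c [d [t [ew sP eh]]]]]]] := split_hop ps.
have uW : uniq W := sorted_uniq (@bef_trans w) (@bef_irr w) sW.
set s := [seq x <- W | p.+1 <= x <= p.+1 + 3]; set s0 := [seq x - (p.+1 - 1) | x <- s].
have ms x : (x \in s) = (p < x <= p + 4).
  by rewrite mem_filter mW; move: ps; clia.
have us : uniq s := filter_uniq _ uW.
have us0 : uniq s0.
  rewrite map_inj_in_uniq // => x y; rewrite !ms; clia.
have P0 : perm_eq s0 [:: 1; 2; 3; 4].
  apply: uniq_perm => // x; apply/mapP/idP => [[y]|].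
    by rewrite ms !inE => yp ->; move: yp; clia.
  move=> hx; exists (x + p); rewrite ?ms; move: hx; rewrite !inE; clia.
have S0 : sorted (bef [:: a; b; c; d]) s0.
  rewrite /s0 sorted_map; apply: (@sub_in_sorted _ (mem s) (bef w)); last first.
  - by apply: sorted_filter sW; apply: bef_trans.
  - exact/allP.
  move=> x y xs ys; have hx : p < x <= p + 4 by rewrite -ms.
  have hy : p < y <= p + 4 by rewrite -ms.
  have N z : p < z <= p + 4 -> nth 0 [:: a; b; c; d] (z - (p.+1 - 1)).-1 = nth 0 w z.-1.
    move=> hz; have [i [zi i4]] : exists i, z = p + i.+1 /\ i < 4.
      by exists (z - p.+1); move: hz; clia.
    rewrite ew nth_cat sP zi addnS /= ltnNge leq_addr /= addKn subn1 /= -addnS addKn /=.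
    by case: i {zi} i4 => [|[|[|[|]]]].
  by rewrite /bef /= !N //; move: hx hy; clia.
have hE : h p.+1 W = [seq if x \in s then nth 0 [seq y + p | y <- h1 s0] (index x s) else x | x <- W].
  by rewrite /h -/s -/s0 subn1.
have [[e1 e2]|[v [e1 e2 e3]]] := h1_hop4 P0 S0.
  have -> : hop p w = w by rewrite eh e2 -ew.
  suff -> : h p.+1 W = W by [].
  rewrite hE e1; apply: map_id_in => x xW; case: ifP => // xs.
  rewrite -map_comp (nth_map 0) ?index_mem // nth_index //=; move: xs; rewrite ms; clia.
have [N1 N2] := nth_hop_sw ew sP eh e2 e3.
have [v1 v3] : 0 < v /\ v <= 3 by move: e2; rewrite !inE => /or3P[] /eqP[-> _].
have -> : h p.+1 W = map (sw (v + p)) W.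
  rewrite hE e1; apply/eq_in_map => x xW; case: ifP => xs.
    rewrite -map_comp -map_comp (nth_map 0) ?index_mem // nth_index //=; move: xs; rewrite ms /sw.
    by move=> hx; do ![case: eqP]; move: hx v1 v3; clia.
  by move: xs; rewrite ms /sw; do ![case: eqP]; move: v1 v3; clia.
split; last first.
  move=> x; rewrite -{1}(swK (v + p) x) mem_map ?mW ?size_hop; last exact: can_inj (swK _).
  by rewrite /sw; do ![case: eqP]; move: ps v1 v3; clia.
rewrite sorted_map; apply: (@sub_in_sorted _ (mem W) (bef w)) sW; last exact/allP.
move=> x y xW yW; have hx : 0 < x <= size w by rewrite -mW.
have hy : 0 < y <= size w by rewrite -mW.
rewrite /bef /= !N1; try by move: hx hy; clia.
(* Two entries of one row keep their order unless they are the two exchanged ones, and those lie in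
   different rows by [N2]. *)
case/orP=> [-> //|/andP[/eqP e xy]]; rewrite e eqxx ltnn /=.
move: N2; have := e; rewrite /sw; do ![case: eqP]; try by move: xy; clia.
by move=> *; subst; exfalso; auto.
Qed.

(** * Standard fillings as words of rows *)

Definition occ (w : seq nat) (r : nat) : seq nat := [seq k <- iota 0 (size w) | nth 0 w k == r].

Lemma occ_rcons w a r : occ (rcons w a) r = if a == r then rcons (occ w r) (size w) else occ w r.
Proof.
rewrite /occ size_rcons -addn1 iotaD filter_cat /= add0n nth_rcons ltnn eqxx.
have -> : [seq k <- iota 0 (size w) | nth 0 (rcons w a) k == r] = [seq k <- iota 0 (size w) | nth 0 w k == r].
  by apply: eq_in_filter => k; rewrite mem_iota nth_rcons /= add0n => ->.
by case: ifP; rewrite ?cats0 ?cats1.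
Qed.

Lemma size_occ w r : size (occ w r) = cnt w r.
Proof.
elim/last_ind: w => [|w a IH] //; rewrite occ_rcons cnt_rcons /inc (eq_sym r a).
by case: eqP; rewrite ?size_rcons IH ?addn1 ?addn0.
Qed.

Lemma occ_sorted w r : sorted ltn (occ w r).
Proof. by apply: sorted_filter (iota_ltn_sorted _ _) => x y z; apply: ltn_trans. Qed.

Lemma mem_occ w r k : (k \in occ w r) = (k < size w) && (nth 0 w k == r).
Proof. by rewrite mem_filter mem_iota andbC. Qed.

(** An entry of row [r] is among the first [k] entries exactly when the row has by then grown past
    its cell. Column conditions thus become inequalities between row lengths. *)
Lemma nth_occ_lt w r i k : i < size (occ w r) -> k <= size w ->
  (nth 0 (occ w r) i < k) = (i < cnt (take k w) r).
Proof.
elim/last_ind: w => [|w a IH] //; rewrite size_rcons => si; rewrite leq_eqVlt => /orP[/eqP->|ks].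
  rewrite -(size_rcons w a) take_size -size_occ si; have := mem_nth 0 si.
  by rewrite mem_occ => /andP[].
rewrite -cats1 takel_cat // cats1; move: si; rewrite occ_rcons; case: ifP => _; last by move/IH; apply.
rewrite size_rcons nth_rcons; case: (ltngtP i (size (occ w r))) => [lt _|gt si|-> _]; [exact: IH|by move: gt si; clia|].
rewrite ltnNge -ltnS ks size_occ; apply/esym/negbTE; rewrite -leqNgt.
by rewrite -{2}(cat_take_drop k w) !cntE count_cat leq_addr.
Qed.

Lemma adm_nth w : (forall k, k < size w -> addable (cnt (take k w)) (nth 0 w k)) -> adm w.
Proof.
elim/last_ind: w => // w a IH H; rewrite adm_rcons; apply/andP; split.
  apply: IH => k kw; have := H k; rewrite size_rcons nth_rcons kw -cats1 takel_cat 1?ltnW //.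
  exact.
by have := H (size w); rewrite size_rcons nth_rcons ltnn eqxx -cats1 take_size_cat //; apply.
Qed.

Lemma addable_nth w k : adm w -> k < size w -> addable (cnt (take k w)) (nth 0 w k).
Proof.
by move=> A kw; move: A; rewrite -{1}(cat_take_drop k w) adm_cat (drop_nth 0 kw) /= => /and3P[].
Qed.

Lemma pairwise_allpairs (A B : eqType) (rA : rel A) (rB : rel B) sA sB :
  pairwise rA sA -> pairwise rB sB ->
  pairwise (fun c d : A * B => rA c.1 d.1 || (c.1 == d.1) && rB c.2 d.2) [seq (i, j) | i <- sA, j <- sB].
Proof.
elim: sA => //= i sA IH /andP[/allP iA pA] pB; rewrite pairwise_cat IH // andbT; apply/andP; split.
  apply/allrelP => _ _ /mapP[j _ ->] /allpairsP[[i' j'] [i'A _ ->]] /=; by rewrite iA.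
rewrite pairwise_map; apply: sub_pairwise pB => j j' /= ->; by rewrite eqxx orbT.
Qed.

(** Peaks and colors in the 0-based indices of [pk] and [hop]. *)
Definition gsig m (G : scgraph m) (v : G) (k : nat) : bool := signature v k.+2.
Definition gedge m (G : scgraph m) (k : nat) (u v : G) : bool := edge k.+1 u v.

Section Tableaux.
Variables (n : nat) (lam : strict_part n).
Local Notation L := (fun r => nth 0 lam r).
Local Notation shape := (shifted_shape lam).

Lemma parts_strict : strict L.
Proof.
move=> r; case: (ltnP r.+1 (size lam)) => [lt|ge]; last by left; rewrite nth_default.
right; have := parts_decr lam; move/(sortedP 0) => /(_ r lt).
by [].
Qed.

Lemma parts_bound r : 0 < L r -> r + L r <= n.
Proof.
move=> Lr; apply: leq_trans (_ : r + L r <= sumn lam) _; last by rewrite (parts_sum lam).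
move: Lr; have := parts_pos lam; elim: (parts lam) r => [|x s IH] [|r] //=; first by move=> *; rewrite leq_addr.
by case/andP=> x0 /IH{}IH /IH; move: x0; clia.
Qed.

Lemma shapeE (c : 'I_n * 'I_n) : (c \in shape) = (c.1 <= c.2 < L c.1 + c.1).
Proof. by rewrite inE. Qed.

Lemma cell_inj (c d : 'I_n * 'I_n) : c.1 = d.1 :> nat -> c.2 = d.2 :> nat -> c = d.
Proof. by case: c d => c1 c2 [d1 d2] /= /val_inj-> /val_inj->. Qed.

Lemma cell_exists r i : i < L r -> exists2 c : 'I_n * 'I_n, c \in shape & (c.1 : nat, c.2 : nat) = (r, r + i).
Proof.
move=> iL; have b := parts_bound (leq_ltn_trans (leq0n i) iL).
have rn : r < n by move: b iL; clia.
have cn : r + i < n by move: b iL; clia.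
by exists (Ordinal rn, Ordinal cn) => //; rewrite shapeE /=; move: iL; clia.
Qed.

Lemma standard_gt0 (T : SST lam) c : (0 < val T c) = (c \in shape).
Proof. by case: T => T /= /and4P[/forallP/(_ c)/eqP]. Qed.

Lemma standard_cell (T : SST lam) k : 0 < k <= n -> exists2 c, c \in shape & val T c = k :> nat.
Proof.
case: T => T /= /and4P[_ /forallP H _ _] kn.
have kn' : k < n.+1 by case/andP: kn.
have := H (Ordinal kn'); have -> : 0 < Ordinal kn' by case/andP: kn.
move/cards1P=> [c] /setP/(_ c); rewrite !inE eqxx => /andP[cs /eqP e].
by exists c; rewrite ?shapeE ?e.
Qed.

Lemma standard_inj (T : SST lam) c d : c \in shape -> val T c = val T d -> c = d.
Proof.
move=> cs e; have ds : d \in shape by rewrite -(standard_gt0 T) -e standard_gt0.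
move: cs (standard_gt0 T c); case: T e => T /= /and4P[_ /forallP H _ _] e cs; rewrite cs => T0.
have := H (T c); rewrite T0 => /cards1P[b] /setP Hb.
have := Hb c; have := Hb d; rewrite !in_set -e eqxx !andbT !in_set1 -!shapeE cs ds.
by move=> /esym/eqP-> /esym/eqP->.
Qed.

Lemma standard_row (T : SST lam) c d : c \in shape -> d \in shape -> c.1 = d.1 -> c.2 < d.2 ->
  val T c < val T d.
Proof.
case: T => T /= /and4P[_ _ /forall_inP H _] cs ds e lt.
by have /forall_inP/(_ d ds) := H c cs; rewrite e eqxx lt.
Qed.

Lemma standard_col (T : SST lam) c d : c \in shape -> d \in shape -> c.2 = d.2 -> c.1 < d.1 ->
  val T c < val T d.
Proof.
case: T => T /= /and4P[_ _ _ /forall_inP H] cs ds e lt.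
by have /forall_inP/(_ d ds) := H c cs; rewrite e eqxx lt.
Qed.

Definition row_word (T : SST lam) (w : seq nat) : Prop :=
  size w = n /\ forall c, c \in shape -> nth 0 w (val T c).-1 = c.1.

Lemma row_word_exists T : exists w, row_word T w.
Proof.
have /fin_all_exists[f Hf] : forall k : 'I_n, exists c, c \in shape /\ val T c = k.+1 :> nat.
  by move=> k; have [|c cs e] := @standard_cell T k.+1; [rewrite /=|exists c].
exists [seq nat_of_ord (f k).1 | k <- enum 'I_n]; split; first by rewrite size_map size_enum_ord.
move=> c cs; have T0 := standard_gt0 T c; rewrite cs in T0.
have kn : (val T c).-1 < n by have := ltn_ord (val T c); move: T0; clia.
rewrite (nth_map (Ordinal kn)) ?size_enum_ord //.
have -> : nth (Ordinal kn) (enum 'I_n) (val T c).-1 = Ordinal kn.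
  by apply: val_inj; rewrite /= nth_enum_ord.
have [fs fe] := Hf (Ordinal kn); congr (nat_of_ord _.1); apply: (@standard_inj T) => //.
by apply: val_inj; rewrite /= fe /= prednK.
Qed.

Lemma row_word_uniq T w w' : row_word T w -> row_word T w' -> w = w'.
Proof.
move=> [s H] [s' H']; apply: (@eq_from_nth _ 0) => [|k]; rewrite s ?s' // => kn.
have [|c cs e] := @standard_cell T k.+1; first by rewrite /=.
by have := H c cs; have := H' c cs; rewrite e /= => -> ->.
Qed.

Lemma row_word_reads T w : row_word T w -> reads w (reading_word T).
Proof.
move=> [s H]; split.
  have srt : sorted (fun i j : 'I_n => i < j) (enum 'I_n).
    by have := iota_ltn_sorted 0 n; rewrite -val_enum_ord sorted_map.
  rewrite /reading_word sorted_map.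
  pose R (c d : 'I_n * 'I_n) := (d.1 < c.1) || (c.1 == d.1) && (c.2 < d.2).
  apply: (@sub_in_sorted _ (mem shape) R); last 1 first.
  - apply: sorted_filter => [y x z|]; first by rewrite /R -!val_eqE /=; clia.
    apply: pairwise_sorted.
    have := @pairwise_allpairs _ _ (fun i j : 'I_n => j < i) (fun i j : 'I_n => i < j) (rev (enum 'I_n)) (enum 'I_n).
    apply.
      rewrite -sorted_pairwise ?rev_sorted; last by move=> y x z /= h1 h2; exact: ltn_trans h2 h1.
      exact: srt.
    rewrite -sorted_pairwise; last by move=> y x z; exact: ltn_trans.
    exact: srt.
  - by move=> c d cs ds; rewrite /R /bef /= !H // => /orP[->//|/andP[/eqP e lt]]; rewrite e eqxx standard_row ?orbT.
  - by apply/allP => c; rewrite mem_filter => /andP[].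
move=> x; rewrite s; apply/mapP/idP => [[c]|x0].
  by rewrite mem_filter => /andP[cs _] ->; rewrite standard_gt0 cs -ltnS /=.
have [c cs e] := standard_cell T x0; exists c => //.
rewrite mem_filter cs; apply/allpairsP; exists c; rewrite mem_rev !mem_enum.
by split=> //; case: (c).
Qed.

Lemma reading_word_inj (T U : SST lam) : reading_word T = reading_word U -> T = U.
Proof.
move=> e; apply: val_inj; apply/ffunP => c; case cs: (c \in shape); last first.
  have := standard_gt0 T c; have := standard_gt0 U c; rewrite cs.
  have z x : (0 < x) = false -> x = 0 by case: x.
  by move=> h1 h2; apply: val_inj; rewrite /= (z _ h1) (z _ h2).
apply: val_inj; move/eq_in_map: e => /(_ c); apply; rewrite mem_filter cs /=.
by apply/allpairsP; exists c; rewrite mem_rev !mem_enum; split=> //; case: (c).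
Qed.

Lemma row_word_inj T U w : row_word T w -> row_word U w -> T = U.
Proof. by move=> /row_word_reads rT /row_word_reads rU; apply/reading_word_inj/(reads_eq rT rU). Qed.

Definition entry (T : SST lam) (r j : nat) : nat :=
  if [pick c : 'I_n * 'I_n | (c.1 == r :> nat) && (c.2 == j :> nat)] is Some c then val T c else 0.

Lemma entryE T (c : 'I_n * 'I_n) r j : (c.1 : nat, c.2 : nat) = (r, j) -> entry T r j = val T c.
Proof.
rewrite /entry; case: pickP => [d /andP[/eqP d1 /eqP d2] [c1 c2]|/(_ c) + [c1 c2]].
  by congr (nat_of_ord (val T _)); apply: cell_inj; rewrite ?c1 ?c2.
by rewrite c1 c2 !eqxx.
Qed.

Lemma occ_row T w r : row_word T w -> occ w r = mkseq (fun i => (entry T r (r + i)).-1) (L r).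
Proof.
move=> [s H]; apply: (irr_sorted_eq ltn_trans ltnn); first exact: occ_sorted.
  rewrite /mkseq sorted_map; apply: (@sub_in_sorted _ (mem (iota 0 (L r))) ltn); last 2 first.
  - by apply/allP.
  - exact: iota_ltn_sorted.
  move=> i j; rewrite /= !mem_iota !add0n => /andP[_ iL] /andP[_ jL] ij.
  have [c cs ec] := cell_exists iL; have [d ds ed] := cell_exists jL.
  rewrite (entryE T ec) (entryE T ed).
  have := standard_gt0 T c; have : val T c < val T d; last by rewrite cs; clia.
  have [[c1 c2] [d1 d2]] := (ec, ed); apply: standard_row => //; first by apply: val_inj; rewrite /= c1 d1.
  by rewrite c2 d2 ltn_add2l.
move=> k; rewrite mem_occ s; apply/andP/mapP => [[kn /eqP e]|[i]].
  have [|c cs ec] := @standard_cell T k.+1; first by rewrite /=.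
  have := H c cs; rewrite ec /= e => r1; move: (cs); rewrite shapeE => /andP[c12 c2L].
  exists (c.2 - c.1); first by rewrite mem_iota add0n r1 /= ltn_subLR // addnC.
  by rewrite (entryE T (c := c)) ?ec // r1 subnKC.
rewrite mem_iota add0n => /andP[_ iL] ->; have [c cs ec] := cell_exists iL.
rewrite (entryE T ec) H //; have [-> _] := ec; have := standard_gt0 T c; rewrite cs.
by have := ltn_ord (val T c); split=> //; lia.
Qed.

Lemma row_word_cnt T w r : row_word T w -> cnt w r = L r.
Proof. by move=> /occ_row H; rewrite -size_occ H size_mkseq. Qed.

(** Because of the shift, the cell directly below has an index larger by one in its own row, and its
    entry is smaller; this is the strict inequality of [addable]. *)
Lemma row_word_adm T w : row_word T w -> adm w.
Proof.
move=> Hw; have [s H] := Hw; apply: adm_nth => k; rewrite s => kn.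
have [|c cs ec] := @standard_cell T k.+1; first by rewrite /=.
have := H c cs; rewrite ec /= => ->; move: (cs); rewrite shapeE => /andP[c12 c2L].
have kw : k <= size w by rewrite s ltnW.
have iL : c.2 - c.1 < L c.1 by rewrite ltn_subLR // addnC.
have := @nth_occ_lt w c.1 (c.2 - c.1) k; rewrite size_occ (row_word_cnt _ Hw) => /(_ iL kw).
rewrite (occ_row _ Hw) nth_mkseq // subnKC // (entryE T (c := c)) // ec ltnn => /esym/negbT.
rewrite -leqNgt => ci; rewrite /addable; case E: (c.1 : nat) => [//|r] /=.
have iL' : (c.2 - c.1).+1 < L r.
  by case: (parts_strict r); rewrite -E; move: iL; clia.
have [d ds ed] := cell_exists iL'.
have := @nth_occ_lt w r (c.2 - c.1).+1 k; rewrite size_occ (row_word_cnt _ Hw) => /(_ iL' kw).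
rewrite (occ_row _ Hw) nth_mkseq // (entryE T ed).
have : val T d < val T c.
  have [d1 d2] := ed; apply: standard_col => //; first by apply: val_inj; rewrite /= d2 addnS -addSn -E subnKC.
  by rewrite d1 E.
have := standard_gt0 T d; rewrite ds ec -E; move: (nat_of_ord (val T d)) ci => x; clia.
Qed.

(** Row [r] receives from left to right the positions of the letter [r], counted from 1. *)
Lemma row_word_lift w : adm w -> size w = n -> (forall r, cnt w r = L r) -> exists T, row_word T w.
Proof.
move=> A s C; pose F (c : 'I_n * 'I_n) := if c \in shape then (nth 0 (occ w c.1) (c.2 - c.1)).+1 else 0.
have idx c : c \in shape -> c.2 - c.1 < size (occ w c.1).
  by rewrite size_occ C shapeE => /andP[c12]; rewrite ltn_subLR // addnC.
have occF c : c \in shape -> F c = (nth 0 (occ w c.1) (c.2 - c.1)).+1 by rewrite /F => ->.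
have memF c : c \in shape -> (F c).-1 < n /\ nth 0 w (F c).-1 = c.1.
  move=> cs; have := mem_nth 0 (idx c cs); rewrite mem_occ s occF //= => /andP[-> /eqP ->] //.
have Fn c : F c < n.+1.
  by case cs: (c \in shape); [have [+ _] := memF c cs; rewrite occF|rewrite /F cs].
pose T : {ffun 'I_n * 'I_n -> 'I_n.+1} := [ffun c => inord (F c)].
have TF c : T c = F c :> nat by rewrite ffunE inordK.
have ST : standard lam T.
  apply/and4P; split.
  - by apply/forallP => c; rewrite TF /F; case: ifP.
  - apply/forallP => k; apply/implyP => k0; have kn : k.-1 < n by have := ltn_ord k; move: k0; clia.
    set r := nth 0 w k.-1; have ko : k.-1 \in occ w r by rewrite mem_occ s kn eqxx.
    have iL : index k.-1 (occ w r) < L r by rewrite -C -size_occ index_mem.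
    have [c cs [c1 c2]] := cell_exists iL; apply/cards1P; exists c; apply/setP => d.
    rewrite in_set in_set1 -val_eqE /= TF; apply/andP/eqP => [[ds /eqP e]|->].
      have [_ d1] := memF d ds; rewrite e -/r in d1.
      have e' : nth 0 (occ w r) (d.2 - r) = k.-1 by rewrite -e occF // d1.
      have : d.2 - r = index k.-1 (occ w r).
        rewrite -e' index_uniq //; first by rewrite d1 idx.
        exact: sorted_uniq ltn_trans ltnn _ (occ_sorted w r).
      move: ds; rewrite shapeE => /andP[d12 _] e2; apply: cell_inj; first by rewrite c1.
      by rewrite c2 -e2 d1 subnKC // -d1.
    by split=> //; rewrite occF // c1 c2 addKn nth_index // prednK.
  - apply/forall_inP => c cs; apply/forall_inP => d ds; apply/implyP => /andP[/eqP e lt].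
    rewrite !TF !occF // ltnS e; apply: (sorted_ltn_nth ltn_trans 0 (occ_sorted w d.1)).
    + by rewrite inE; have := idx c cs; rewrite e.
    + by rewrite inE; exact: idx.
    + by move: cs ds; rewrite !shapeE e => /andP[c1 _] /andP[d1 _]; apply: ltn_sub2r => //; apply: leq_ltn_trans lt.
  - apply/forall_inP => c cs; apply/forall_inP => d ds; apply/implyP => /andP[/eqP e lt].
    rewrite !TF !occF // ltnS; set k := nth 0 (occ w d.1) _.
    have [kn kd] : k < n /\ nth 0 w k = d.1 by have := memF d ds; rewrite occF.
    have kw : k < size w by rewrite s.
    rewrite nth_occ_lt ?idx ?(ltnW kw) //; have Ak := addable_nth A kw; rewrite kd in Ak.
    have St : strict (cnt (take k w)) by apply/strict_cnt/adm_take.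
    have := @nth_occ_lt w d.1 (d.2 - d.1) k.+1 (idx d ds) kw; rewrite -/k ltnSn (take_nth 0) // cnt_rcons kd incE => /esym di.
    move: Ak; rewrite /addable; case E: (d.1 : nat) lt => [|r] // lt /= Ak.
    have cr : c.1 + (r - c.1) = r by rewrite subnKC.
    (* The lower cell need not be in the adjacent row: strictness of the shape at that stage carries
       the length condition from row [r] down to row [c.1]. *)
    have := @strict_add (cnt (take k w)) c.1 (r - c.1) St; rewrite cr => /(_ (leq_ltn_trans (leq0n _) Ak)) hs.
    rewrite e; move: ds; rewrite shapeE => /andP[d12 _]; move: Ak di hs lt d12; rewrite E.
    move: (nat_of_ord c.1) (nat_of_ord d.2) (cnt (take k w) r.+1) (cnt (take k w) r) (cnt (take k w) c.1) => c1 d2 x y z; clia.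
exists (exist _ T ST); split=> // c cs; rewrite /= TF; exact: (memF c cs).2.
Qed.

Lemma standard_labeling : exists phi : standard_graph lam -> seq nat,
  [/\ labeling (@gsig _ (standard_graph lam)) (@gedge _ (standard_graph lam)) n phi,
      injective phi, forall T r, cnt (phi T) r = L r &
      forall w, adm w -> size w = n -> (forall r, cnt w r = L r) -> exists T, phi T = w].
Proof.
have /fin_all_exists[phi Hphi] := row_word_exists.
exists phi.
have lift w : adm w -> size w = n -> (forall r, cnt w r = L r) -> exists T, phi T = w.
  move=> A s C; have [T HT] := row_word_lift A s C; exists T; exact: row_word_uniq (Hphi T) HT.
have Iphi : injective phi by move=> T U e; apply: row_word_inj (Hphi T) _; rewrite e.
have rd T := row_word_reads (Hphi T).
have sz T : size (phi T) = n by have [] := Hphi T.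
have step k T : k.+4 <= n -> exists2 U, phi U = hop k (phi T) & reading_word U = h k.+1 (reading_word T).
  move=> kn; have [|||U eU] := lift (hop k (phi T)).
  - by apply/adm_hop/(row_word_adm (Hphi T)).
  - by rewrite size_hop.
  - by move=> r; rewrite (cnt_perm (hop_perm _ _)); apply: row_word_cnt (Hphi T).
  exists U => //; have := rd U; rewrite eU => rU; apply: reads_eq rU _.
  by apply: (@reads_h _ _ k.+1) => //; rewrite ?sz //; move: kn; clia.
split=> //; last by move=> T r; apply: row_word_cnt (Hphi T).
split=> //.
- by move=> T; apply: row_word_adm (Hphi T).
- move=> T k kn; rewrite /gsig /= /peak /after /pk.
  have i1 := @reads_index _ _ k.+1 k.+2 (rd T); have i2 := @reads_index _ _ k.+2 k.+3 (rd T).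
  rewrite sz /= in i1 i2; rewrite /= i1 //; last by move: kn; clia.
  have {}i2 := i2 isT (leqnn _) kn.
  have ne : index k.+2 (reading_word T) != index k.+3 (reading_word T).
    have [_ m] := rd T; have m2 : k.+2 \in reading_word T by rewrite m sz; move: kn; clia.
    have m3 : k.+3 \in reading_word T by rewrite m sz.
    by apply/eqP => e; have := nth_index 0 m2; rewrite e nth_index // => /eqP; rewrite eqSS -addn1 -{2}(addn0 k) eqn_add2l.
  by move: i2 ne kn; clia.
- move=> k T U kn /and3P[_ TU e].
  have {}e : phi U = hop k (phi T).
    case/orP: e => /eqP e.
      by have [U' eU rU] := step _ T kn; rewrite -eU; congr phi; apply: reading_word_inj; rewrite rU.
    have [U' eU rU] := step _ U kn; have -> : T = U' by apply: reading_word_inj; rewrite rU.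
    by rewrite eU hopK.
  by split=> // /Iphi e2; rewrite e2 eqxx in TU.
- move=> k T kn ne; have [U eU rU] := step _ T kn; exists U; apply/and3P; split.
  + by move: kn; clia.
  + by apply/eqP => e; apply: ne; rewrite -eU e.
  + by rewrite rU eqxx.
Qed.

End Tableaux.

(** * Labelings of signed colored graphs *)

Lemma labeling_ext V m (sig sig' : V -> nat -> bool) (E E' : nat -> V -> V -> bool) f :
  (forall v k, k.+3 <= m -> sig v k = sig' v k) -> (forall k u v, k.+4 <= m -> E k u v = E' k u v) ->
  labeling sig E m f /\ faithful E m f -> labeling sig' E' m f /\ faithful E' m f.
Proof.
move=> S H [[A Z s e l] F]; split; last first.
  move=> u v uv; apply: F; elim: uv => [|x y k _ IH k0 km xy]; first exact: ConRefl.
  by apply: (ConStep IH k0 km); rewrite H.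
split=> // [v k km|k u v km|k u km ne]; first by rewrite -S // s.
  by rewrite -H //; apply: e.
by have [v uv] := l k u km ne; exists v; rewrite -H.
Qed.

Section Graph.
Variable m : nat.
Implicit Types G H : scgraph m.

Lemma gedge_sym G k (u v : G) : gedge k u v -> gedge k v u.
Proof. exact: edge_sym. Qed.

Lemma edge_gedge G i (u v : G) : edge i u v -> exists k, [/\ i = k.+1, k.+4 <= m & gedge k u v].
Proof.
move=> e; have := edge_color e => im; exists i.-1; case: i e im => // k e im.
by split=> //; move: im; clia.
Qed.

Lemma con_connect G (u v : G) : con (@gedge m G) 0 m u v <-> connect (@adjacent m G) u v.
Proof.
split.
  elim=> // x y k _ ux _ km xy; apply: connect_trans ux _; apply: connect1.
  by apply/hasP; exists k.+1 => //; rewrite mem_iota; move: km; clia.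
case/connectP => s; elim/last_ind: s v => [|s x IH] v; first by move=> _ ->; exact: ConRefl.
rewrite rcons_path last_rcons => /andP[/IH/(_ erefl) us /hasP[i _ /edge_gedge[k [_ km lx]]]] ->.
exact: ConStep us _ km lx.
Qed.

Definition labeled G (f : G -> seq nat) : Prop :=
  labeling (@gsig m G) (@gedge m G) m f /\ faithful (@gedge m G) m f.

Lemma label_sig G H f g (x : G) (y : H) : labeled f -> labeled g -> f x = g y -> signature x =1 signature y.
Proof.
move=> [Lf _] [Lg _] e s; case: s => [|[|k]]; try by apply/idP/idP => /sig_bounds.
have [km|mk] := leqP k.+3 m.
  by have := lab_sig Lf x km; have := lab_sig Lg y km; rewrite /gsig e => -> ->.
by apply/idP/idP => /sig_bounds/andP[_]; move: mk; clia.
Qed.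

(** Inside a component the label determines the vertex, its signature and its edges, and every
    tableau of the shape occurs; so it is enough to preserve labels and to match the components. *)
Lemma labeled_isomorphic G H f g (F : G -> H) : labeled f -> labeled g -> (forall x, g (F x) = f x) ->
  (forall x y, con (@gedge m G) 0 m x y <-> con (@gedge m H) 0 m (F x) (F y)) ->
  (forall y, exists x, con (@gedge m H) 0 m (F x) y) -> isomorphic G H.
Proof.
move=> lf lg gF conF surj; have [[Lf Ff] [Lg Fg]] := (lf, lg).
have injF : injective F.
  by move=> x y e; apply: Ff; [apply/conF; rewrite e; exact: ConRefl|rewrite -!gF e].
have /fin_all_exists[F' F'K] : forall y, exists x, F x = y.
  move=> y; have [x xy] := surj y.
  have [|x' xx' e] := exists_label Lf (u := x) (lab_adm Lg y).
    by rewrite -gF; exact: (con_perm Lg (leqnn m) xy).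
  exists x'; apply: Fg; last by rewrite gF.
  by apply: con_trans xy; apply/conF; apply: con_sym xx'; exact: gedge_sym.
have sigF x : signature (F x) =1 signature x by apply: (label_sig lg lf).
have edgeF i x y : edge i (F x) (F y) = edge i x y.
  apply/idP/idP => /edge_gedge[k [-> km xy]].
    have [e ne] := lab_edge Lg km xy; rewrite !gF in e ne.
    have [|z xz] := lab_lift Lf km (u := x); first by rewrite -e.
    have [ez _] := lab_edge Lf km xz; suff <- : z = y by [].
    apply: Ff; last by rewrite e ez.
    apply: con_trans (con1 (leq0n _) km (gedge_sym xz)) _; apply/conF; exact: con1 (leq0n _) km xy.
  have [e ne] := lab_edge Lf km xy; rewrite -!gF in e ne.
  have [|z xz] := lab_lift Lg km (u := F x); first by rewrite -e.
  have [ez _] := lab_edge Lg km xz; suff <- : z = F y by [].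
  apply: Fg; last by rewrite e ez.
  apply: con_trans (con1 (leq0n _) km (gedge_sym xz)) _; apply/conF; exact: con1 (leq0n _) km xy.
exists F, F'; split=> //; first by move=> x; apply: injF.
  by split=> [v|i u v]; [exact: sigF|rewrite edgeF].
by split=> [v s|i u v]; [rewrite -[in RHS](F'K v) sigF|rewrite -edgeF !F'K].
Qed.

Lemma label_component G f (v : G) : labeled f ->
  labeled (fun x : component v => f (val x)) /\
  forall x y : component v, con (@gedge m (component v)) 0 m x y.
Proof.
move=> [Lf Ff]; have lift (x : component v) w : con (@gedge m G) 0 m (val x) w ->
    exists2 y, con (@gedge m (component v)) 0 m x y & val y = w.
  elim=> [|a b k _ [y xy ya] _ km ab]; first by exists x => //; exact: ConRefl.
  have vb : connect (@adjacent m G) v b.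
    apply: (connect_trans (valP y)); apply/con_connect; rewrite ya; exact: con1 (leq0n _) km ab.
  by exists (exist _ b vb) => //; apply: (ConStep xy (leq0n _) km); rewrite /gedge /= /component_edge ya.
have down (x y : component v) : con (@gedge m (component v)) 0 m x y -> con (@gedge m G) 0 m (val x) (val y).
  by elim=> [|a b k _ IH _ km ab]; [exact: ConRefl|apply: ConStep IH _ km ab].
split; last first.
  move=> x y; have [|z xz /val_inj <-] := lift x (val y); last exact: xz.
  apply: con_trans (_ : con _ _ _ _ v) _; last by apply/con_connect; exact: valP y.
  by apply: con_sym; [exact: gedge_sym|apply/con_connect; exact: valP x].
split; last by move=> x y /down xy e; apply: val_inj; apply: Ff.
split=> [x|x|x k km|k x y km xy|k x km ne].
- exact: (lab_adm Lf _).
- exact: (lab_size Lf _).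
- exact: (lab_sig Lf (val x) km).
- exact: (lab_edge Lf km xy).
have [w xw] := lab_lift Lf km ne.
have [y _ yw] := lift x w (con1 (leq0n _) km xw).
by exists y; rewrite /gedge /= /component_edge yw.
Qed.

Lemma label_exists G : (forall v : G, exists f : component v -> seq nat, labeled f) -> exists f : G -> seq nat, labeled f.
Proof.
move=> /fin_all_exists[phi Hphi].
have sc : connect_sym (@adjacent m G).
  move=> x y; apply/idP/idP => /con_connect c; apply/con_connect; apply: con_sym c; exact: gedge_sym.
pose r := root (@adjacent m G).
have cr x : connect (@adjacent m G) (r x) x by rewrite sc; exact: connect_root.
have rE x y : con (@gedge m G) 0 m x y -> r x = r y by move/con_connect => c; apply/(rootP sc).
(* The default [[::]] is never met: [at_ u v] is evaluated only for [v] connected to [u]. *)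
pose at_ u v : seq nat := if insub v is Some x then phi u x else [::].
have atE u v (c : connect (@adjacent m G) u v) : at_ u v = phi u (exist _ v c).
  by rewrite /at_ (insubT (fun v => connect (@adjacent m G) u v) c).
pose f v := at_ (r v) v; exists f.
have fE v : exists c : connect (@adjacent m G) (r v) v, f v = phi (r v) (exist _ v c).
  by exists (cr v); rewrite /f atE.
split; last first.
  move=> x y xy; rewrite /f -(rE _ _ xy); have cy : connect (@adjacent m G) (r x) y by rewrite (rE _ _ xy).
  rewrite (atE _ _ (cr x)) (atE _ _ cy) => e.
  have [Lr Fr] := Hphi (r x).
  have [z c1 e1] : exists2 z : component (r x), con (@gedge m (component (r x))) 0 m (exist _ x (cr x)) z & val z = y.
    elim: xy {e cy} => [|a b k _ [z xz za] _ km ab]; first by exists (exist _ x (cr x)) => //; exact: ConRefl.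
    have cb : connect (@adjacent m G) (r x) b.
      apply: (connect_trans (valP z)); apply/con_connect; rewrite za; exact: con1 (leq0n _) km ab.
    by exists (exist _ b cb) => //; apply: (ConStep xz (leq0n _) km); rewrite /gedge /= /component_edge za.
  have := Fr _ _ c1; have -> : z = exist _ y cy by apply: val_inj.
  by move/(_ e)/(congr1 val).
split=> [x|x|x k km|k x y km xy|k x km].
- by have [c ->] := fE x; apply: (lab_adm (Hphi _).1 _).
- by have [c ->] := fE x; apply: (lab_size (Hphi _).1 _).
- by have [c ->] := fE x; apply: (lab_sig (Hphi _).1 (exist _ x c) km).
- have rxy := rE _ _ (con1 (leq0n _) km xy); rewrite /f -rxy.
  have cy : connect (@adjacent m G) (r x) y by rewrite rxy.
  rewrite (atE _ _ (cr x)) (atE _ _ cy); apply: (lab_edge (Hphi _).1 km).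
  exact: xy.
- have [c ->] := fE x => /(lab_lift (Hphi _).1 km)[y xy]; exists (val y); exact: xy.
Qed.

End Graph.

Section Shape.

Lemma sumn_count (w : seq nat) k : all (fun x => x < k) w -> sumn (mkseq (fun r => count_mem r w) k) = size w.
Proof.
elim: w => [|a w IH] /=; first by rewrite /mkseq sumnE big_map big1.
case/andP=> ak /IH <-; rewrite /mkseq !sumnE !big_map big_split /=; rewrite -add1n; congr (_ + _).
rewrite (bigD1_seq a) ?iota_uniq ?mem_iota //= eqxx big1 // => i; rewrite eq_sym => /negbTE ->.
by [].
Qed.

Lemma shape_exists w : adm w -> exists lam : strict_part (size w), forall r, cnt w r = nth 0 lam r.
Proof.
move=> A; have S := strict_cnt A.
have z : exists k, cnt w k == 0.
  exists (\max_(x <- w) x).+1; rewrite cntE; apply/eqP/count_memPn/negP => h.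
  have := @leq_bigmax_seq _ _ xpredT id _ h isT; by rewrite ltnn.
have [k /eqP k0 kmin] := ex_minnP z.
have pos r : r < k -> 0 < cnt w r by move=> rk; rewrite lt0n; apply/negP => /kmin; move: rk; clia.
have zero r : k <= r -> cnt w r = 0.
  move=> kr; apply/eqP; rewrite -leqn0 leqNgt; apply/negP => /(strict_gt0 S kr).
  by rewrite k0.
have dec : sorted gtn (mkseq (cnt w) k).
  apply/(sortedP 0) => i; rewrite size_mkseq => ik; rewrite !nth_mkseq //; last by apply: leq_trans ik.
  by case: (S i) => // e; have := pos _ ik; rewrite e.
have ps : all (leq 1) (mkseq (cnt w) k).
  by apply/allP => x /mapP[r]; rewrite mem_iota add0n => /andP[_ rk] ->; apply: pos.
have sum : sumn (mkseq (cnt w) k) = size w.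
  have -> : mkseq (cnt w) k = mkseq (fun r => count_mem r w) k by apply: eq_mkseq => r; exact: cntE.
  apply: sumn_count; apply/allP => x xw; rewrite ltnNge; apply/negP => /zero.
  by rewrite cntE => /count_memPn; rewrite xw.
exists (StrictPart dec ps sum) => r /=.
have [rk|kr] := ltnP r k; first by rewrite nth_mkseq.
by rewrite zero // nth_default // size_mkseq.
Qed.

End Shape.

Lemma standard_labeled n (lam : strict_part n) : exists phi : standard_graph lam -> seq nat,
  [/\ labeled phi, injective phi, forall T r, cnt (phi T) r = nth 0 lam r,
      forall T U, con (@gedge n (standard_graph lam)) 0 n T U &
      forall w, adm w -> size w = n -> (forall r, cnt w r = nth 0 lam r) -> exists T, phi T = w].
Proof.
have [phi [Lp Ip cp sp]] := standard_labeling lam; exists phi.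
split=> //; first by split=> // T U _; apply: Ip.
move=> T U; have [|V TV /Ip <-] := exists_label Lp (u := T) (lab_adm Lp U); last exact: TV.
by apply: perm_cnt; apply: functional_extensionality => r; rewrite !cp.
Qed.

Lemma component_standard n (G : scgraph n) (f : G -> seq nat) (v : G) : labeled f ->
  exists lam : strict_part n, isomorphic (component v) (standard_graph lam).
Proof.
move=> lf; have [lc conc] := label_component v lf; have [Lf _] := lf.
have := shape_exists (lab_adm Lf v); rewrite (lab_size Lf) => -[lam Hlam]; exists lam.
have [phi [lp Ip cp conp sp]] := standard_labeled lam.
have /fin_all_exists[F HF] : forall x : component v, exists T, phi T = f (val x).
  move=> x; apply: sp; [exact: (lab_adm Lf _)|exact: (lab_size Lf _)|move=> r; rewrite -Hlam].
  have vx : con (@gedge n G) 0 n v (val x) by apply/con_connect; exact: valP x.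
  by rewrite (cnt_perm (con_perm Lf (leqnn _) vx)).
apply: (labeled_isomorphic (F := F) lc lp) => // y.
have v0 : connect (@adjacent n G) v v by [].
by exists (exist _ v v0); exact: conp.
Qed.

Lemma isomorphic_labeled m (G H : scgraph m) : isomorphic G H ->
  (exists g : H -> seq nat, labeled g) -> exists f : G -> seq nat, labeled f.
Proof.
move=> [F [F' [FK F'K [sF eF] [sF' eF']]]] [g [Lg Fg]]; exists (g \o F); split; last first.
  move=> x y xy e; apply: (can_inj FK); apply: Fg e.
  elim: xy => [|a b k _ IH _ km ab]; first exact: ConRefl.
  by apply: (ConStep IH (leq0n _) km); apply: eF.
split=> [x|x|x k km|k x y km xy|k x km ne] /=.
- exact: (lab_adm Lg _).
- exact: (lab_size Lg _).
- by rewrite -(lab_sig Lg) // /gsig sF.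
- by apply: (lab_edge Lg km); apply: eF.
have [y xy] := lab_lift Lg km ne; exists (F' y).
by rewrite -(FK x); apply: eF'.
Qed.

Lemma union_labeled n (J : finType) (lam : J -> strict_part n)
    (U := disjoint_union (fun j => standard_graph (lam j))) :
  exists Phi : U -> seq nat,
  [/\ labeled Phi, forall a b, con (@gedge n U) 0 n a b <-> tag a = tag b,
      forall a r, cnt (Phi a) r = nth 0 (lam (tag a)) r &
      forall j w, adm w -> size w = n -> (forall r, cnt w r = nth 0 (lam j) r) ->
        exists a, tag a = j /\ Phi a = w].
Proof.
have /fin_all_exists[phi Hphi] := fun j => standard_labeled (lam j).
exists (fun u => phi (tag u) (tagged u)).
have conU a b : con (@gedge n U) 0 n a b <-> tag a = tag b.
  split; first by elim=> // x y k _ -> _ _ /andP[/eqP].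
  case: a b => [j x] [j' y] /= e; subst j'; have [_ _ _ conp _] := Hphi j.
  elim: (conp x y) => [|z t k _ IH _ km zt]; first exact: ConRefl.
  by apply: (ConStep IH (leq0n _) km); rewrite /gedge /= /union_edge /= tagged_asE eqxx.
split=> //; last 2 first.
- by move=> [j x] r; have [_ _ cp _ _] := Hphi j; apply: cp.
- move=> j w A s C; have [_ _ _ _ sp] := Hphi j; have [T e] := sp w A s C.
  by exists (existT _ j T).
split; last first.
  move=> [j x] [j' y] /conU /= e; subst j'; have [_ Ip _ _ _] := Hphi j.
  by move/Ip ->.
split=> [[j x]|[j x]|[j x] k km|k [j x] [j' y] km|k [j x] km ne]; have [[Lp _] Ip _ _ _] := Hphi j.
- exact: (lab_adm Lp x).
- exact: (lab_size Lp x).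
- exact: (lab_sig Lp x km).
- move=> /andP[/eqP /= e]; subst j'; rewrite tagged_asE; exact: (lab_edge Lp km).
have [y xy] := lab_lift Lp km ne; exists (existT _ j y).
by rewrite /gedge /= /union_edge /= tagged_asE eqxx.
Qed.

(** For the converse, the summands are indexed by the roots of the components, each with the shape
    of the labels found in its component. *)
Lemma is_sdeg_labeled n (G : scgraph n) : is_sdeg G <-> exists f : G -> seq nat, labeled f.
Proof.
split.
  move=> [J [lam /isomorphic_labeled H]]; apply: H.
  by have [Phi [lP _ _ _]] := union_labeled lam; exists Phi.
move=> [f lf]; have [Lf Ff] := lf.
have sc : connect_sym (@adjacent n G).
  move=> x y; apply/idP/idP => /con_connect c; apply/con_connect; apply: con_sym c; exact: gedge_sym.
pose J : finType := {x : G | roots (@adjacent n G) x}.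
have /fin_all_exists[lam Hlam] : forall j : J, exists lam : strict_part n,
    forall r, cnt (f (val j)) r = nth 0 lam r.
  by move=> j; have := shape_exists (lab_adm Lf (val j)); rewrite (lab_size Lf).
exists J, lam; have [Phi [lP conP cP sP]] := union_labeled lam.
pose rt x : J := exist (fun x => is_true (roots (@adjacent n G) x)) _ (roots_root sc x).
have rtE x y : con (@gedge n G) 0 n x y <-> rt x = rt y.
  split; first by move/con_connect => c; apply: val_inj; apply/(rootP sc).
  by move/(congr1 val) => e; apply/con_connect; apply/(rootP sc).
have rtK (j : J) : rt (val j) = j by apply: val_inj; exact/eqP/(valP j).
have /fin_all_exists[F HF] : forall x, exists a, tag a = rt x /\ Phi a = f x.
  move=> x; apply: sP; [exact: (lab_adm Lf)|exact: (lab_size Lf)|move=> r; rewrite -Hlam].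
  have c : con (@gedge n G) 0 n x (val (rt x)) by apply/rtE; rewrite rtK.
  by rewrite (cnt_perm (con_perm Lf (leqnn n) c)).
apply: (@labeled_isomorphic n G (disjoint_union (fun j => standard_graph (lam j))) f Phi F lf lP).
- by move=> x; case: (HF x).
  move=> x y; split=> [/rtE e|/conP].
    by apply/conP; rewrite (HF x).1 (HF y).1.
  by rewrite (HF x).1 (HF y).1 => /rtE.
by move=> a; exists (val (tag a)); apply/conP; rewrite (HF _).1 rtK.
Qed.

Lemma restrict_labeled n (G : scgraph n) a m f : 
  labeled (f : restrict G a.+1 (a + m) -> seq nat) <->
  labeling (fun v k => gsig (v : G) (a + k)) (fun k => @gedge n G (a + k)) m f /\
    faithful (fun k => @gedge n G (a + k)) m f.
Proof.
set W := _ /\ _; have em : (a + m).+1 - a.+1 = m by rewrite subSS addKn.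
have -> : W = (labeling (fun v k => gsig (v : G) (a + k)) (fun k => @gedge n G (a + k)) ((a + m).+1 - a.+1) f /\
    faithful (fun k => @gedge n G (a + k)) ((a + m).+1 - a.+1) f) by rewrite /W em.
have S v k : k.+3 <= (a + m).+1 - a.+1 -> gsig (v : restrict G a.+1 (a + m)) k = gsig (v : G) (a + k).
  move=> km; rewrite /gsig /= /restrict_sig km /=.
  by congr signature; clia.
have H k u v : k.+4 <= (a + m).+1 - a.+1 -> @gedge _ (restrict G a.+1 (a + m)) k u v = @gedge n G (a + k) u v.
  move=> km; rewrite /gedge /= /restrict_edge.
  have -> : 0 < k.+1 <= (a + m).+1 - a.+1 - 3 by move: km; clia.
  by rewrite andTb; congr edge; clia.
by split; apply: labeling_ext => *; rewrite ?S ?H.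
Qed.

Theorem theorem1p4 (n : nat) (G : scgraph n) :
  is_sdeg G <->
  (forall a b : nat, 1 <= a -> a <= b -> b <= n -> b.+1 - a <= 9 ->
     forall v : restrict G a b,
       exists (m : nat) (lam : strict_part m),
         m <= b.+1 - a /\ isomorphic_deg (component v) (standard_graph lam))
  /\
  (forall i j : nat, i + 3 < j \/ j + 3 < i ->
     forall u v w : G, edge i u v -> edge j u w ->
       exists y : G, edge j v y /\ edge i w y).
Proof.
rewrite is_sdeg_labeled; split.
  move=> [f [Lf Ff]]; split.
    case=> // a b _ ab bn _ v; have [m eb] : exists m, b = a + m by exists (b - a); rewrite subnKC // ltnW.
    subst b; have [g lg] := labeling_window Lf Ff bn.
    have [lam iso] := component_standard v (proj2 (restrict_labeled _) lg).
    exists ((a + m).+1 - a.+1), lam; split=> //; by exists erefl.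
  move=> i j ij u v w /edge_gedge[k [ei kn uv]] /edge_gedge[l [el ln uw]].
  subst i j; have [||y vy wy] := labeling_com Lf Ff _ _ kn ln uv uw; last by exists y.
    by move=> *; apply: gedge_sym.
  by move: ij; clia.
move=> [loc com]; apply: (local_to_global (E := @gedge n G)).
- by move=> *; apply: gedge_sym.
- move=> k l u v w kl ln uv uw.
  by have [|y [vy wy]] := com k.+1 l.+1 _ u v w uv uw; [move: kl; clia|exists y].
(* The local property speaks of nonempty intervals only. *)
move=> a [|m] m9 am; first by exists (fun=> [::]); apply: labeling0.
have [|f] := @label_exists _ (restrict G a.+1 (a + m.+1)).
  have ab : a.+1 <= a + m.+1 by rewrite addnS leq_addr.
  have b9 : (a + m.+1).+1 - a.+1 <= 9 by rewrite subSS addKn.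
  (* An isomorphism requires equal degrees, so the size of [lam] is that of the interval. *)
  move=> v; have [m' [lam [_ [e iso]]]] := loc a.+1 (a + m.+1) isT ab am b9 v.
  subst m'; apply: isomorphic_labeled iso _.
  by have [phi [lp _ _ _ _]] := standard_labeled lam; exists phi.
by move/restrict_labeled => H; exists f.
Qed.
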